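(* Suppose that $f^{(s)}+k^{(s)}\in L^1(0,T;X)$ and $f^{(s+1)}+k^{(s+1)}\in L^1(0,T;X)$ (time derivatives), that the underlying quadrature rule is of order $s+1$, i.e. $$\sum_{i=1}^sb_i(0)c_i^{j-1}=\frac1j,\qquad 1\le j\le s+1,$$ and that there is $\kappa>0$ such that the step sizes satisfy $\tau_j\le\kappa\,\tau_{j+1}$ for $0\le j\le N-2$. Then the $s$-stage method $$u_{n+1}=\mathrm{e}^{\tau_nA}\bigl(u_n-z(t_n)\bigr)+z(t_{n+1})+\tau_n\sum_{i=1}^s b_i(\tau_nA)\bigl(f(t_n+c_i\tau_n)+k(t_n+c_i\tau_n)\bigr),\qquad 0\le n\le N-1,$$ started from $u_0$ and applied to the problem $\partial_tu=Du+f(t)$, $Bu=b(t)$, $u(0)=u_0$ on $[0,T]$, satisfies $$\begin{aligned}\|u_n-u(t_n)\|\le{}& C\sum_{j=0}^{n-1}\tau_j^{s+1}\int_{t_j}^{t_{j+1}}\bigl\|f^{(s+1)}(\xi)+k^{(s+1)}(\xi)\bigr\|\,d\xi+C\tau_{n-1}^{s+1}\bigl\|f^{(s)}+k^{(s)}\bigr\|_\infty\\&+C\kappa\sum_{j=0}^{n-2}\tau_j^{s+1}\bigl((t_n-t_{j+1})^{-1}\tau_j\bigr)\bigl\|f^{(s)}+k^{(s)}\bigr\|_\infty\end{aligned}$$ for all $n\ge1$ with $0\le t_n\le T$. The constant $C$ depends on $T$, but is independent of $n$ and of $\{\tau_n\}_{n=0}^{N-1}$.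
   Context: **Problem.** $(X,\|\cdot\|)$ is a Banach space of functions on a domain $\Omega\subset\mathbb{R}^d$, $D$ is a strongly elliptic linear differential operator with smooth coefficients, $B$ is a linear boundary operator (Dirichlet, Neumann or mixed boundary conditions), and $u=u(t)$ (dependence on $x\in\Omega$ suppressed) denotes the exact solution on $[0,T]$ of $$\partial_tu=Du+f(t),\qquad Bu=b(t),\qquad u(0)=u_0 .$$ **Correction.** $z=z(t,x)$ is a smooth function with $Bz=b$, and $k:=Dz-\partial_tz$. The function $w=u-z$ satisfies $Bw=0$. **Operator.** $A$ is the restriction of $D$ to functions satisfying $Bu=0$, with domain $D(A)\subset X$. It is assumed that $A$ is sectorial: $A$ is densely defined and closed on $X$ and there are $M\ge1$, $a\in\mathbb{R}$, $\pi/2<\theta<\pi$ with $\|(\lambda I-A)^{-1}\|\le M/|\lambda-a|$ for all $\lambda\in\mathbb{C}$ with $\lambda\ne a$, $|\arg(\lambda-a)|\le\theta$. Thus $A$ generates an analytic semigroup $\{\mathrm{e}^{tA}\}_{t\ge0}$, and $w$ is the solution of the abstract problem $w'(t)=Aw(t)+f(t)+k(t)$, $w(0)=u_0-z(0)$, i.e. $w(t)=\mathrm{e}^{tA}w(0)+\int_0^t\mathrm{e}^{(t-\xi)A}(f(\xi)+k(\xi))\,d\xi$. **$\varphi$-functions.** $\varphi_0(\zeta)=\mathrm{e}^\zeta$, $\varphi_j(\zeta)=\bigl(\varphi_{j-1}(\zeta)-\frac1{(j-1)!}\bigr)/\zeta$ for $j\ge1$; for operators, $\varphi_j(\tau A)=\tau^{-j}\int_0^\tau\mathrm{e}^{(\tau-\xi)A}\frac{\xi^{j-1}}{(j-1)!}\,d\xi$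 for $j\ge1$, $\tau>0$. In particular $\varphi_j(0)=1/j!$. **Quadrature rule.** The nodes $c_1,\dots,c_s\in[0,1]$ are pairwise distinct and the weights $b_1(\tau A),\dots,b_s(\tau A)$ are the linear combinations of $\varphi_1(\tau A),\dots,\varphi_s(\tau A)$ uniquely determined by the order conditions $$\frac1{(j-1)!}\sum_{i=1}^sb_i(\tau A)c_i^{j-1}=\varphi_j(\tau A),\qquad j=1,\dots,s.$$ The numbers $b_i(0)$ are the values at $0$ of the corresponding scalar functions. **Grid.** $\tau_n>0$, $t_0=0$, $t_{n+1}=t_n+\tau_n$ for $n=0,\dots,N-1$, $t_N=T$. **Norm.** For $v:[0,T]\to X$, $\|v\|_\infty=\max_{0\le t\le T}\|v(t)\|$. Empty sums are zero. *)

(* Defs.v *)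
(* MathComp / MathComp-Analysis *)
From HB Require Import structures.
From mathcomp Require Import all_boot all_order all_algebra.
From mathcomp Require Import all_classical all_reals all_analysis.
From mathcomp Require Import complex.

Set Implicit Arguments.
Unset Strict Implicit.
Unset Printing Implicit Defensive.

Import Order.TTheory GRing.Theory Num.Theory.
Import numFieldNormedType.Exports.

Local Open Scope classical_set_scope.
Local Open Scope complex_scope.
Local Open Scope ring_scope.

Section BanachSpace.
Variables (R : realType) (X : completeNormedModType R[i]).

(* The norm of a normed module over R[i] takes its values in R[i]. *)
Definition nrm (x : X) : R := complex.Re `|x|.

Definition supnorm (T : R) (v : R -> X) : R := sup [set nrm (v t) | t in `[0, T]].

(* [v] is the derivative at [t] of the curve [z] on [0, T] (one-sided at the
   end points). *)
Definition curve_deriv (T : R) (z : R -> X) (t : R) (v : X) : Prop :=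
  ((t' - t)^-1)%:C *: (z t' - z t) @[t' --> within `[0, T] t^'] --> v.

Definition smooth_curve (T : R) (z : R -> X) : Prop :=
  exists Z : nat -> R -> X, Z 0%N = z /\
    forall n t, t \in `[0, T] -> curve_deriv T (Z n) t (Z n.+1 t).

Definition simple_fun (m : nat) (A : nat -> set R) (x : nat -> X) (t : R) : X :=
  \sum_(i < m) (\1_(A i) t : R[i]) *: x i.

Definition simple_int (m : nat) (A : nat -> set R) (x : nat -> X) : X :=
  \sum_(i < m) (fine (lebesgue_measure (A i)))%:C *: x i.

(* Bochner integral: [g] is Bochner integrable on [a, b] (i.e. strongly
   measurable with integrable norm) and its integral is [v]. *)
Definition is_bochner (a b : R) (g : R -> X) (v : X) : Prop :=
  exists (m : nat -> nat) (A : nat -> nat -> set R) (x : nat -> nat -> X),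
    [/\ forall n i, measurable (A n i) /\ A n i `<=` `[a, b],
        {ae lebesgue_measure, forall t : R, a <= t <= b ->
           simple_fun (m n) (A n) (x n) t @[n --> \oo] --> g t},
        (\int[lebesgue_measure]_(t in `[a, b])
           (nrm (g t - simple_fun (m n) (A n) (x n) t))%:E)%E
          @[n --> \oo] --> 0%:E &
        simple_int (m n) (A n) (x n) @[n --> \oo] --> v].

Definition bochner_integrable (a b : R) (g : R -> X) : Prop :=
  exists v, is_bochner a b g v.

Definition bochner (a b : R) (g : R -> X) : X := xget 0 (is_bochner a b g).

(* [h] is the time derivative of [g] in the sense of W^{1,1}(0, T; X), [g]
   being the absolutely continuous representative. *)
Definition sobolev_deriv (T : R) (g h : R -> X) : Prop :=
  forall t, t \in `[0, T] -> is_bochner 0 t h (g t - g 0).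

Definition linear_on (Y : lmodType R[i]) (dom : set X) (L : X -> Y) : Prop :=
  dom 0 /\
  forall (a : R[i]) u v, dom u -> dom v ->
    dom (a *: u + v) /\ L (a *: u + v) = a *: L u + L v.

(* Unbounded operators are given by their domain [dA] and a total function [A]
   which is only meaningful on [dA]. *)
Definition closed_op (dA : set X) (A : X -> X) : Prop :=
  closed [set p : X * X | dA p.1 /\ p.2 = A p.1].

Definition is_resolvent (dA : set X) (A : X -> X) (lambda : R[i])
    (Rl : X -> X) : Prop :=
  (forall x, dA (Rl x) /\ lambda *: Rl x - A (Rl x) = x) /\
  (forall u, dA u -> Rl (lambda *: u - A u) = u).

(* The points lambda <> a with |arg (lambda - a)| <= theta are written
   lambda = a + r (cos w + i sin w) with r > 0 and |w| <= theta. *)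
Definition sectorial (dA : set X) (A : X -> X) : Prop :=
  [/\ closure dA = [set: X], closed_op dA A &
      exists (M a theta : R),
        [/\ 1 <= M, pi / 2 < theta, theta < pi &
          forall r w : R, 0 < r -> `|w| <= theta ->
            exists Rl : X -> X,
              is_resolvent dA A (a%:C + r%:C * (cos w +i* sin w)) Rl /\
              forall x, nrm (Rl x) <= M / r * nrm x]].

(* [S t] is exp(tA): [S] is the strongly continuous semigroup with generator
   [A] (generator and domain included). *)
Definition is_semigroup_of (dA : set X) (A : X -> X) (S : R -> X -> X) : Prop :=
  [/\ forall t, 0 <= t -> linear_on [set: X] (S t) /\
        exists K : R, forall x, nrm (S t x) <= K * nrm x,
      forall x, S 0 x = x,
      forall t t' x, 0 <= t -> 0 <= t' -> S (t + t') x = S t (S t' x),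
      forall x, S t x @[t --> 0^'+] --> x &
      forall x y, (dA x /\ A x = y) <->
        ((h^-1)%:C *: (S h x - x) @[h --> (0 : R)^'+] --> y)].

(* w' = A w + g, w(0) = w0, by variation of constants *)
Definition mild_solution (S : R -> X -> X) (T : R) (g : R -> X) (w0 : X)
    (w : R -> X) : Prop :=
  forall t, t \in `[0, T] ->
    is_bochner 0 t (fun xi => S (t - xi) (g xi)) (w t - S t w0).

Definition phi_op (S : R -> X -> X) (j : nat) (tau : R) (x : X) : X :=
  if j is j'.+1 then
    (tau ^- j)%:C *:
      bochner 0 tau (fun xi => (xi ^+ j' / j'`!%:R)%:C *: S (tau - xi) x)
  else S tau x.

End BanachSpace.

Section QuadratureWeights.
Variables (R : realType) (s : nat).

Definition cexp (z : R[i]) : R[i] :=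
  (expR (complex.Re z))%:C * (cos (complex.Im z) +i* sin (complex.Im z)).

Fixpoint phi (j : nat) (z : R[i]) : R[i] :=
  if z == 0 then (j`!%:R)^-1
  else if j is j'.+1 then (phi j' z - (j'`!%:R)^-1) / z
  else cexp z.

(* [beta i l] is the coefficient of phi_(l+1) in the weight b_i. *)
Definition weight (beta : 'M[R[i]]_s) (i : 'I_s) (z : R[i]) : R[i] :=
  \sum_(l < s) beta i l * phi l.+1 z.

Definition weight_op (X : completeNormedModType R[i]) (S : R -> X -> X)
    (beta : 'M[R[i]]_s) (i : 'I_s) (tau : R) (x : X) : X :=
  \sum_(l < s) beta i l *: phi_op S l.+1 tau x.

(* As an identity between functions of z, this determines [beta], because
   phi_1, ..., phi_s are linearly independent; inserting z = tau A gives the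
   operator identity. *)
Definition order_conditions (c : 'I_s -> R) (beta : 'M[R[i]]_s) : Prop :=
  forall (j : nat) (z : R[i]), (1 <= j <= s)%N ->
    (j.-1`!%:R)^-1 * \sum_(i < s) weight beta i z * (c i)%:C ^+ j.-1 = phi j z.

Definition quadrature_order (c : 'I_s -> R) (beta : 'M[R[i]]_s) (p : nat) : Prop :=
  forall j : nat, (1 <= j <= p)%N ->
    \sum_(i < s) weight beta i 0 * (c i)%:C ^+ j.-1 = j%:R^-1.

End QuadratureWeights.

Definition grid (R : realType) (tau : nat -> R) (n : nat) : R :=
  \sum_(i < n) tau i.

Section FunctionsOnDomain.
Variable R : realType.

(* Lebesgue integral over R^d as an iterated integral *)
Fixpoint leb_int (d : nat) : ('rV[R]_d -> \bar R) -> \bar R :=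
  match d return ('rV[R]_d -> \bar R) -> \bar R with
  | 0 => fun f => f 0
  | d'.+1 => fun f =>
      (\int[lebesgue_measure]_x
         leb_int (fun y : 'rV[R]_d' =>
           f (row_mx ((x : R)%:M : 'rV[R]_1) y : 'rV[R]_(1 + d'))))%E
  end.

Variable d : nat.
Local Notation E := 'rV[R]_d.

Definition is_domain (Omega : set E) : Prop :=
  [/\ open Omega, connected Omega & Omega !=set0].

Definition pd (i : 'I_d) (h : E -> R[i]) (x : E) : R[i] :=
  'D_(delta_mx 0 i) (fun y => complex.Re (h y)) x +i*
  'D_(delta_mx 0 i) (fun y => complex.Im (h y)) x.

Definition pds (l : seq 'I_d) (h : E -> R[i]) : E -> R[i] := foldr pd h l.

Definition smooth_on (U : set E) (h : E -> R[i]) : Prop :=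
  forall (l : seq 'I_d) (x : E), U x ->
    [/\ {for x, continuous (fun y => complex.Re (pds l h y))},
        {for x, continuous (fun y => complex.Im (pds l h y))} &
        forall i : 'I_d,
          derivable (fun y => complex.Re (pds l h y)) x (delta_mx 0 i) /\
          derivable (fun y => complex.Im (pds l h y)) x (delta_mx 0 i)].

Definition test_function (Omega : set E) (phi : E -> R[i]) : Prop :=
  smooth_on [set: E] phi /\
  exists K : set E, [/\ compact K, K `<=` Omega & forall x, ~ K x -> phi x = 0].

Definition leb_intC (h : E -> R[i]) : R[i] :=
  fine (leb_int (fun x => (complex.Re (h x))%:E)) +i*
  fine (leb_int (fun x => (complex.Im (h x))%:E)).

Definition borel_on (Omega : set E) (h : E -> R) : Prop :=
  forall U : set R, open U -> <<s [set V : set E | open V] >> (Omega `&` h @^-1` U).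

Definition loc_integrable (Omega : set E) (h : E -> R[i]) : Prop :=
  [/\ borel_on Omega (fun x => complex.Re (h x)),
      borel_on Omega (fun x => complex.Im (h x)) &
      forall K : set E, compact K -> K `<=` Omega ->
        (leb_int (fun x => ((complex.Re `|h x|) * \1_K x)%:E) < +oo)%E].

Definition ae_eq_on (Omega : set E) (h h' : E -> R[i]) : Prop :=
  leb_int (fun x => (\1_[set y | Omega y /\ h y <> h' y] x : R)%:E) = 0%E.

(* [X] is a Banach space of (classes modulo a.e. equality of) functions on
   [Omega]; [rep u] is a representative of [u]. *)
Definition function_space (Omega : set E) (X : completeNormedModType R[i])
    (rep : X -> E -> R[i]) : Prop :=
  [/\ forall u, loc_integrable Omega (rep u),
      forall (a : R[i]) u v,
        ae_eq_on Omega (rep (a *: u + v)) (fun x => a * rep u x + rep v x) &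
      forall u, ae_eq_on Omega (rep u) (fun=> 0) -> u = 0].

Section DifferentialOperator.
Variable m : nat.

Definition multi_index := {ffun 'I_d -> 'I_m.+1}.

Definition mi_size (alpha : multi_index) : nat := (\sum_(i < d) alpha i)%N.

Definition mi_seq (alpha : multi_index) : seq 'I_d :=
  flatten [seq nseq (alpha i) i | i <- enum 'I_d].

(* formal transpose of sum_(|alpha| <= m) a_alpha d^alpha *)
Definition transpose_op (a : multi_index -> E -> R[i]) (phi : E -> R[i]) (x : E)
    : R[i] :=
  \sum_(alpha : multi_index | (mi_size alpha <= m)%N)
     (-1) ^+ mi_size alpha * pds (mi_seq alpha) (fun y => a alpha y * phi y) x.

Definition smooth_coefficients (Omega : set E) (a : multi_index -> E -> R[i]) : Prop :=
  forall alpha, smooth_on Omega (a alpha).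

(* The sign is such that the Laplacian is strongly elliptic (m = 2) and that
   u_t = D u is parabolic. *)
Definition strongly_elliptic (Omega : set E) (a : multi_index -> E -> R[i]) : Prop :=
  exists q : nat, [/\ (0 < q)%N, m = q.*2 &
    exists2 nu : R, 0 < nu &
      forall x xi : E, Omega x ->
        nu * (\sum_(i < d) xi 0 i ^+ 2) ^+ q <=
        (-1) ^+ q.+1 *
          complex.Re (\sum_(alpha : multi_index | mi_size alpha == m)
                 a alpha x * (\prod_(i < d) xi 0 i ^+ alpha i)%:C)].

(* On [domD], [Dop] is the differential operator with coefficients [a], in the
   sense of distributions on [Omega]; classical and Sobolev domains are both
   allowed. *)
Definition is_diff_op (Omega : set E) (X : completeNormedModType R[i])
    (rep : X -> E -> R[i]) (a : multi_index -> E -> R[i])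
    (domD : set X) (Dop : X -> X) : Prop :=
  linear_on domD Dop /\
  forall u phi, domD u -> test_function Omega phi ->
    leb_intC (fun x => rep (Dop u) x * phi x) =
    leb_intC (fun x => rep u x * transpose_op a phi x).

End DifferentialOperator.

(* [B] maps into a space [Y] of classes of functions on the boundary, [cls]
   being the projection onto classes.  On functions that are smooth up to the
   boundary, B v = alpha v + sum_i beta_i d_i v: Dirichlet conditions are
   alpha = 1, beta = 0, Neumann conditions are alpha = 0, beta = outer normal,
   and mixed conditions are obtained with variable alpha and beta. *)
Definition is_boundary_op (Omega : set E) (X : completeNormedModType R[i])
    (rep : X -> E -> R[i]) (domD : set X) (Y : lmodType R[i]) (B : X -> Y) : Prop :=
  linear_on domD B /\
  exists (cls : (E -> R[i]) -> Y) (alpha : E -> R[i]) (beta : 'I_d -> E -> R[i]),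
    [/\ forall (a : R[i]) (h h' : E -> R[i]),
          cls (fun x => a * h x + h' x) = a *: cls h + cls h',
        forall h h' : E -> R[i],
          (forall x, (closure Omega `\` Omega) x -> h x = h' x) -> cls h = cls h' &
        forall u (v : E -> R[i]), domD u -> smooth_on [set: E] v ->
          ae_eq_on Omega (rep u) v ->
          B u = cls (fun x => alpha x * v x + \sum_(i < d) beta i x * pd i v x)].

End FunctionsOnDomain.

(* Main.v *)
Require Import Defs.
From HB Require Import structures.
From mathcomp Require Import all_boot all_order all_algebra.
From mathcomp Require Import all_classical all_reals all_analysis.
From mathcomp Require Import measurable_realfun complex.
From mathcomp Require Import zify ring lra.
From mathcomp Require separable cyclotomic cyclic.

Set Implicit Arguments.
Unset Strict Implicit.
Unset Printing Implicit Defensive.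

Import Order.TTheory GRing.Theory Num.Theory.
Import numFieldNormedType.Exports.

Local Open Scope classical_set_scope.
Local Open Scope complex_scope.
Local Open Scope ring_scope.

(** Subtracting the correction z reduces the claim to homogeneous boundary
    conditions, where the exact solution is given by variation of constants and
    the method integrates the inhomogeneity by quadrature, the semigroup S being
    applied exactly.  The error at t_n is minus the sum of the local errors d_j
    transported by S(t_n - t_(j+1)) ([error_recursion]).

    Expanding the inhomogeneity at t_j, with derivatives g_0, ..., g_s, up to
    degree s, the rule is exact on the powers of degree less than s, and the
    local error is
      d_j = tau_j^(s+1) psi(tau_j A) g_s(t_j) + O(tau_j^(s+1) int |g_(s+1)|),
    where psi = phi_(s+1) - sum_l gamma_l phi_l ([local_error]).  The remainders
    give the first sum of the bound.  The classical order s + 1 of the rule means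
    that psi(0) = 0, so that psi(tau A) is small on smooth data; as the data are
    not smooth, the smoothness comes from the transport: S(t) psi(tau A) is
    O(tau / t) ([defect_smooth]).  This gives the last sum, except for the last
    step, which is transported by the identity and gives the middle term.  The
    factor kappa in the last sum is harmless when kappa >= 1/2; when
    kappa < 1/2 the steps at least double and the whole sum is of the size of
    the last step ([step_ratio_sum]).

    Of the analyticity of the semigroup only the following is used:
    |S(t + u) x - S(t) x| <= L (u / t) |x| for t + u <= T
    ([sectorial_semigroup_estimates]).  It is proved without contour integrals.
    After rescaling, S is bounded and the resolvent of A is bounded by M / |z| in
    the right half-plane.  The implicit Euler step r = (1 - h A)^-1 then does not
    increase an equivalent norm and satisfies Ritt's condition
    |1 - z| |(1 - z r)^-1| <= C in the unit disc, uniformly in h; Ritt's theorem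
    gives |r^n - r^(n+1)| <= C / (n + 1) ([ritt_power_diff]), by a finite
    averaging over roots of unity, and the limit h -> 0 gives the estimate for S
    ([analytic_bound]).

    The order conditions are identities between functions; since phi_1, ...,
    phi_s are linearly independent, the exponential function being
    transcendental, they amount to identities between the coefficients of the
    weights ([order_conditions_coef]), which apply to the operators.

    Bochner integrals are handled through [lint], which retains only convergence
    in mean of simple functions. *)

(** * Norms on a complex Banach space *)
Section RealSequences.
Variable R : realType.

Lemma le_of_eps (a b : R) : (forall e : R, 0 < e -> a <= b + e) -> a <= b.
Proof. by move=> ab; apply/ler_addgt0Pr => e; exact: ab. Qed.

Lemma cvg_realP (f : nat -> R) (l : R) :
  (f n @[n --> \oo] --> l) <->
  (forall e, 0 < e -> exists N, forall n, (N <= n)%N -> `|l - f n| < e).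
Proof.
split=> [/cvgrPdist_lt fl e /fl[N _ NP]|fl]; first by exists N.
by apply/cvgrPdist_lt => e /fl[N NP]; exists N.
Qed.

Lemma small_invn (e : R) : 0 < e -> exists N, forall n, (N <= n)%N -> n.+1%:R^-1 < e.
Proof.
move=> e0; exists (Num.truncn e^-1) => n Nn.
rewrite -[e]invrK ltf_pV2 ?posrE ?invr_gt0 ?ltr0Sn//.
rewrite (lt_le_trans (truncnS_gt _))// ler_nat; exact: Nn.
Qed.

Lemma le_of_invn (a b K : R) : (forall n, a <= b + K * n.+1%:R^-1) -> a <= b.
Proof.
move=> ab; apply: le_of_eps => e e0.
have K0 : 0 < `|K| + 1 by rewrite ltr_wpDl.
have [N NP] := small_invn (divr_gt0 e0 K0).
have := NP N (leqnn _); rewrite ltr_pdivlMr// => NK.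
apply: (le_trans (ab N)); rewrite lerD2l.
have : 0 < (N.+1%:R^-1 : R) by rewrite invr_gt0.
move: NK (ler_norm K); set t := N.+1%:R^-1; nra.
Qed.
End RealSequences.

Section Norm.
Variables (R : realType) (X : completeNormedModType R[i]).
Implicit Types (x y : X) (a : R[i]) (r : R).

Definition cabs (a : R[i]) : R := complex.Re `|a|.

Lemma cabsE a : `|a| = (cabs a)%:C.
Proof. by rewrite /cabs RRe_real// ger0_real. Qed.

Lemma cabsM a b : cabs (a * b) = cabs a * cabs b.
Proof.
by apply/(@complexI R); rewrite -cabsE normrM !cabsE -rmorphM.
Qed.

Lemma cabs_ge0 a : 0 <= cabs a.
Proof. by rewrite -lecR -cabsE normr_ge0. Qed.

Lemma cabs_eq0 a : (cabs a == 0) = (a == 0).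
Proof. by rewrite -(inj_eq (@complexI R)) -cabsE normr_eq0. Qed.

Lemma cabs_gt0 a : (0 < cabs a) = (a != 0).
Proof. by rewrite lt0r cabs_eq0 cabs_ge0 andbT. Qed.

Lemma cabsD a b : cabs (a + b) <= cabs a + cabs b.
Proof. by rewrite -lecR rmorphD /= -!cabsE ler_normD. Qed.

Lemma cabsN a : cabs (- a) = cabs a.
Proof. by rewrite /cabs normrN. Qed.

Lemma cabs_real r : cabs r%:C = `|r|.
Proof. by apply/(@complexI R); rewrite -cabsE normc_def/= expr0n/= addr0 sqrtr_sqr. Qed.

Lemma cabs_pos r : 0 <= r -> cabs r%:C = r.
Proof. by move=> r0; rewrite cabs_real ger0_norm. Qed.

Lemma cabs0 : cabs 0 = 0.
Proof. by apply/eqP; rewrite cabs_eq0. Qed.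

Lemma cabs1 : cabs 1 = 1.
Proof. exact: (cabs_pos ler01). Qed.

Lemma cabsX a n : cabs (a ^+ n) = cabs a ^+ n.
Proof. by elim: n => [|n IH]; rewrite ?expr0 ?cabs1// !exprS cabsM IH. Qed.

Lemma cabs_sqr a : cabs a ^+ 2 = complex.Re a ^+ 2 + complex.Im a ^+ 2.
Proof.
by apply/(@complexI R); rewrite add_Re2_Im2 cabsE rmorphXn.
Qed.

Lemma nrmE x : `|x| = (nrm x)%:C.
Proof. by rewrite /nrm RRe_real// ger0_real. Qed.

Lemma nrm_ge0 x : 0 <= nrm x.
Proof. by rewrite -lecR -nrmE normr_ge0. Qed.

Lemma nrm0 : nrm (0 : X) = 0.
Proof. by rewrite /nrm normr0. Qed.

Lemma nrm0_eq0 x : nrm x = 0 -> x = 0.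
Proof. by move=> x0; apply/eqP; rewrite -normr_eq0 nrmE x0. Qed.

Lemma nrmD x y : nrm (x + y) <= nrm x + nrm y.
Proof. by rewrite -lecR rmorphD/= -!nrmE ler_normD. Qed.

Lemma nrmN x : nrm (- x) = nrm x.
Proof. by rewrite /nrm normrN. Qed.

Lemma nrmB x y : nrm (x - y) <= nrm x + nrm y.
Proof. by rewrite (le_trans (nrmD _ _))// nrmN. Qed.

Lemma nrmC x y : nrm (x - y) = nrm (y - x).
Proof. by rewrite -nrmN opprB. Qed.

Lemma nrmBD x y z : nrm (x - z) <= nrm (x - y) + nrm (y - z).
Proof. by rewrite (_ : x - z = (x - y) + (y - z)) ?nrmD// addrA subrK. Qed.

Lemma nrmZ a x : nrm (a *: x) = cabs a * nrm x.
Proof. by apply/(@complexI R); rewrite -nrmE normrZ nrmE cabsE -rmorphM. Qed.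

Lemma nrmZr r x : nrm (r%:C *: x) = `|r| * nrm x.
Proof. by rewrite nrmZ cabs_real. Qed.

Lemma nrmZp r x : 0 <= r -> nrm (r%:C *: x) = r * nrm x.
Proof. by move=> r0; rewrite nrmZ cabs_pos. Qed.

Lemma nrm_sum (I : Type) (s : seq I) (P : pred I) (F : I -> X) :
  nrm (\sum_(i <- s | P i) F i) <= \sum_(i <- s | P i) nrm (F i).
Proof.
elim/big_ind2 : _ => [|x a y b xa yb|//]; first by rewrite nrm0.
by rewrite (le_trans (nrmD _ _))// lerD.
Qed.

Lemma cvg_nrmP {I : Type} (F : set_system I) {FF : Filter F} (f : I -> X) (l : X) :
  (f @ F --> l) <-> (forall e, 0 < e -> \forall t \near F, nrm (l - f t) < e).
Proof.
split=> [/cvgrPdist_lt fl e e0|fl].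
  have /fl : 0 < e%:C by rewrite ltcR.
  by apply: filterS => t; rewrite nrmE ltcR.
apply/cvgrPdist_lt => e e0.
have eE : e = (complex.Re e)%:C by rewrite RRe_real// gtr0_real.
rewrite eE ltcR in e0; have := fl _ e0.
by apply: filterS => t; rewrite eE nrmE ltcR.
Qed.

Lemma cvg_seqP (f : nat -> X) (l : X) :
  (f n @[n --> \oo] --> l) <->
  (forall e, 0 < e -> exists N, forall n, (N <= n)%N -> nrm (l - f n) < e).
Proof.
split=> [/cvg_nrmP fl e /fl[N _ NP]|fl]; first by exists N.
by apply/cvg_nrmP => e /fl[N NP]; exists N.
Qed.

Lemma cauchy_seq_cvg (f : nat -> X) (e : nat -> R) :
  e n @[n --> \oo] --> 0 ->
  (forall n m, nrm (f n - f m) <= e n + e m) ->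
  exists l : X, f n @[n --> \oo] --> l.
Proof.
move=> e0 fe; suff : cvg (f @ \oo) by move=> /cvg_ex[l fl]; exists l.
apply/cauchy_cvgP/cauchy_ballP => d d0; near_simpl.
have dE : d = (complex.Re d)%:C by rewrite RRe_real// gtr0_real.
rewrite dE ltcR in d0.
have /cvgrPdist_lt/(_ (complex.Re d / 2)) := e0.
move=> /(_ ltac:(by rewrite divr_gt0)) [N _ NP].
exists ([set n | (N <= n)%N], [set n | (N <= n)%N]); first by split; exists N.
move=> [n m] [/= Nn Nm]; rewrite -ball_normE/= dE nrmE ltcR.
rewrite (le_lt_trans (fe _ _))//.
have /= := NP _ Nn; have /= := NP _ Nm; rewrite !sub0r !normrN => A B.
move: (ler_norm (e n)) (ler_norm (e m)); lra.
Qed.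

End Norm.

(** * Upper bounds for integrals *)
Section Dominated.
Import HBNNSimple.
Variable R : realType.
Implicit Types (a b eps : R) (q : R -> R).
Local Notation mu := (@lebesgue_measure R).

Lemma ae_filter_leb : Filter (almost_everywhere mu).
Proof. exact: (ae_filter_ringOfSetsType (@lebesgue_measure R)). Qed.

Lemma aeS (P Q : R -> Prop) : (forall t, P t -> Q t) ->
  {ae mu, forall t, P t} -> {ae mu, forall t, Q t}.
Proof. by move=> PQ; apply: (@filterS _ _ ae_filter_leb). Qed.

Lemma aeS2 (P P' Q : R -> Prop) : (forall t, P t -> P' t -> Q t) ->
  {ae mu, forall t, P t} -> {ae mu, forall t, P' t} -> {ae mu, forall t, Q t}.
Proof. by move=> PQ; apply: (@filterS2 _ _ ae_filter_leb). Qed.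

Lemma ae_neq b : {ae mu, forall t : R, t != b}.
Proof.
exists [set b]; split=> //; first by rewrite lebesgue_measure_set1.
by move=> t /= /negP; rewrite negbK => /eqP.
Qed.

(** The norm of a vector-valued function need not be measurable, and the
    integral of a nonnegative function that is not measurable is a supremum over
    simple minorants, which is not subadditive.  Bounds in mean are therefore
    expressed by a measurable majorant: this amounts to bounding an upper
    integral, which is subadditive and monotone. *)
Definition dominated a b q eps : Prop :=
  exists e : R -> \bar R,
    [/\ measurable_fun [set: R] e, forall t, (0 <= e t)%E,
        {ae mu, forall t : R, a <= t <= b -> ((q t)%:E <= e t)%E} &
        (\int[mu]_(t in `[a, b]) e t <= eps%:E)%E].

Lemma dominated_le a b q q' eps eps' :
  (forall t, a <= t <= b -> q t <= q' t) -> eps' <= eps ->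
  dominated a b q' eps' -> dominated a b q eps.
Proof.
move=> qq' ee [e [me e0 qe ie]]; exists e; split=> //.
  apply: aeS qe => t qe /[dup] abt /qe; apply: le_trans.
  by rewrite lee_fin qq'.
by rewrite (le_trans ie)// lee_fin.
Qed.

Lemma dominatedD a b q q' eps eps' :
  dominated a b q eps -> dominated a b q' eps' ->
  dominated a b (fun t => q t + q' t) (eps + eps').
Proof.
move=> [e [me e0 qe ie]] [e' [me' e'0 qe' ie']].
exists (fun t => e t + e' t)%E; split.
- exact: emeasurable_funD.
- by move=> t; rewrite adde_ge0.
- by apply: aeS2 qe qe' => t qe qe' abt; rewrite EFinD leeD ?qe ?qe'.
- rewrite ge0_integralD//; first by rewrite EFinD leeD.
  + exact: measurable_funTS.
  + exact: measurable_funTS.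
Qed.

Lemma dominatedZ a b q eps k : 0 <= k ->
  dominated a b q eps -> dominated a b (fun t => k * q t) (k * eps).
Proof.
move=> k0 [e [me e0 qe ie]].
exists (fun t => k%:E * e t)%E; split.
- exact: measurable_funeM.
- by move=> t; rewrite mule_ge0.
- by apply: aeS qe => t qe abt; rewrite EFinM lee_wpmul2l// qe.
- rewrite ge0_integralZl//; first by rewrite EFinM lee_wpmul2l.
  exact: measurable_funTS.
Qed.

Lemma dominated_sub a b a' b' q eps : a <= a' -> b' <= b ->
  dominated a b q eps -> dominated a' b' q eps.
Proof.
move=> aa bb [e [me e0 qe ie]]; exists e; split=> //.
  apply: aeS qe => t qe /andP[at' tb']; apply: qe.
  by rewrite (le_trans aa)// (le_trans tb').
apply: le_trans ie; apply: ge0_subset_integral => //.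
- exact: measurable_funTS.
- by move=> t /=; rewrite !in_itv/= => /andP[at' tb]; rewrite (le_trans aa)// (le_trans tb).
Qed.

Lemma lebesgue_itvcc a b : a <= b -> mu `[a, b]%classic = (b - a)%:E.
Proof.
move=> ab; rewrite lebesgue_measure_itv/= lte_fin; case: ltgtP ab => //= -> _.
by rewrite subrr.
Qed.

Lemma dominated_cst a b k : a <= b -> 0 <= k ->
  dominated a b (fun=> k) (k * (b - a)).
Proof.
move=> ab k0; exists (cst k%:E); split => //.
- by apply: aeW => /= t _.
- by rewrite integral_cst//= lebesgue_itvcc// EFinM.
Qed.

Lemma integral_le_dominated a b q eps : (forall t, 0 <= q t) ->
  dominated a b q eps -> (\int[mu]_(t in `[a, b]) (q t)%:E <= eps%:E)%E.
Proof.
move=> q0 [e [me e0 qe ie]]; apply: le_trans ie.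
rewrite ge0_integralE; last by move=> t _; rewrite lee_fin.
apply: ge_ereal_sup => _ [h hq <-].
rewrite -integralT_nnsfun [leRHS]integral_mkcond.
apply: ae_ge0_le_integral => //.
- by move=> t _; rewrite lee_fin; exact: fun_ge0.
- by apply/measurable_EFinP; exact: measurable_funPT.
- by move=> t _; exact: erestrict_ge0.
- by apply/(measurable_restrictT _ _).1 => //; exact: measurable_funTS.
- apply: aeS qe => t qe _; apply: (le_trans (hq t)).
  rewrite /patch; case: ifP => // /[!inE]/= tab; exact: qe.
Qed.

Lemma le_integral_lower a b q (e : R -> \bar R) : (forall t, 0 <= q t) ->
  (forall t, 0 <= e t)%E -> (forall t, a <= t <= b -> (e t <= (q t)%:E)%E) ->
  (\int[mu]_(t in `[a, b]) e t <= \int[mu]_(t in `[a, b]) (q t)%:E)%E.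
Proof.
move=> q0 e0 eq; rewrite !ge0_integralE//; last by move=> t _; rewrite lee_fin.
apply: le_ereal_sup => _ [h he <-]; exists h => // t.
apply: (le_trans (he t)); rewrite /patch; case: ifP => // /[!inE]/= tab.
exact: eq.
Qed.

(** Outside a null set on which [q] is not controlled, [q] is its own measurable
    majorant, so that the lower integral bounds the upper one. *)
Lemma dominated_integral a b q eps (Z : set R) : (forall t, 0 <= q t) ->
  measurable Z -> mu Z = 0%E -> measurable_fun (`[a, b]%classic `\` Z) q ->
  (\int[mu]_(t in `[a, b]) (q t)%:E <= eps%:E)%E -> dominated a b q eps.
Proof.
move=> q0 mZ Z0 mq iq.
have mD : measurable (`[a, b]%classic `\` Z) by exact: measurableD.
exists ((EFin \o q) \_ (`[a, b]%classic `\` Z)); split.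
- by apply/(measurable_restrictT _ _).1 => //; apply/measurable_EFinP.
- by move=> t; apply: erestrict_ge0 => ? _; rewrite lee_fin.
- exists Z; split=> // t /=; apply: contra_notP => nZ abt.
  by rewrite /patch mem_set//=; split.
- apply: le_trans iq; apply: le_integral_lower => //.
  + by move=> t; apply: erestrict_ge0 => ? _; rewrite lee_fin.
  + by move=> t _; rewrite /patch; case: ifP => //; rewrite lee_fin.
Qed.

End Dominated.

(** * Simple functions *)
Section SimpleFunctions.
Variables (R : realType) (X : completeNormedModType R[i]).
Local Notation mu := (@lebesgue_measure R).
Implicit Types (m : nat) (A : nat -> set R) (x : nat -> X).

Lemma simple_funE m A x (t : R) :
  simple_fun m.+1 A x t = simple_fun m A x t + (if t \in A m then x m else 0).
Proof.
rewrite /simple_fun big_ord_recr/= indicE; case: (t \in A m).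
  by rewrite scale1r.
by rewrite scale0r.
Qed.

Lemma measurable_nrm_simple m A x y : (forall i, measurable (A i)) ->
  measurable_fun [set: R] (fun t => nrm (y + simple_fun m A x t)).
Proof.
move=> mA; elim: m y => [|m IH] y.
  by under eq_fun do rewrite /simple_fun big_ord0; exact: measurable_cst.
have -> : (fun t => nrm (y + simple_fun m.+1 A x t)) =
  (fun t => if t \in A m then nrm ((y + x m) + simple_fun m A x t)
            else nrm (y + simple_fun m A x t)).
  apply/funext => t; rewrite simple_funE; case: (t \in A m).
    by rewrite [_ + x m]addrC addrA.
  by rewrite addr0.
apply: measurable_fun_ifT => //.
apply: (@measurable_fun_bool _ _ _ _ true); rewrite setTI.
rewrite (_ : _ @^-1` _ = A m)//; apply/seteqP; split => t /=; last by move/mem_set.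
by move=> tA; apply: set_mem.
Qed.

Lemma leb_sub_fin (G F : set R) : measurable G -> measurable F -> G `<=` F ->
  (mu F < +oo)%E -> (mu G < +oo)%E.
Proof.
by move=> mG mF GF Foo; apply: le_lt_trans Foo; apply: le_measure; rewrite ?inE.
Qed.

(** The sets [A i] may overlap, so the norm of a simple function is not a simple
    expression in its values.  Splitting [E] along the last set makes that set
    disappear from the sum, at the price of a constant [y], which is why the
    induction carries both [y] and [E]. *)
Lemma simple_int_le m A x y (E : set R) :
  (forall i, measurable (A i)) -> measurable E -> (mu E < +oo)%E ->
  ((nrm ((fine (mu E))%:C *: y +
         \sum_(i < m) (fine (mu (A i `&` E)))%:C *: x i))%:E <=
   \int[mu]_(t in E) (nrm (y + simple_fun m A x t))%:E)%E.
Proof.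
move=> mA; elim: m y E => [|m IH] y E mE Eoo.
  rewrite big_ord0 addr0 nrmZp ?fine_ge0//.
  rewrite (eq_integral (cst (nrm y)%:E)); last first.
    by move=> t _; rewrite /simple_fun big_ord0 addr0.
  have Ef : mu E \is a fin_num by rewrite ge0_fin_numE.
  have -> : (\int[mu]_(t in E) cst (nrm y)%:E t = (nrm y)%:E * mu E)%E.
    exact: integral_cst.
  by rewrite EFinM fineK// muleC.
have mEA : measurable (E `&` A m) by exact: measurableI.
have mEB : measurable (E `\` A m) by exact: measurableD.
have EAoo : (mu (E `&` A m) < +oo)%E.
  exact: leb_sub_fin Eoo.
have EBoo : (mu (E `\` A m) < +oo)%E.
  by apply: leb_sub_fin Eoo => //; exact: subDsetl.
have fsplit (F : set R) : measurable F -> (mu F < +oo)%E ->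
    fine (mu F) = fine (mu (F `&` A m)) + fine (mu (F `\` A m)).
  move=> mF Foo.
  have mFA : measurable (F `&` A m) by exact: measurableI.
  have mFB : measurable (F `\` A m) by exact: measurableD.
  have Fa : mu (F `&` A m) \is a fin_num.
    by rewrite ge0_fin_numE//; apply: leb_sub_fin Foo.
  have Fb : mu (F `\` A m) \is a fin_num.
    by rewrite ge0_fin_numE//; apply: leb_sub_fin Foo.
  rewrite -fineD//; congr fine.
  rewrite -measureU//; first by rewrite setUIDK.
  by rewrite setDE setIACA setICr setI0.
pose L1 := (fine (mu (E `&` A m)))%:C *: (y + x m) +
         \sum_(i < m) (fine (mu (A i `&` (E `&` A m))))%:C *: x i.
pose L2 := (fine (mu (E `\` A m)))%:C *: y +
         \sum_(i < m) (fine (mu (A i `&` (E `\` A m))))%:C *: x i.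
have -> : (fine (mu E))%:C *: y +
         \sum_(i < m.+1) (fine (mu (A i `&` E)))%:C *: x i = L1 + L2.
  rewrite /L1 /L2 big_ord_recr/= (fsplit E)// rmorphD/= scalerDl scalerDr.
  rewrite [A m `&` E]setIC.
  rewrite (eq_bigr (fun i : 'I_m => (fine (mu (A i `&` (E `&` A m))))%:C *: x i
       + (fine (mu (A i `&` (E `\` A m))))%:C *: x i)); last first.
    move=> i _; rewrite -scalerDl -rmorphD/=; congr (_%:C *: _).
    rewrite (fsplit (A i `&` E)); first by rewrite -setIA -setIDA.
    - exact: measurableI.
    - by apply: leb_sub_fin Eoo => //; exact: measurableI.
  rewrite big_split/=.
  set p := (_ *: y); set q := (_ *: y); set r := (_ *: x m).
  set u := \sum_(i < m) _; set v := \sum_(i < m) _.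
  by rewrite [RHS]addrACA [LHS]addrA [LHS]addrAC [p + r + q]addrAC.
apply: (@le_trans _ _ ((nrm L1)%:E + (nrm L2)%:E)%E).
  by rewrite -EFinD lee_fin nrmD.
apply: (le_trans (leeD (IH _ _ mEA EAoo) (IH _ _ mEB EBoo))).
rewrite -[X in (_ <= \int[_]_(_ in X) _)%E](setUIDK E (A m)).
rewrite ge0_integral_setU//; last 3 first.
- by apply/measurable_EFinP; apply: measurable_funTS; exact: measurable_nrm_simple.
- by move=> t _; rewrite lee_fin nrm_ge0.
- by apply/disj_setPS => t [[_ ?] [_ ?]].
rewrite le_eqVlt; apply/orP; left; apply/eqP; congr (_ + _)%E; apply: eq_integral => t.
  by rewrite inE => -[_ At]; rewrite simple_funE mem_set// -[y + x m + _]addrA [x m + _]addrC.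
by rewrite inE => -[_ At]; rewrite simple_funE memNset// addr0.
Qed.

Definition simple_on (a b : R) (A : nat -> set R) : Prop :=
  forall i, measurable (A i) /\ A i `<=` `[a, b].

Lemma simple_int_dominated a b m A x eps : simple_on a b A ->
  dominated a b (fun t => nrm (simple_fun m A x t)) eps ->
  nrm (simple_int m A x) <= eps.
Proof.
move=> sA dA; rewrite -lee_fin.
have := integral_le_dominated (fun t => nrm_ge0 _) dA; apply: le_trans.
have mab : measurable (`[a, b]%classic : set R) by [].
have aboo : (mu `[a, b]%classic < +oo)%E.
  by rewrite lebesgue_measure_itv/=; case: ifP; rewrite ltry.
have := @simple_int_le m A x 0 _ (fun i => (sA i).1) mab aboo.
rewrite scaler0 add0r.
rewrite (_ : (fun t => (nrm (0 + simple_fun m A x t))%:E) =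
  (fun t => (nrm (simple_fun m A x t))%:E)); last first.
  by apply/funext => t; rewrite add0r.
rewrite (_ : \sum_(i < m) _ = simple_int m A x)//; apply: eq_bigr => i _.
by rewrite setIidl//; exact: (sA i).2.
Qed.

Lemma simple_lincomb a b (k : R[i]) m A x m' A' x' :
  simple_on a b A -> simple_on a b A' ->
  exists m'' A'' x'', [/\ simple_on a b A'',
    forall t, simple_fun m'' A'' x'' t = k *: simple_fun m A x t + simple_fun m' A' x' t &
    simple_int m'' A'' x'' = k *: simple_int m A x + simple_int m' A' x' :> X].
Proof.
move=> sA sA'; exists (m + m')%N, (fun i => if (i < m)%N then A i else A' (i - m)%N),
  (fun i => if (i < m)%N then k *: x i else x' (i - m)%N); split.
- by move=> i; case: ifP.
- move=> t; rewrite /simple_fun big_split_ord/= scaler_sumr; congr (_ + _).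
    by apply: eq_bigr => i _; rewrite ltn_ord scalerA mulrC -scalerA.
  by apply: eq_bigr => i _; rewrite ltnNge leq_addr/= addKn.
- rewrite /simple_int big_split_ord/= scaler_sumr; congr (_ + _).
    by apply: eq_bigr => i _; rewrite ltn_ord !scalerA mulrC.
  by apply: eq_bigr => i _; rewrite ltnNge leq_addr/= addKn.
Qed.

Lemma simple_int_dist a b (g : R -> X) m A x m' A' x' eps eps' :
  simple_on a b A -> simple_on a b A' ->
  dominated a b (fun t => nrm (g t - simple_fun m A x t)) eps ->
  dominated a b (fun t => nrm (g t - simple_fun m' A' x' t)) eps' ->
  nrm (simple_int m A x - simple_int m' A' x') <= eps + eps'.
Proof.
move=> sA sA' d d'.
have [m2 [A2 [x2 [s2 f2 i2]]]] := simple_lincomb (-1) m' x' m x sA' sA.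
have -> : simple_int m A x - simple_int m' A' x' = simple_int m2 A2 x2.
  by rewrite i2 scaleN1r addrC.
apply: (simple_int_dominated s2).
apply: dominated_le (dominatedD d d') => // t _.
rewrite f2 scaleN1r addrC (le_trans (nrmBD _ (g t) _))//.
by rewrite lerD2r nrmC.
Qed.

End SimpleFunctions.

(** * Integrals as limits of simple functions in mean *)
Section LInt.
Variables (R : realType) (X : completeNormedModType R[i]).
Local Notation mu := (@lebesgue_measure R).
Implicit Types (a b : R) (g h : R -> X) (v w : X).

Lemma nrm_dist (x y : X) : `|nrm x - nrm y| <= nrm (x - y).
Proof.
rewrite ler_norml; apply/andP; split.
  have := nrmD (y - x) x; rewrite subrK (nrmC y x); lra.
have := nrmD (x - y) y; rewrite subrK; lra.
Qed.

(** The Bochner integral without the pointwise convergence of the simple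
    functions: the convergence in mean alone determines the value, and it is
    stable under the operations below without measurability arguments. *)
Definition lint a b g v : Prop :=
  exists (m : nat -> nat) (A : nat -> nat -> set R) (x : nat -> nat -> X)
    (eps : nat -> R),
  [/\ forall n, simple_on a b (A n),
      forall n, dominated a b
        (fun t => nrm (g t - simple_fun (m n) (A n) (x n) t)) (eps n),
      eps n @[n --> \oo] --> 0 &
      simple_int (m n) (A n) (x n) @[n --> \oo] --> v].

(** A strongly measurable function has measurable distances to simple functions
    off one null set, as a pointwise limit of distances between simple
    functions. *)
Lemma ae_measurable_nrm a b g m A (x : nat -> nat -> X) :
  (forall n, simple_on a b (A n)) ->
  {ae mu, forall t : R, a <= t <= b ->
     simple_fun (m n) (A n) (x n) t @[n --> \oo] --> g t} ->
  exists Z : set R, [/\ measurable Z, mu Z = 0%E &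
    forall m' A' x', simple_on a b A' ->
      measurable_fun (`[a, b]%classic `\` Z)
        (fun t => nrm (g t - simple_fun m' A' x' t))].
Proof.
move=> sA [Z [mZ Z0 cZ]]; exists Z; split=> // m' A' x' sA'.
pose hk n t := nrm (simple_fun (m n) (A n) (x n) t - simple_fun m' A' x' t).
apply: (@measurable_fun_cvg _ _ _ _ hk).
  move=> n; apply: measurable_funTS.
  have [m2 [A2 [x2 [s2 f2 _]]]] := simple_lincomb (-1) m' x' (m n) (x n) sA' (sA n).
  rewrite (_ : hk n = fun t => nrm (0 + simple_fun m2 A2 x2 t)).
    by apply: measurable_nrm_simple => i; exact: (s2 i).1.
  by apply/funext => t; rewrite /hk f2 add0r scaleN1r addrC.
move=> t [/= tab nZ].
have ct : simple_fun (m n) (A n) (x n) t @[n --> \oo] --> g t.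
  by apply: contrapT => ncvg; apply: nZ; apply: cZ => /= H; apply/ncvg/H; move: tab; rewrite in_itv.
apply/cvg_realP => e e0; have [N NP] := (cvg_seqP _ _).1 ct e e0.
exists N => n /NP; apply: le_lt_trans.
by rewrite (le_trans (nrm_dist _ _))// opprD addrACA subrr addr0.
Qed.

(** The integrals in mean of a Bochner approximation are lower integrals; the
    almost everywhere measurability turns them into upper ones.  They are finite
    only from some index on, hence the shift by [N]. *)
Lemma lint_of_bochner a b g v : is_bochner a b g v -> lint a b g v.
Proof.
move=> [m [A [x [sA cvs ci cv]]]].
have [Z [mZ Z0 mg]] := ae_measurable_nrm sA cvs.
have [[N _ NP] fc] := (fine_cvgP _ _).1 ci.
exists (fun n => m (N + n)%N), (fun n => A (N + n)%N), (fun n => x (N + n)%N),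
  (fun n => fine (\int[mu]_(t in `[a, b])
           (nrm (g t - simple_fun (m (N + n)%N) (A (N + n)%N) (x (N + n)%N) t))%:E)).
split.
- by move=> n i; exact: sA.
- move=> n; apply: (@dominated_integral _ _ _ _ _ Z) => //.
  + by move=> t; exact: nrm_ge0.
  + by apply: mg => i; exact: sA.
  by rewrite fineK//; apply: NP; rewrite /= leq_addr.
- apply/cvg_realP => e e0; have [M MP] := (cvg_realP _ _).1 fc e e0.
  by exists M => n Mn; apply: MP; rewrite (leq_trans Mn)// leq_addl.
- apply/cvg_seqP => e e0; have [M MP] := (cvg_seqP _ _).1 cv e e0.
  by exists M => n Mn; apply: MP; rewrite (leq_trans Mn)// leq_addl.
Qed.

Lemma lint_nrm_le a b g v eps : lint a b g v ->
  dominated a b (fun t => nrm (g t)) eps -> nrm v <= eps.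
Proof.
move=> [m [A [x [e [sA dA e0 cv]]]]] dg; apply: le_of_eps => d d0.
have d2 : 0 < d / 2 by rewrite divr_gt0.
have [N NP] := (cvg_seqP _ _).1 cv _ d2; have [M MP] := (cvg_realP _ _).1 e0 _ d2.
set n := maxn N M.
have : nrm (simple_int (m n) (A n) (x n)) <= eps + e n.
  apply: (simple_int_dominated (sA n)).
  apply: dominated_le (dominatedD dg (dA n)) => // t _.
  set s := simple_fun _ _ _ _.
  by have := nrmBD 0 (g t) s; rewrite !sub0r !nrmN.
have := NP n (leq_maxl _ _); have := MP n (leq_maxr _ _).
rewrite sub0r normrN; move: (ler_norm (e n)).
have := nrmD (v - simple_int (m n) (A n) (x n)) (simple_int (m n) (A n) (x n)).
rewrite subrK; lra.
Qed.

Lemma lint_nrm_cst a b g v K : a <= b -> 0 <= K -> lint a b g v ->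
  (forall t, a <= t <= b -> nrm (g t) <= K) -> nrm v <= K * (b - a).
Proof.
move=> ab K0 gv gK; apply: (lint_nrm_le gv).
exact: (dominated_le gK (lexx _) (dominated_cst ab K0)).
Qed.

Lemma lint_eq a b g h v : (forall t, a <= t <= b -> g t = h t) ->
  lint a b g v -> lint a b h v.
Proof.
move=> gh [m [A [x [e [sA dA e0 cv]]]]]; exists m, A, x, e; split=> // n.
by apply: dominated_le (dA n) => // t /gh ->.
Qed.

Lemma lint_lincomb a b g h v w (k : R[i]) : lint a b g v -> lint a b h w ->
  lint a b (fun t => k *: g t + h t) (k *: v + w).
Proof.
move=> [m [A [x [e [sA dA e0 cv]]]]] [m' [A' [x' [e' [sA' dA' e'0 cv']]]]].
have [m2 m2P] := choice (fun n => simple_lincomb k (m n) (x n) (m' n) (x' n) (sA n) (sA' n)).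
have [A2 A2P] := choice m2P.
have [x2 x2P] := choice A2P.
exists m2, A2, x2, (fun n => cabs k * e n + e' n); split.
- by move=> n; have [] := x2P n.
- move=> n; have [_ f2 _] := x2P n.
  apply: dominated_le (dominatedD (dominatedZ (cabs_ge0 k) (dA n)) (dA' n)) => // t _.
  by rewrite f2 opprD addrACA -scalerBr (le_trans (nrmD _ _))// nrmZ.
- by have := cvgD (cvgM (cvg_cst (cabs k)) e0) e'0; rewrite mulr0 addr0; apply.
- under eq_fun do rewrite (let: And3 _ _ i := x2P _ in i).
  by apply: cvgD => //; apply: cvgZr.
Qed.

Lemma lint_zero a b : a <= b -> lint a b (fun=> 0) 0.
Proof.
move=> ab; exists (fun=> 0%N), (fun _ _ => set0), (fun _ _ => 0), (fun=> 0); split.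
- by move=> n i; split=> //; exact: sub0set.
- move=> n; apply: dominated_le (dominated_cst ab (lexx 0)); last by rewrite mul0r.
  by move=> t _; rewrite /simple_fun big_ord0 subr0 nrm0.
- exact: cvg_cst.
- by rewrite /simple_int; under eq_fun do rewrite big_ord0; exact: cvg_cst.
Qed.

Lemma lintD a b g h v w : lint a b g v -> lint a b h w ->
  lint a b (fun t => g t + h t) (v + w).
Proof.
move=> gv hw; have := lint_lincomb 1 gv hw; rewrite scale1r.
by apply: lint_eq => t _; rewrite scale1r.
Qed.

Lemma lintB a b g h v w : lint a b g v -> lint a b h w ->
  lint a b (fun t => g t - h t) (v - w).
Proof.
move=> gv hw; have := lint_lincomb (-1) hw gv; rewrite scaleN1r addrC.
by apply: lint_eq => t _; rewrite scaleN1r addrC.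
Qed.

Lemma lint_sum a b (n : nat) (g : 'I_n -> R -> X) (v : 'I_n -> X) : a <= b ->
  (forall i, lint a b (g i) (v i)) ->
  lint a b (fun t => \sum_(i < n) g i t) (\sum_(i < n) v i).
Proof.
move=> ab; elim: n g v => [|n IH] g v gv.
  rewrite big_ord0; apply: lint_eq (lint_zero ab) => t _.
  by rewrite big_ord0.
rewrite big_ord_recr/=.
apply: lint_eq (lintD (IH _ _ (fun i => gv (widen_ord (leqnSn n) i))) (gv ord_max)) => t _.
by rewrite big_ord_recr.
Qed.

Lemma lint_unique a b g v w : a <= b -> lint a b g v -> lint a b g w -> v = w.
Proof.
move=> ab gv gw; apply/eqP; rewrite -subr_eq0; apply/eqP/nrm0_eq0/eqP.
rewrite eq_le nrm_ge0 andbT.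
have := @lint_nrm_cst _ _ _ _ 0 ab (lexx _) (lintB gv gw); rewrite mul0r; apply.
by move=> t _; rewrite subrr nrm0.
Qed.

Definition bounded_linear (L : X -> X) (K : R) : Prop :=
  linear L /\ forall x, nrm (L x) <= K * nrm x.

Lemma bounded_linear_cvg L K (u : nat -> X) v : bounded_linear L K ->
  u n @[n --> \oo] --> v -> L (u n) @[n --> \oo] --> L v.
Proof.
move=> [lL bL] uv; apply/cvg_seqP => e e0.
have K1 : 0 < `|K| + 1 by rewrite ltr_wpDl.
have [N NP] := (cvg_seqP _ _).1 uv _ (divr_gt0 e0 K1).
exists N => n /NP; rewrite ltr_pdivlMr// => lt.
have -> : L v - L (u n) = L (v - u n).
  by have := lL (-1) (u n) v; rewrite !scaleN1r ![- _ + _]addrC.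
apply: le_lt_trans (bL _) _; apply: le_lt_trans lt.
rewrite mulrC ler_wpM2l ?nrm_ge0//.
by rewrite (le_trans (ler_norm K))// lerDl.
Qed.

Lemma bounded_linear_sum L K (n : nat) (k : 'I_n -> R[i]) (x : 'I_n -> X) :
  bounded_linear L K ->
  L (\sum_(i < n) k i *: x i) = \sum_(i < n) k i *: L (x i).
Proof.
move=> [lL bL]; have L0 : L 0 = 0.
  by have := lL (-1) 0 0; rewrite scaler0 addr0 scaleN1r addNr.
elim: n k x => [|n IH] k x; first by rewrite !big_ord0.
by rewrite !big_ord_recl lL IH.
Qed.

Lemma lint_map a b g v L K : 0 <= K -> bounded_linear L K -> lint a b g v ->
  lint a b (fun t => L (g t)) (L v).
Proof.
move=> K0 bL [m [A [x [e [sA dA e0 cv]]]]].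
exists m, A, (fun n i => L (x n i)), (fun n => K * e n); split=> //.
- move=> n; apply: dominated_le (dominatedZ K0 (dA n)) => // t _.
  rewrite /simple_fun -(bounded_linear_sum _ _ bL).
  set s := \sum_(i < _) _.
  have -> : L (g t) - L s = L (g t - s).
    by have := bL.1 (-1) s (g t); rewrite !scaleN1r ![- _ + _]addrC.
  exact: bL.2.
- by have := cvgM (cvg_cst K) e0; rewrite mulr0; apply.
- rewrite (_ : (fun n => simple_int (m n) (A n) (fun i => L (x n i))) =
    (fun n => L (simple_int (m n) (A n) (x n)))); first exact: bounded_linear_cvg bL cv.
  by apply/funext => n; rewrite /simple_int (bounded_linear_sum _ _ bL).
Qed.

(** Additivity over intervals, in the form of a difference: the parts on [a, b]
    of the simple functions approximating over [a, c] approximate over [a, b],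
    so their integrals have the limit [w], and the parts on ]b, c] are left with
    the limit [v - w]. *)
Lemma lint_sub a b c g v w : a <= b -> b <= c ->
  lint a c g v -> lint a b g w -> lint b c g (v - w).
Proof.
move=> ab bc [m [A [x [e [sA dA e0 cv]]]]] [m' [A' [x' [e' [sA' dA' e'0 cv']]]]].
pose A1 n i := A n i `&` `[a, b]; pose A2 n i := A n i `&` `]b, c].
have sA1 n : simple_on a b (A1 n).
  by move=> i; split; [apply: measurableI => //; exact: (sA n i).1|apply: subIsetr].
have sA2 n : simple_on b c (A2 n).
  move=> i; split; first by apply: measurableI => //; exact: (sA n i).1.
  by move=> t [_] /=; rewrite !in_itv/= => /andP[/ltW -> ->].
have i12 n : simple_int (m n) (A n) (x n) =
    simple_int (m n) (A1 n) (x n) + simple_int (m n) (A2 n) (x n).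
  rewrite /simple_int -big_split/=; apply: eq_bigr => i _.
  rewrite -scalerDl -rmorphD/=; congr (_%:C *: _).
  have fin (F : set R) : measurable F -> F `<=` `[a, c] -> mu F \is a fin_num.
    move=> mF Fac; rewrite ge0_fin_numE//.
    apply: (@le_lt_trans _ _ (mu `[a, c]%classic)).
      by apply: le_measure; rewrite ?inE.
    by rewrite lebesgue_measure_itv/=; case: ifP; rewrite ltry.
  rewrite -fineD; last 2 first.
  - by apply: fin; [exact: (sA1 n i).1|move=> t [At _]; exact: (sA n i).2].
  - by apply: fin; [exact: (sA2 n i).1|move=> t [At _]; exact: (sA n i).2].
  congr fine; rewrite -measureU//; last 3 first.
  - exact: (sA1 n i).1.
  - exact: (sA2 n i).1.
  - rewrite /A1 /A2 setIACA setIid -subset0 => t [_ []] /=.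
    by rewrite !in_itv/= => /andP[_ tb] /andP[]; rewrite ltNge tb.
  congr (mu _); rewrite /A1 /A2 -setIUr setIidl// => t At.
  have := (sA n i).2 _ At; rewrite /= !in_itv/= => /andP[ta tc].
  by case: (leP t b) => tb; rewrite ta tc; [left|right].
exists m, A2, x, e; split=> //.
- move=> n; have [ee [me ee0 qe ie]] := dominated_sub ab (lexx _) (dA n).
  exists ee; split=> //.
  apply: aeS2 qe (ae_neq b) => t qe tb /andP[bt tc].
  rewrite (_ : simple_fun (m n) (A2 n) (x n) t = simple_fun (m n) (A n) (x n) t).
    by apply: qe; rewrite bt tc.
  rewrite /simple_fun; apply: eq_bigr => i _; congr (_ *: _).
  rewrite !indicE; congr (_%:R); rewrite /A2 in_setI.
  have -> : t \in `]b, c]%classic.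
    by apply/mem_set => /=; rewrite ?in_itv/= lt_neqAle eq_sym tb bt tc.
  by rewrite andbT.
- rewrite (_ : (fun n => simple_int (m n) (A2 n) (x n)) =
     (fun n => simple_int (m n) (A n) (x n) - simple_int (m n) (A1 n) (x n))).
    2: by apply/funext => n; rewrite i12 addrAC subrr add0r.
  apply: cvgB => //.
  apply/cvg_seqP => d d0.
  have d3 : 0 < d / 3 by rewrite divr_gt0.
  have [N NP] := (cvg_seqP _ _).1 cv' _ d3; have [M MP] := (cvg_realP _ _).1 e0 _ d3.
  have [M' MP'] := (cvg_realP _ _).1 e'0 _ d3.
  exists (N + M + M')%N => n Nn.
  have /NP h1 : (N <= n)%N by rewrite (leq_trans _ Nn)// -addnA leq_addr.
  have /MP h2 : (M <= n)%N by rewrite (leq_trans _ Nn)// addnAC leq_addl.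
  have /MP' h3 : (M' <= n)%N by rewrite (leq_trans _ Nn)// leq_addl.
  have d1 : dominated a b (fun t => nrm (g t - simple_fun (m n) (A1 n) (x n) t)) (e n).
    apply: dominated_le (dominated_sub (lexx _) bc (dA n)) => // t abt.
    rewrite (_ : simple_fun (m n) (A1 n) (x n) t = simple_fun (m n) (A n) (x n) t)//.
    rewrite /simple_fun; apply: eq_bigr => i _; congr (_ *: _).
    rewrite !indicE; congr (_%:R); rewrite /A1 in_setI.
    have -> : t \in `[a, b]%classic by apply/mem_set => /=; rewrite ?in_itv/=.
    by rewrite andbT.
  have := simple_int_dist (sA' n) (sA1 n) (dA' n) d1.
  have := nrmBD w (simple_int (m' n) (A' n) (x' n)) (simple_int (m n) (A1 n) (x n)).
  move: h1 h2 h3 (ler_norm (e n)) (ler_norm (e' n)); rewrite !sub0r !normrN; lra.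
Qed.

(** For an integrable [g], the integral of the norm over a subinterval is finite
    and is a genuine upper bound.  This is how the integrals of the norm in an
    error bound enter the estimates of the integrals of [g]. *)
Lemma bochner_dominated_nrm a b a' b' g : a <= a' -> a' <= b' -> b' <= b ->
  bochner_integrable a b g ->
  dominated a' b' (fun t => nrm (g t)) (Rintegral mu `[a', b'] (fun t => nrm (g t))).
Proof.
move=> aa ab' bb [v gv]; have ab := le_trans aa (le_trans ab' bb).
have [m [A [x [e [sA dA e0 cv]]]]] := lint_of_bochner gv.
move: gv => [m1 [A1 [x1 [sA1 cvs ci _]]]].
have [Z [mZ Z0 mg]] := ae_measurable_nrm sA1 cvs.
have mgg : measurable_fun (`[a, b]%classic `\` Z) (fun t => nrm (g t)).
  have := mg 0%N (fun=> set0) (fun=> 0).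
  have E0 : (fun t => nrm (g t - simple_fun 0 (fun=> set0) (fun=> 0) t)) = (fun t => nrm (g t)).
    by apply/funext => t; rewrite /simple_fun big_ord0 subr0.
  by rewrite E0; apply => i; split=> //; exact: sub0set.
have {}mgg : measurable_fun (`[a', b']%classic `\` Z) (fun t => nrm (g t)).
  apply: measurable_funS mgg; first exact: measurableD.
  move=> t [/= tab nZ]; split=> //=; move: tab; rewrite !in_itv/= => /andP[t1 t2].
  by rewrite (le_trans aa)// (le_trans t2).
apply: (@dominated_integral _ _ _ _ _ Z) => // [t|]; first exact: nrm_ge0.
rewrite /Rintegral fineK//.
pose K := \sum_(i < m 0%N) nrm (x 0%N i).
have K0 : 0 <= K by rewrite sumr_ge0// => i _; rewrite nrm_ge0.
rewrite ge0_fin_numE; last by apply: integral_ge0 => t _; rewrite lee_fin nrm_ge0.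
apply: (@le_lt_trans _ _ (e 0%N + K * (b - a))%:E); last by rewrite ltry.
apply: integral_le_dominated => [t|]; first exact: nrm_ge0.
apply: (dominated_sub aa bb).
have := dominatedD (dA 0%N) (dominated_cst ab K0).
apply: dominated_le => // u _.
set S := simple_fun _ _ _ _.
have {1}-> : g u = (g u - S) + S by rewrite subrK.
rewrite (le_trans (nrmD _ _))// lerD2l /S /simple_fun.
rewrite (le_trans (nrm_sum _ _ _))// /K ler_sum// => i _.
rewrite nrmZ indicE; case: (_ \in _); rewrite ?cabs1 ?mul1r ?cabs0 ?mul0r// nrm_ge0//.
Qed.

End LInt.

(** * Uniformly continuous integrands *)
Section Riemann.
Variables (R : realType) (X : completeNormedModType R[i]).
Local Notation mu := (@lebesgue_measure R).
Implicit Types (a b : R) (F G : R -> X) (v w : X).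

Definition unif_cont a b F : Prop := forall e, 0 < e ->
  exists2 d, 0 < d & forall s t, a <= s <= b -> a <= t <= b ->
    `|s - t| < d -> nrm (F s - F t) < e.

Definition mesh a b n : R := (b - a) / n.+1%:R.
Definition node a b n k : R := a + k%:R * mesh a b n.

Definition riemann a b F n : X :=
  \sum_(k < n.+1) (mesh a b n)%:C *: F (node a b n k).

(** The empty set is the value beyond the last cell, because all sets of a
    family of subsets of [a, b] are constrained, not only those that are used. *)
Definition step_set a b n (k : nat) : set R :=
  if (k < n.+1)%N then `[node a b n k, node a b n k.+1[%classic else set0.

Lemma mesh_ge0 a b n : a <= b -> 0 <= mesh a b n.
Proof. by move=> ab; rewrite divr_ge0// subr_ge0. Qed.

Lemma nodeS a b n k : node a b n k.+1 = node a b n k + mesh a b n.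
Proof. by rewrite /node -natr1 mulrDl mul1r addrA. Qed.

Lemma node0 a b n : node a b n 0 = a.
Proof. by rewrite /node mul0r addr0. Qed.

Lemma node_last a b n : node a b n n.+1 = b.
Proof. by rewrite /node /mesh mulrCA divff ?pnatr_eq0// mulr1 addrCA subrr addr0. Qed.

Lemma node_in a b n k : a <= b -> (k <= n.+1)%N -> a <= node a b n k <= b.
Proof.
move=> ab kn; apply/andP; split.
  by rewrite lerDl mulr_ge0// mesh_ge0.
by rewrite -{2}(node_last a b n) lerD2l ler_wpM2r ?mesh_ge0// ler_nat.
Qed.

Lemma step_on a b n : a <= b -> simple_on a b (step_set a b n).
Proof.
move=> ab k; rewrite /step_set; case: ifP => kn; last by split=> //; exact: sub0set.
split=> // t /=; rewrite !in_itv/= => /andP[kt tk].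
have /andP[ak _] := node_in ab (ltnW kn); have /andP[_ kb] := node_in ab kn.
by rewrite (le_trans ak)// (le_trans (ltW tk)).
Qed.

Lemma step_int a b F n : a <= b ->
  simple_int n.+1 (step_set a b n) (fun k => F (node a b n k)) = riemann a b F n.
Proof.
move=> ab; apply: eq_bigr => k _; congr (_%:C *: _).
rewrite /step_set ltn_ord lebesgue_measure_itv/= lte_fin nodeS ltrDl.
have := mesh_ge0 n ab; rewrite le_eqVlt => /orP[/eqP <-|m0]; first by rewrite ltxx.
by rewrite m0 /= addrAC subrr add0r.
Qed.

(** The cell containing [t] is the integer part of (t - a) / mesh. *)
Lemma step_fun a b F n t : a <= t -> t < b ->
  exists2 k, (k < n.+1)%N /\ node a b n k <= t < node a b n k.+1 &
  simple_fun n.+1 (step_set a b n) (fun k => F (node a b n k)) t = F (node a b n k).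
Proof.
move=> at_ tb; have ab := le_lt_trans at_ tb.
have m0 : 0 < mesh a b n by rewrite divr_gt0// subr_gt0.
pose x := (t - a) / mesh a b n.
have x0 : 0 <= x by rewrite divr_ge0 ?subr_ge0 ?(ltW m0).
have kE k : (node a b n k <= t < node a b n k.+1) = (k == Num.truncn x).
  rewrite /node -!lerBrDl -ltrBlDl.
  rewrite -ler_pdivlMr// -ltr_pdivrMr// eq_sym.
  by rewrite truncn_eq.
exists (Num.truncn x).
  split; last by rewrite kE.
  rewrite -(ltr_nat R); apply: (@le_lt_trans _ _ x); first by rewrite truncn_le.
  by rewrite ltr_pdivrMr// /mesh mulrCA divff ?pnatr_eq0// mulr1 ltrD2r.
have kn : (Num.truncn x < n.+1)%N.
  rewrite -(ltr_nat R); apply: (@le_lt_trans _ _ x); first by rewrite truncn_le.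
  by rewrite ltr_pdivrMr// /mesh mulrCA divff ?pnatr_eq0// mulr1 ltrD2r.
rewrite /simple_fun (bigD1 (Ordinal kn))//= big1 ?addr0.
  rewrite indicE mem_set ?scale1r// /step_set kn /= in_itv/=.
  by rewrite kE.
move=> i /eqP ik; rewrite indicE memNset ?scale0r// /step_set ltn_ord/= in_itv/= kE.
by move=> /eqP ixk; apply: ik; apply/val_inj.
Qed.

Lemma step_close a b F : a <= b -> unif_cont a b F -> forall e, 0 < e ->
  exists N, forall n, (N <= n)%N -> forall t, a <= t -> t < b ->
    nrm (F t - simple_fun n.+1 (step_set a b n) (fun k => F (node a b n k)) t) <= e.
Proof.
move=> ab ucF e e0; have [d d0 dP] := ucF e e0.
have ba0 : 0 < (b - a) + 1 by rewrite ltr_wpDl// subr_ge0.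
have [N NP] := small_invn (divr_gt0 d0 ba0).
exists N => n /NP nd t at_ tb.
have [k [kn /andP[kt tk]] ->] := step_fun F n at_ tb.
apply: ltW; apply: dP.
- by rewrite at_ ltW.
- by apply: node_in; rewrite // ltnW.
rewrite ger0_norm ?subr_ge0//.
have : t - node a b n k < mesh a b n by rewrite ltrBlDl -nodeS.
move/lt_le_trans; apply; rewrite /mesh.
move: nd; rewrite ltr_pdivlMr// => nd; rewrite mulrC; apply: ltW; apply: le_lt_trans nd.
by rewrite ler_wpM2l ?invr_ge0// lerDl.
Qed.

Lemma step_dominated a b F e n : a <= b -> 0 <= e ->
  (forall t, a <= t -> t < b ->
    nrm (F t - simple_fun n.+1 (step_set a b n) (fun k => F (node a b n k)) t) <= e) ->
  dominated a b (fun t => nrm (F t -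
    simple_fun n.+1 (step_set a b n) (fun k => F (node a b n k)) t)) (e * (b - a)).
Proof.
move=> ab e0 Fe.
have [ee [me ee0 qe ie]] := dominated_cst ab e0.
exists ee; split=> //; apply: aeS2 qe (ae_neq b) => t qe tb /[dup] abt /qe.
apply: le_trans; rewrite lee_fin; case/andP: abt => at_ tb'.
by apply: Fe => //; rewrite lt_neqAle tb.
Qed.

(** Step functions on uniform grids converge uniformly, which gives the three
    kinds of convergence at once; the Riemann sums are a Cauchy sequence because
    the distance of two of them is at most the sum of the two distances to
    [F]. *)
Lemma unif_cont_bochner a b F : a <= b -> unif_cont a b F ->
  exists v, is_bochner a b F v.
Proof.
move=> ab ucF.
have [N NP] := choice (fun p : nat => step_close ab ucF (ltac:(by rewrite invr_gt0) : 0 < p.+1%:R^-1)).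
pose s p := simple_fun (N p).+1 (step_set a b (N p)) (fun k => F (node a b (N p) k)).
have ip0 (p : nat) : 0 <= p.+1%:R^-1 :> R by rewrite invr_ge0.
have sd p := step_dominated ab (ip0 p) (NP p _ (leqnn _)).
have dist p q : nrm (riemann a b F (N p) - riemann a b F (N q)) <=
    p.+1%:R^-1 * (b - a) + q.+1%:R^-1 * (b - a).
  by rewrite -!step_int//; apply: simple_int_dist (sd p) (sd q); exact: step_on.
have e0 : (p.+1%:R^-1 * (b - a) : R) @[p --> \oo] --> 0.
  have : (p.+1%:R^-1 : R) @[p --> \oo] --> 0.
    apply/cvg_realP => e e0; have [M MP] := small_invn e0.
    by exists M => n /MP; rewrite sub0r normrN ger0_norm.
  by move=> /cvgM /(_ (cvg_cst (b - a))); rewrite mul0r.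
have [v vP] := cauchy_seq_cvg e0 dist.
exists v, (fun p => (N p).+1), (fun p => step_set a b (N p)),
  (fun p k => F (node a b (N p) k)); split.
- by move=> p i; exact: step_on.
- apply: aeS (ae_neq b) => t tb /andP[at_ tb'].
  have {tb tb'} tb : t < b by rewrite lt_neqAle tb.
  apply/cvg_seqP => e e1; have [M MP] := small_invn e1.
  exists M => p /MP; apply: le_lt_trans; exact: NP.
- apply: (@squeeze_cvge _ _ _ _ (cst 0%E) _ (fun p => (p.+1%:R^-1 * (b - a))%:E)).
  + apply: nearW => p; apply/andP; split; first by apply: integral_ge0 => t _; rewrite lee_fin nrm_ge0.
    by apply: integral_le_dominated (sd p) => t; exact: nrm_ge0.
  + exact: cvg_cst.
  + by apply: cvg_EFin => //; exact: nearW.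
- rewrite (_ : (fun n => simple_int _ _ _) = (fun n => riemann a b F (N n)))//.
  by apply/funext => p; rewrite step_int.
Qed.

Lemma unif_cont_lint a b F : a <= b -> unif_cont a b F -> exists v, lint a b F v.
Proof.
by move=> ab /(unif_cont_bochner ab)[v /lint_of_bochner]; exists v.
Qed.

Lemma bochner_lint a b F : a <= b -> unif_cont a b F -> lint a b F (bochner a b F).
Proof.
move=> ab /(unif_cont_bochner ab) ev; apply: lint_of_bochner.
by rewrite /bochner; apply: xgetPex.
Qed.

Lemma simple_lint a b m A (x : nat -> X) : a <= b -> simple_on a b A ->
  lint a b (simple_fun m A x) (simple_int m A x).
Proof.
move=> ab sA; exists (fun=> m), (fun=> A), (fun=> x), (fun=> 0); split=> //.
- move=> n; apply: dominated_le (dominated_cst ab (lexx 0)); last by rewrite mul0r.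
  by move=> t _; rewrite subrr nrm0.
- exact: cvg_cst.
- exact: cvg_cst.
Qed.

Lemma riemann_close a b F v : a <= b -> unif_cont a b F -> lint a b F v ->
  forall e, 0 < e -> exists N, forall n, (N <= n)%N ->
    nrm (v - riemann a b F n) <= e.
Proof.
move=> ab ucF Fv e e0.
have ba0 : 0 < (b - a) + 1 by rewrite ltr_wpDl// subr_ge0.
have d0 := divr_gt0 e0 ba0; have [N NP] := step_close ab ucF d0.
exists N => n /NP sn; rewrite -step_int//.
apply: (lint_nrm_le (lintB Fv (simple_lint _ _ ab (step_on n ab)))).
apply: dominated_le (step_dominated ab (ltW d0) sn) => //.
by rewrite mulrAC ler_pdivrMr// ler_wpM2l ?(ltW e0)// lerDl.
Qed.

(** Translation leaves the Riemann sums unchanged, which spares the translation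
    of measurable sets. *)
Lemma lint_shift a b F v : a <= b -> unif_cont a b F -> lint a b F v ->
  lint 0 (b - a) (fun t => F (a + t)) v.
Proof.
move=> ab ucF Fv.
have ab0 : 0 <= b - a by rewrite subr_ge0.
have ucG : unif_cont 0 (b - a) (fun t => F (a + t)).
  move=> e /ucF[d d0 dP]; exists d => // s t /andP[s0 sb] /andP[t0 tb] st.
  apply: dP; first by rewrite lerDl s0 -lerBrDl.
    by rewrite lerDl t0 -lerBrDl.
  by rewrite opprD addrACA subrr add0r.
have [w Gw] := unif_cont_lint ab0 ucG.
suff -> : v = w by [].
apply/eqP; rewrite -subr_eq0; apply/eqP/nrm0_eq0/eqP.
rewrite eq_le nrm_ge0 andbT; apply: le_of_eps => e e0; rewrite add0r.
have e2 : 0 < e / 2 by rewrite divr_gt0.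
have [N NP] := riemann_close ab ucF Fv e2.
have [M MP] := riemann_close ab0 ucG Gw e2.
have := NP _ (leq_maxl N M); have := MP _ (leq_maxr N M).
set n := maxn N M.
have -> : riemann 0 (b - a) (fun t => F (a + t)) n = riemann a b F n.
  by apply: eq_bigr => k _; rewrite /node /mesh subr0 add0r.
have := nrmBD v (riemann a b F n) w; rewrite (nrmC (riemann _ _ _ _) w); lra.
Qed.

(** The fundamental theorem of calculus: the increments of [G] telescope and
    differ from the terms of the Riemann sums by a small multiple of the mesh. *)
Lemma lint_ftc a b F G : a <= b -> unif_cont a b F ->
  (forall e, 0 < e -> exists2 d, 0 < d & forall s t, a <= s -> s <= t -> t <= b ->
     t - s < d -> nrm (G t - G s - (t - s)%:C *: F s) <= e * (t - s)) ->
  lint a b F (G b - G a).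
Proof.
move=> ab ucF GF; have [v Fv] := unif_cont_lint ab ucF.
suff <- : v = G b - G a by [].
apply/eqP; rewrite -subr_eq0; apply/eqP/nrm0_eq0/eqP.
rewrite eq_le nrm_ge0 andbT; apply: le_of_eps => e e0; rewrite add0r.
have e2 : 0 < e / 2 by rewrite divr_gt0.
have ba0 : 0 < (b - a) + 1 by rewrite ltr_wpDl// subr_ge0.
have [N NP] := riemann_close ab ucF Fv e2.
have [d d0 dP] := GF _ (divr_gt0 e2 ba0).
have [M MP] := small_invn (divr_gt0 d0 ba0).
pose n := maxn N M.
have h1 := NP _ (leq_maxl N M : (N <= n)%N); have h2 := MP _ (leq_maxr N M : (M <= n)%N).
have md : mesh a b n < d.
  move: h2; rewrite ltr_pdivlMr// => h2; rewrite /mesh mulrC; apply: le_lt_trans h2.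
  by rewrite ler_wpM2l ?invr_ge0// lerDl.
have tel : G b - G a = \sum_(k < n.+1) (G (node a b n k.+1) - G (node a b n k)).
  rewrite -(big_mkord xpredT (fun k => G (node a b n k.+1) - G (node a b n k))).
  by rewrite (telescope_sumr (fun k => G (node a b n k)))//= node0 node_last.
have h3 : nrm (G b - G a - riemann a b F n) <= e / 2.
  rewrite tel /riemann -sumrB (le_trans (nrm_sum _ _ _))//.
  apply: (@le_trans _ _ (\sum_(k < n.+1) (e / 2 / (b - a + 1) * mesh a b n))).
    apply: ler_sum => k _.
    have /andP[ak kb] := node_in (n := n) ab (ltnW (ltn_ord k)).
    have /andP[ak1 kb1] := node_in (n := n) ab (ltn_ord k).
    have E : node a b n k.+1 - node a b n k = mesh a b n by rewrite nodeS addrAC subrr add0r.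
    have := dP (node a b n k) (node a b n k.+1) ak; rewrite E; apply=> //.
    by rewrite nodeS lerDl mesh_ge0.
  rewrite sumr_const card_ord -mulrnAr.
  have -> : mesh a b n *+ n.+1 = b - a by rewrite -[LHS]mulr_natr /mesh divfK ?pnatr_eq0.
  rewrite mulrAC ler_pdivrMr// ler_wpM2l ?(ltW e2)//.
  by rewrite lerDl.
have := nrmBD v (riemann a b F n) (G b - G a); rewrite (nrmC (riemann _ _ _ _) (_ - _)); lra.
Qed.

End Riemann.

(** * Uniform boundedness *)
Section BanachSteinhaus.
Variables (R : realType) (X : completeNormedModType R[i]).

Lemma linear_sub (L : X -> X) x y : linear L -> L (x - y) = L x - L y.
Proof. by move=> lL; have := lL (-1) y x; rewrite !scaleN1r ![- _ + _]addrC. Qed.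

Lemma linear_zero (L : X -> X) : linear L -> L 0 = 0.
Proof. by move=> lL; have := linear_sub 0 0 lL; rewrite !subrr. Qed.

Lemma linear_add (L : X -> X) x y : linear L -> L (x + y) = L x + L y.
Proof. by move=> lL; have := lL 1 x y; rewrite !scale1r. Qed.

Lemma linear_scale (L : X -> X) k x : linear L -> L (k *: x) = k *: L x.
Proof. by move=> lL; have := lL k x 0; rewrite (linear_zero lL) !addr0. Qed.

(** A gliding hump.  If the family is not uniformly bounded, one constructs
    centres x_k and radii r_k, decreasing geometrically, such that some operator
    T n_k has norm at least k / 2 at x_(k+1): either at x_k itself or after a
    step of length r_k, since the difference of the two values is large.  The
    next radius is so small that T n_k varies by at most 1 on the ball to which
    all later centres belong; then T n_k is unbounded at the limit. *)
Lemma banach_steinhaus (T : nat -> X -> X) :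
  (forall n, exists K, bounded_linear (T n) K) ->
  (forall x, exists M, forall n, nrm (T n x) <= M) ->
  exists2 K : R, 0 <= K & forall n x, nrm (T n x) <= K * nrm x.
Proof.
move=> bT pT; apply: contrapT => nK.
have big (M : R) : exists n x, `|M| * nrm x < nrm (T n x).
  apply: contrapT => nM; apply: nK; exists `|M|; first exact: normr_ge0.
  move=> n x; rewrite leNgt; apply/negP => lt; apply: nM; by exists n, x.
have step (p : nat * X * {posnum R}) : exists q : nat * X * {posnum R},
    p.2%:num <= 1 ->
    exists n, [/\ q.1.1 = p.1.1.+1, nrm (q.1.2 - p.1.2) <= p.2%:num,
      p.1.1%:R <= 2 * nrm (T n q.1.2), q.2%:num <= p.2%:num / 4 &
      forall y, nrm y <= 2 * q.2%:num -> nrm (T n y) <= 1].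
  case: p => [[k x] r] /=.
  have [n [y]] := big (k%:R / r%:num).
  rewrite ger0_norm ?divr_ge0// => yT.
  have [C [lT CT]] := bT n.
  have y0 : 0 < nrm y.
    rewrite lt_neqAle nrm_ge0 andbT eq_sym; apply/eqP => /nrm0_eq0 y0; move: yT.
    by rewrite y0 (linear_zero lT) nrm0 mulr0 ltxx.
  pose xi := (r%:num / nrm y)%:C *: y.
  have rxi : nrm xi = r%:num by rewrite nrmZp ?divr_ge0 ?nrm_ge0// divfK ?gt_eqF.
  have Txi : k%:R <= nrm (T n xi).
    rewrite (linear_scale _ _ lT) nrmZp ?divr_ge0 ?nrm_ge0//.
    by rewrite mulrAC ler_pdivlMr// [leRHS]mulrC -ler_pdivrMr// mulrAC ltW.
  have C1 : 0 < `|C| + 1 by rewrite ltr_wpDl.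
  have r'0 : 0 < r%:num / (4 * (`|C| + 1)) by rewrite divr_gt0// mulr_gt0.
  have [x' [xx' Tx']] : exists x', nrm (x' - x) <= r%:num /\ k%:R <= 2 * nrm (T n x').
    have [h|h] := leP (k%:R / 2) (nrm (T n x)).
      by exists x; rewrite subrr nrm0 mulrC -ler_pdivrMr.
    exists (x + xi); rewrite addrAC subrr add0r rxi; split=> //.
    have := nrmB (T n (x + xi)) (T n x).
    rewrite -(linear_sub _ _ lT) addrAC subrr add0r.
    move: h Txi; rewrite ltr_pdivlMr//; lra.
  exists (k.+1, x', PosNum r'0) => /= r1; exists n; split=> //.
    rewrite ler_pM2l// lef_pV2 ?posrE ?mulr_gt0// ler_peMr// lerDr//.
  move=> z zr; apply: (le_trans (CT z)).
  apply: (@le_trans _ _ ((`|C| + 1) * nrm z)).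
    by rewrite ler_wpM2r ?nrm_ge0// (le_trans (ler_norm C))// lerDl.
  apply: (@le_trans _ _ ((`|C| + 1) * (2 * (r%:num / (4 * (`|C| + 1)))))).
    by rewrite ler_wpM2l// ltW.
  have -> : (`|C| + 1) * (2 * (r%:num / (4 * (`|C| + 1)))) = r%:num / 2.
    by field; rewrite gt_eqF.
  by rewrite ler_pdivrMr// mul1r (le_trans r1)// ler1n.
have [f fP] := choice step.
pose s n := iter n f (0%N, 0, PosNum (@ltr01 R)).
have sS n : s n.+1 = f (s n) by [].
have s1 n : (s n).2%:num <= n.+1%:R^-1.
  elim: n => [|n IH]; first by rewrite invr1.
  have s1 : (s n).2%:num <= 1.
    by rewrite (le_trans IH)// invf_le1// ler1n.
  have [m [_ _ _ le _]] := fP _ s1; rewrite sS (le_trans le)//.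
  rewrite (@le_trans _ _ (n.+1%:R^-1 / 4))//; first by rewrite ler_pM2r.
  rewrite -invfM lef_pV2 ?posrE ?mulr_gt0// -natrM ler_nat; lia.
have s1' n : (s n).2%:num <= 1 by rewrite (le_trans (s1 n))// invf_le1// ler1n.
have sk n : (s n).1.1 = n.
  elim: n => // n IH; have [m [E _ _ _ _]] := fP _ (s1' n); by rewrite sS E IH.
have d n p : nrm ((s (n + p)%N).1.2 - (s n).1.2) <= 2 * (s n).2%:num - 2 * (s (n + p)%N).2%:num.
  elim: p => [|p IH]; first by rewrite addn0 !subrr nrm0.
  rewrite addnS; have [m [_ dx _ le _]] := fP _ (s1' (n + p)%N).
  rewrite -sS in dx le.
  have := nrmBD (s (n + p).+1).1.2 (s (n + p)%N).1.2 (s n).1.2.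
  move: IH dx le; have : 0 < (s (n + p)%N).2%:num by [].
  lra.
have dd n m : (n <= m)%N -> nrm ((s m).1.2 - (s n).1.2) <= 2 * (s n).2%:num.
  move=> nm; rewrite -(subnKC nm) (le_trans (d _ _))//.
  have : 0 < (s (n + (m - n))%N).2%:num by [].
  lra.
have [x xP] : exists x : X, (s n).1.2 @[n --> \oo] --> x.
  apply: (@cauchy_seq_cvg _ _ _ (fun n => 2 * (s n).2%:num)).
    apply/cvg_realP => e e0; have e2 : 0 < e / 2 by rewrite divr_gt0.
    have [N NP] := small_invn e2.
    exists N => n /NP h; rewrite sub0r normrN ger0_norm ?mulr_ge0//.
    by rewrite mulrC -ltr_pdivlMr// (le_lt_trans (s1 n)).
  move=> n m; have := dd m n; have := dd n m; rewrite (nrmC (s m).1.2).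
  have : 0 < (s n).2%:num by []. have : 0 < (s m).2%:num by [].
  move=> h1 h2 h3 h4; case/orP: (leq_total n m) => [/h3|/h4]; lra.
have dx n : nrm (x - (s n).1.2) <= 2 * (s n).2%:num.
  apply: le_of_eps => e e0; have [N NP] := (cvg_seqP _ _).1 xP e e0.
  have := NP _ (leq_maxr n N); have := dd n _ (leq_maxl n N).
  have := nrmBD x (s (maxn n N)).1.2 (s n).1.2; lra.
have [M MP] := pT x.
have [k kM] : exists k : nat, 2 * M + 2 < k%:R.
  exists (Num.truncn `|2 * M + 2|).+1; apply: le_lt_trans (ler_norm _) _.
  exact: truncnS_gt.
have [m [_ _ km _ Ty]] := fP _ (s1' k); rewrite -sS sk in km Ty.
have [C [lT _]] := bT m.
have := Ty _ (dx k.+1); rewrite (linear_sub _ _ lT).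
have := nrmB (T m x) (T m x - T m (s k.+1).1.2).
rewrite opprB addrC subrK; move: (MP m) km kM; lra.
Qed.

End BanachSteinhaus.

(** * Differences of powers of a Ritt operator *)
Section RootsOfUnity.
Variable R : realType.
Implicit Types (z w : R[i]).

Lemma primitive_root_exists (L : nat) : (0 < L)%N -> exists w : R[i], L.-primitive_root w.
Proof.
move=> L0; have [s Ds] := closed_field_poly_normal ('X^L - 1 : {poly R[i]}).
rewrite (monicP _) ?monicXnsubC// scale1r in Ds.
have s1 : all L.-unity_root s by apply/allP => z; rewrite -root_prod_XsubC -Ds.
have us : uniq s by rewrite -separable.separable_prod_XsubC -Ds cyclotomic.separable_Xn_sub_1// pnatr_eq0 -lt0n.
have sL : (L <= size s)%N by rewrite -ltnS -(size_prod_XsubC s id) -Ds size_XnsubC.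
by have /hasP[w _ wL] := cyclic.has_prim_root L0 s1 us sL; exists w.
Qed.

Lemma sum_root_powers L w (e : nat) : L.-primitive_root w ->
  \sum_(j < L) (w ^+ e) ^+ j = if (L %| e)%N then L%:R else 0.
Proof.
move=> pw; rewrite (prim_order_dvd pw).
case: eqP => [->|/eqP we1].
  under eq_bigr do rewrite expr1n; by rewrite sumr_const card_ord.
have : (w ^+ e - 1) * \sum_(j < L) (w ^+ e) ^+ j = 0.
  by rewrite -subrX1 exprAC (prim_expr_order pw) expr1n subrr.
by move/eqP; rewrite mulf_eq0 subr_eq0 (negbTE we1)/= => /eqP.
Qed.

Lemma cabs_root L w : (0 < L)%N -> w ^+ L = 1 -> cabs w = 1.
Proof.
move=> L0 wL; have := cabsX w L; rewrite wL cabs1 => /esym/eqP.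
by rewrite pexpr_eq1 ?cabs_ge0// => /eqP.
Qed.

Lemma Re_sum (I : finType) (F : I -> R[i]) :
  complex.Re (\sum_i F i) = \sum_i complex.Re (F i).
Proof. by apply: big_morph => // -[a b] [c d]. Qed.

(** This expresses |1 - z|^-2 through a harmonic function, whose averages over
    roots of unity are explicit. *)
Lemma poisson_kernel z : z != 1 ->
  (cabs (1 - z)) ^- 2 * (1 - cabs z ^+ 2) = 2 * complex.Re (1 - z)^-1 - 1.
Proof.
case: z => x y z1; have d0 : (1 - x) ^+ 2 + y ^+ 2 != 0.
  apply: contra z1; rewrite paddr_eq0 ?sqr_ge0// !sqrf_eq0 subr_eq0.
  by move=> /andP[/eqP <- /eqP ->].
by rewrite !cabs_sqr /= !sub0r sqrrN; field.
Qed.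

(** The mean of |1 - z|^-2 over the points z = rho w^j of a circle.  Summing the
    geometric series, the mean of 1 / (1 - z) is 1 / (1 - rho^L): only the
    exponents divisible by L survive, so the finitely many points behave as the
    whole circle as soon as rho^L is not close to 1. *)
Lemma poisson_sum L w (rho : R) : L.-primitive_root w -> 0 <= rho -> rho < 1 ->
  rho ^+ L <= 1 / 2 ->
  (\sum_(j < L) (cabs (1 - rho%:C * w ^+ j)) ^- 2) * (1 - rho ^+ 2) <= 3 * L%:R.
Proof.
move=> pw r0 r1 qh; have L0 := prim_order_gt0 pw.
have w1 := cabs_root L0 (prim_expr_order pw).
pose z (j : 'I_L) := rho%:C * w ^+ j.
have cz j : cabs (z j) = rho by rewrite /z cabsM cabs_pos// cabsX w1 expr1n mulr1.
have z1 j : z j != 1.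
  by apply/eqP => zj; have := cz j; rewrite zj cabs1 => r1'; move: r1; rewrite -r1' ltxx.
have zL j : z j ^+ L = (rho ^+ L)%:C.
  by rewrite /z exprMn -rmorphXn -exprM mulnC exprM (prim_expr_order pw) expr1n mulr1.
rewrite mulr_suml (eq_bigr (fun j => 2 * complex.Re (1 - z j)^-1 - 1)); last first.
  by move=> j _; rewrite -(poisson_kernel (z1 j)) cz.
rewrite big_split/= -mulr_sumr -Re_sum sumrN sumr_const card_ord.
set q := rho ^+ L in qh zL *.
have q1 : 0 < 1 - q by lra.
have -> : \sum_j (1 - z j)^-1 = (L%:R / (1 - q))%:C.
  transitivity (\sum_(j < L) \sum_(m < L) (1 - q)%:C^-1 * (rho ^+ m)%:C * (w ^+ m) ^+ j).
    apply: eq_bigr => j _.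
    have u0 : 1 - z j != 0 by rewrite subr_eq0 eq_sym.
    have q0 : (1 - q)%:C != 0 by rewrite -cabs_gt0 cabs_pos// ltW.
    apply: (mulfI u0); rewrite mulfV//.
    under eq_bigr do rewrite -mulrA.
    rewrite -mulr_sumr mulrCA; apply: (mulfI q0); rewrite mulVKf// mulr1.
    rewrite (eq_bigr (fun m : 'I_L => z j ^+ m)); last first.
      by move=> m _; rewrite /z exprMn -rmorphXn -!exprM mulnC.
    have := subrX1 (z j) L; rewrite zL => E.
    by rewrite -[1 - z j]opprB mulNr -E rmorphB/= opprB rmorph1.
  rewrite exchange_big/=.
  under eq_bigr do rewrite -mulr_sumr (sum_root_powers _ pw).
  rewrite (bigD1 (Ordinal L0))//= big1 ?addr0.
    have E : (L%:R / (1 - q))%:C = (1 - q)%:C^-1 * L%:R :> R[i].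
      by rewrite [LHS]rmorphM/= rmorph_nat fmorphV mulrC.
    by rewrite dvdn0 expr0 mulr1 E.
  move=> i i0; rewrite gtnNdvd ?mulr0//.
  by rewrite lt0n; apply: contra i0 => /eqP i0; apply/eqP/val_inj.
rewrite /= [leLHS](_ : _ = L%:R * (2 / (1 - q) - 1)); last first.
  by rewrite -mulr_natr; ring.
rewrite mulrC ler_wpM2r// lerBlDr ler_pdivrMr//; lra.
Qed.

End RootsOfUnity.

Section Ritt.
Variables (R : realType) (X : completeNormedModType R[i]).
Variables (r : X -> X) (B C : R).
Hypothesis lr : linear r.
Hypothesis B0 : 0 <= B.
Hypothesis C0 : 0 <= C.
Hypothesis powB : forall n x, nrm (iter n r x) <= B * nrm x.
Hypothesis ritt : forall (z : R[i]) y, cabs z < 1 ->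
  cabs (1 - z) * nrm y <= C * nrm (y - z *: r y).

Lemma iter_linear n : linear (iter n r).
Proof. by elim: n => [|n IH] k x y //=; rewrite IH lr. Qed.

Lemma linear_bigsum (L : X -> X) (I : finType) (F : I -> X) : linear L ->
  L (\sum_i F i) = \sum_i L (F i).
Proof.
move=> lL; apply: big_morph; first by move=> x y; exact: linear_add.
exact: linear_zero.
Qed.

(** The partial sums of the Neumann series of (1 - z r)^-1.  They are used in
    place of the resolvent, because they exist without any convergence and are
    polynomials in z whose coefficients can be extracted exactly by finite
    averages. *)
Definition trunc_neumann N (z : R[i]) (x : X) : X := \sum_(m < N) z ^+ m *: iter m r x.

Lemma trunc_neumannE N z x :
  trunc_neumann N z x - z *: r (trunc_neumann N z x) = x - z ^+ N *: iter N r x.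
Proof.
elim: N => [|N IH].
  by rewrite /trunc_neumann big_ord0 (linear_zero lr) scaler0 expr0 scale1r !subrr.
rewrite /trunc_neumann big_ord_recr/= -/(trunc_neumann N z x).
rewrite (linear_add _ _ lr) (linear_scale _ _ lr) scalerDr opprD addrACA IH.
by rewrite scalerA -exprS addrA subrK.
Qed.

Lemma power_remainder_bound N (z : R[i]) x : cabs z < 1 ->
  nrm (x - z ^+ N *: iter N r x) <= (1 + B) * nrm x.
Proof.
move=> z1; rewrite mulrDl mul1r (le_trans (nrmB _ _))// lerD2l nrmZ cabsX.
rewrite -[leRHS]mul1r ler_pM ?nrm_ge0// ?exprn_ge0 ?cabs_ge0//.
by rewrite exprn_ile1 ?cabs_ge0// ltW.
Qed.

Lemma trunc_neumann_bound N z x : cabs z < 1 ->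
  cabs (1 - z) * nrm (trunc_neumann N z x) <= C * (1 + B) * nrm x.
Proof.
move=> z1; apply: (le_trans (ritt _ z1)).
by rewrite trunc_neumannE -mulrA ler_wpM2l// power_remainder_bound.
Qed.

Lemma trunc_neumann_diff N z x : cabs z < 1 ->
  cabs z * nrm (trunc_neumann N z x - r (trunc_neumann N z x)) <=
  (1 + C) * (1 + B) * nrm x.
Proof.
move=> z1; rewrite -nrmZ; set y := trunc_neumann N z x.
have -> : z *: (y - r y) = (y - z *: r y) - (1 - z) *: y.
  by rewrite scalerBr scalerBl scale1r opprB [RHS]addrC addrA subrK.
rewrite trunc_neumannE (le_trans (nrmB _ _))// -mulrA mulrDl mul1r lerD ?power_remainder_bound//.
by rewrite nrmZ mulrA trunc_neumann_bound.
Qed.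

(** The coefficient of z^(N-1) in (1 + z + ... + z^(N-1))^3. *)
Definition cube_coef N : nat :=
  (\sum_(a < N) \sum_(b < N) \sum_(c < N) (a + b + c == N.-1))%N.

Lemma cube_coefE N : (cube_coef N * 2 = N * N.+1)%N.
Proof.
case: N => [|n]; first by rewrite /cube_coef big_ord0.
have S1 (k m : nat) : (\sum_(c < m) (k + c == n) = ((k <= n) && (n < k + m)))%N.
  elim: m => [|m IH]; first by rewrite big_ord0; lia.
  rewrite big_ord_recr/= IH; lia.
have S2 (a m : nat) : (a <= n)%N -> (\sum_(b < m) (a + b <= n) = minn m (n.+1 - a))%N.
  move=> an; elim: m => [|m IH]; first by rewrite big_ord0; lia.
  by rewrite big_ord_recr/= IH; lia.
have S3 (m : nat) : (m <= n.+1)%N ->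
    ((\sum_(a < m) (n.+1 - a)) * 2 = m * (2 * n.+1 + 1 - m))%N.
  elim: m => [|m IH] mn; first by rewrite big_ord0.
  rewrite big_ord_recr/= mulnDl IH ?(ltnW mn)//.
  move: mn; set N := n.+1 => mn.
  have [p ->] : exists p, (N = m + p.+1)%N by exists (N - m.+1)%N; lia.
  rewrite (_ : m + p.+1 - m = p.+1)%N; last lia.
  rewrite (_ : 2 * (m + p.+1) + 1 - m = m + 2 * p + 3)%N; last lia.
  rewrite (_ : 2 * (m + p.+1) + 1 - m.+1 = m + 2 * p + 2)%N; last lia.
  lia.
transitivity ((\sum_(a < n.+1) (n.+1 - a)) * 2)%N.
  congr (_ * 2)%N; apply: eq_bigr => a _.
  have an : (a <= n)%N by rewrite -ltnS.
  rewrite (eq_bigr (fun b : 'I_n.+1 => nat_of_bool (a + b <= n)%N)); last first.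
    by move=> b _; rewrite S1; lia.
  by rewrite S2//; lia.
by rewrite S3//; lia.
Qed.

Lemma trunc_neumann_cube N z x :
  let y := trunc_neumann N z (trunc_neumann N z (trunc_neumann N z x)) in
  y - r y = \sum_(a < N) \sum_(b < N) \sum_(c < N)
     z ^+ (a + b + c) *: (iter (a + b + c) r x - iter (a + b + c).+1 r x).
Proof.
pose Q u := u - r u.
have lQ : linear Q.
  by move=> k u v; rewrite /Q lr scalerBr opprD addrACA.
move=> /=; set y1 := trunc_neumann N z x.
rewrite -[LHS]/(Q _).
have -> : trunc_neumann N z (trunc_neumann N z y1) =
  \sum_(a < N) \sum_(b < N) \sum_(c < N) z ^+ (a + b + c) *: iter (a + b + c) r x.
  rewrite {1}/trunc_neumann; apply: eq_bigr => a _; rewrite /trunc_neumann.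
  rewrite (linear_bigsum _ (iter_linear a)) scaler_sumr; apply: eq_bigr => b _.
  rewrite (linear_scale _ _ (iter_linear a)) scalerA -exprD -iterD.
  rewrite /y1 /trunc_neumann (linear_bigsum _ (iter_linear _)) scaler_sumr.
  apply: eq_bigr => c _.
  by rewrite (linear_scale _ _ (iter_linear _)) scalerA -exprD -iterD.
rewrite (linear_bigsum _ lQ); apply: eq_bigr => a _.
rewrite (linear_bigsum _ lQ); apply: eq_bigr => b _.
rewrite (linear_bigsum _ lQ); apply: eq_bigr => c _.
by rewrite (linear_scale _ _ lQ).
Qed.

(** The factor w^((L - n) j) = w^(- n j) extracts the coefficient of z^n.  The
    degrees are at most 3 n < L, so no other exponent is congruent to n modulo
    L, and all the triples (a, b, c) of sum n occur in the truncated cube. *)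
Lemma cube_average n (w : R[i]) (rho : R) x : (3 * n.+1).-primitive_root w ->
  \sum_(j < 3 * n.+1) (w ^+ (3 * n.+1 - n)) ^+ j *:
    (\sum_(a < n.+1) \sum_(b < n.+1) \sum_(c < n.+1)
     (rho%:C * w ^+ j) ^+ (a + b + c) *: (iter (a + b + c) r x - iter (a + b + c).+1 r x))
  = ((cube_coef n.+1 * (3 * n.+1))%:R * rho ^+ n)%:C *: (iter n r x - iter n.+1 r x).
Proof.
move=> pw; set L := (3 * n.+1)%N.
transitivity (\sum_(a < n.+1) \sum_(b < n.+1) \sum_(c < n.+1)
   (((a + b + c == n)%N * L)%:R * rho ^+ n)%:C *: (iter n r x - iter n.+1 r x)).
  under eq_bigr do rewrite scaler_sumr.
  rewrite exchange_big/=; apply: eq_bigr => a _.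
  under eq_bigr do rewrite scaler_sumr.
  rewrite exchange_big/=; apply: eq_bigr => b _.
  under eq_bigr do rewrite scaler_sumr.
  rewrite exchange_big/=; apply: eq_bigr => c _.
  set e := (a + b + c)%N.
  rewrite (eq_bigr (fun j : 'I_L => ((rho ^+ e)%:C * (w ^+ (L - n + e)) ^+ j) *:
     (iter e r x - iter e.+1 r x))); last first.
    move=> j _; rewrite scalerA; congr (_ *: _).
    rewrite exprMn -rmorphXn/= mulrCA; congr (_ * _).
    by rewrite exprD exprMn; congr (_ * _); rewrite -!exprM mulnC.
  rewrite -scaler_suml -mulr_sumr (sum_root_powers _ pw).
  have -> : (L %| L - n + e)%N = (e == n).
    have : (e <= 3 * n)%N by rewrite /e; have := ltn_ord a; have := ltn_ord b; have := ltn_ord c; lia.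
    rewrite /L => e3; apply/idP/eqP => [/dvdnP[k]|->]; last by rewrite subnK ?dvdnn//; lia.
    case: k => [|[|k]]; lia.
  case: eqP => [->|_]; last by rewrite mulr0 mul0n mul0r !scale0r.
  by rewrite mul1n mulrC rmorphM/= rmorph_nat.
rewrite /cube_coef.
under eq_bigr do under eq_bigr do under eq_bigr do rewrite natrM.
rewrite natrM natr_sum mulr_suml mulr_suml rmorph_sum scaler_suml.
apply: eq_bigr => a _; rewrite natr_sum mulr_suml mulr_suml rmorph_sum scaler_suml.
apply: eq_bigr => b _; rewrite natr_sum mulr_suml mulr_suml rmorph_sum scaler_suml.
by apply: eq_bigr.
Qed.

(** Ritt's theorem in quantitative form.  The coefficient of z^n in
    (1 - r) P(z)^3, with P the truncated Neumann series of length N = n + 1, is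
    r^n - r^(n+1) times N (N + 1) / 2.  On the other hand (1 - r) P(z) is bounded
    and each of the two other factors is bounded by a multiple of 1 / |1 - z|,
    so the coefficient is at most a multiple of the mean of |1 - z|^-2 on the
    circle of radius rho = N / (N + 1), that is, of N + 1.  The quotient of the
    two is O(1 / N); it is the cube that produces the quadratic growth of the
    coefficient. *)
Lemma ritt_power_diff n x :
  nrm (iter n r x - iter n.+1 r x) <=
  6 * expR 1 * ((1 + C) * (1 + B) * (C * (1 + B)) ^+ 2) / n.+1%:R * nrm x.
Proof.
set K := (1 + C) * _ * _.
have K0 : 0 <= K by rewrite /K !mulr_ge0 ?sqr_ge0 ?addr_ge0.
have KE : K = (1 + C) * (1 + B) * (C * (1 + B)) ^+ 2 by [].
clearbody K.
pose N := n.+1; pose L := (3 * N)%N.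
have N0 : 0 < N%:R :> R by rewrite ltr0n.
pose rho : R := N%:R / N.+1%:R.
have r0 : 0 < rho by rewrite divr_gt0.
have r1 : rho < 1 by rewrite ltr_pdivrMr ?ltr0n// mul1r ltr_nat.
have rV : rho^-1 = 1 + N%:R^-1 by rewrite /rho invf_div -natr1 mulrDl divff ?gt_eqF// mul1r.
have rE : N.+1%:R^-1 = 1 - rho.
  by rewrite /rho -natr1; field; rewrite natr1 pnatr_eq0.
clearbody rho.
have rK0 : 0 <= rho^-1 * K * nrm x.
  by rewrite mulr_ge0 ?nrm_ge0// mulr_ge0// invr_ge0 ltW.
(* 1 / rho = 1 + 1 / N *)
have rNe : (rho ^+ N)^-1 <= expR 1.
  rewrite -exprVn rV -(_ : expR (N%:R^-1) ^+ N = expR 1); last first.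
    by rewrite -expRM_natl mulfV// gt_eqF.
  by rewrite lerXn2r ?nnegrE ?addr_ge0 ?invr_ge0 ?expR_ge0// expR_ge1Dx.
(* (1 + 1 / N)^N >= 2 by the Bernoulli inequality *)
have rN2 : rho ^+ N <= 1 / 2.
  rewrite -[rho ^+ N]invrK div1r lef_pV2 ?posrE ?invr_gt0 ?exprn_gt0//.
  rewrite -exprVn rV.
  have bern m : 1 + m%:R * N%:R^-1 <= (1 + N%:R^-1 : R) ^+ m.
    elim: m => [|m IH]; first by rewrite mul0r addr0.
    rewrite exprS; apply: (@le_trans _ _ ((1 + N%:R^-1) * (1 + m%:R * N%:R^-1))).
      rewrite -natr1; set t := N%:R^-1; have : 0 <= t by rewrite invr_ge0.
      have : 0 <= m%:R :> R by []. nra.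
    by rewrite ler_wpM2l// addr_ge0// invr_ge0.
  by apply: le_trans (bern N); rewrite mulfV ?gt_eqF.
have rL : rho ^+ L <= 1 / 2.
  apply: le_trans rN2; rewrite /L mulnC exprM.
  have q0 : 0 <= rho ^+ N by rewrite exprn_ge0// ltW.
  have q1 : rho ^+ N <= 1 by rewrite exprn_ile1// ltW.
  by rewrite -[leRHS]expr1 ler_wiXn2l.
have [w pw] := primitive_root_exists R (isT : (0 < L)%N).
have w1 := cabs_root (isT : (0 < L)%N) (prim_expr_order pw).
pose z (j : 'I_L) := rho%:C * w ^+ j.
have cz j : cabs (z j) = rho by rewrite /z cabsM (cabs_pos (ltW r0)) cabsX w1 expr1n mulr1.
pose P := trunc_neumann N.
pose y j := P (z j) (P (z j) (P (z j) x)).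
have c1 j : cabs (z j) < 1 by rewrite cz.
have u0 j : 0 < cabs (1 - z j).
  rewrite cabs_gt0 subr_eq0 eq_sym; apply/eqP => zj; have := cz j.
  by rewrite zj cabs1 => E; move: r1; rewrite -E ltxx.
have yB j : nrm (y j - r (y j)) <= rho^-1 * K * nrm x * (cabs (1 - z j)) ^- 2.
  have := trunc_neumann_diff N (P (z j) (P (z j) x)) (c1 j).
  have h1 := trunc_neumann_bound N x (c1 j).
  have h2 := trunc_neumann_bound N (P (z j) x) (c1 j).
  rewrite -/(P (z j) x) in h1; rewrite -/(P (z j) (P (z j) x)) in h2.
  rewrite -/(P (z j) (P (z j) (P (z j) x))) -/(y j) cz.
  rewrite KE; move: h1 h2; rewrite mulrC -ler_pdivlMr// => h1; rewrite mulrC -ler_pdivlMr// => h2 h3.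
  rewrite -!mulrA -ler_pdivrMl ?invr_gt0// invrK; apply: (le_trans h3).
  have CB : 0 <= C * (1 + B) by rewrite mulr_ge0// addr_ge0.
  have h4 : nrm (P (z j) (P (z j) x)) <= (C * (1 + B)) ^+ 2 * nrm x * cabs (1 - z j) ^- 2.
    apply: (le_trans h2); rewrite ler_pdivrMr//.
    apply: (@le_trans _ _ (C * (1 + B) * (C * (1 + B) * nrm x / cabs (1 - z j)))).
      by rewrite ler_wpM2l.
    have := u0 j; move: (cabs (1 - z j)) => d d0.
    by rewrite le_eqVlt; apply/orP; left; apply/eqP; field; rewrite gt_eqF.
  apply: (@le_trans _ _ ((1 + C) * (1 + B) * ((C * (1 + B)) ^+ 2 * nrm x * cabs (1 - z j) ^- 2))).
    by rewrite ler_wpM2l// mulr_ge0// addr_ge0.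
  rewrite le_eqVlt; apply/orP; left; apply/eqP.
  by move: (nrm x) (cabs (1 - z j) ^- 2) => u v; ring.
have := cube_average rho x pw; rewrite -/L -/N.
move=> /(congr1 (@nrm R X)); rewrite nrmZp; last by rewrite mulr_ge0// exprn_ge0// ltW.
set Q := nrm (_ - _) => E.
have : (cube_coef N * L)%:R * rho ^+ n * Q <= rho^-1 * K * nrm x * (3 * L%:R / (1 - rho ^+ 2)).
  rewrite -E (le_trans (nrm_sum _ _ _))//.
  have := poisson_sum pw (ltW r0) r1 rL.
  have d0 : 0 < 1 - rho ^+ 2 by rewrite subr_gt0 exprn_ilt1// ltW.
  rewrite -ler_pdivlMr// => ps.
  apply: (@le_trans _ _ (rho^-1 * K * nrm x * (\sum_(j < L) cabs (1 - rho%:C * w ^+ j) ^- 2))).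
    rewrite mulr_sumr; apply: ler_sum => j _.
    rewrite nrmZ !cabsX w1 !expr1n mul1r -/(z j).
    rewrite -(trunc_neumann_cube N (z j) x); exact: yB.
  by rewrite ler_wpM2l.
have Q0 : 0 <= Q by exact: nrm_ge0.
have x0 : 0 <= nrm x by exact: nrm_ge0.
(* 1 - rho^2 >= 1 - rho = 1 / (N + 1) *)
have d1 : (1 - rho ^+ 2)^-1 <= N.+1%:R.
  rewrite -[N.+1%:R]invrK lef_pV2 ?posrE ?invr_gt0//; last first.
    by rewrite subr_gt0 exprn_ilt1// ltW.
  by rewrite rE lerD2l lerN2 -[leRHS]expr1 ler_wiXn2l// ltW.
have L0 : 0 < L%:R :> R by rewrite ltr0n.
have cN : (cube_coef N)%:R = N%:R * N.+1%:R / 2 :> R.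
  by rewrite -natrM -cube_coefE natrM mulfK.
rewrite natrM cN => H.
have {}H : N%:R * N.+1%:R / 2 * rho ^+ n * Q <= rho^-1 * K * nrm x * (3 * N.+1%:R).
  have : N%:R * N.+1%:R / 2 * L%:R * rho ^+ n * Q <= rho^-1 * K * nrm x * (3 * L%:R * N.+1%:R).
    apply: (le_trans H); rewrite ler_wpM2l//.
    by rewrite ler_wpM2l// mulr_ge0// ltW.
  have -> : N%:R * N.+1%:R / 2 * L%:R * rho ^+ n * Q = L%:R * (N%:R * N.+1%:R / 2 * rho ^+ n * Q) by ring.
  have -> : rho^-1 * K * nrm x * (3 * L%:R * N.+1%:R) = L%:R * (rho^-1 * K * nrm x * (3 * N.+1%:R)) by ring.
  by rewrite ler_pM2l.
have {}H : N%:R * Q <= 6 * (rho ^+ N)^-1 * K * nrm x.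
  have N1 : 0 < N.+1%:R / 2 * rho ^+ n by rewrite mulr_gt0 ?exprn_gt0// divr_gt0.
  rewrite -(ler_pM2l N1).
  have -> : N.+1%:R / 2 * rho ^+ n * (N%:R * Q) = N%:R * N.+1%:R / 2 * rho ^+ n * Q by ring.
  apply: (le_trans H); rewrite le_eqVlt; apply/orP; left; apply/eqP.
  rewrite /N exprS; field; rewrite ?gt_eqF ?exprn_gt0//.
rewrite mulrAC ler_pdivlMr// mulrC; apply: (le_trans H).
by rewrite ler_wpM2r// ler_wpM2r// ler_wpM2l.
Qed.

End Ritt.

(** * Bounded semigroups with resolvent bounds in a half-plane *)
Section BoundedSemigroup.
Variables (R : realType) (X : completeNormedModType R[i]).
Variables (dA : set X) (A : X -> X) (S : R -> X -> X) (B M : R).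
Hypothesis lA : linear_on dA A.
Hypothesis B0 : 0 <= B.
Hypothesis M0 : 0 <= M.
Hypothesis linS : forall t : R, 0 <= t -> linear (S t).
Hypothesis S0 : forall x, S 0 x = x.
Hypothesis SD : forall (t u : R) x, 0 <= t -> 0 <= u -> S (t + u) x = S t (S u x).
Hypothesis SB : forall (t : R) x, 0 <= t -> nrm (S t x) <= B * nrm x.
Hypothesis gen : forall x, dA x -> forall e : R, 0 < e -> exists2 d : R, 0 < d &
  forall h : R, 0 < h -> h < d -> nrm (S h x - x - h%:C *: A x) <= e * h.
Hypothesis inv : forall (t : R) x, 0 <= t -> dA x -> dA (S t x) /\ A (S t x) = S t (A x).
Hypothesis dense : closure dA = [set: X].
Hypothesis res : forall z : R[i], 0 < complex.Re z ->
  exists Rl, is_resolvent dA A z Rl /\ forall x, nrm (Rl x) <= M / cabs z * nrm x.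

Lemma linear_onD x y : dA x -> dA y -> dA (x + y) /\ A (x + y) = A x + A y.
Proof. by move=> dx dy; have := lA.2 1 x y dx dy; rewrite !scale1r. Qed.

Lemma linear_onZ k x : dA x -> dA (k *: x) /\ A (k *: x) = k *: A x.
Proof.
move=> dx; have [d0 _] := lA; have [_ A00] := linear_onD d0 d0.
have A0 : A 0 = 0 by apply: (@addrI _ (A 0)); rewrite addr0 -A00 addr0.
by have := lA.2 k x 0 dx d0; rewrite A0 !addr0.
Qed.

Lemma linear_onB x y : dA x -> dA y -> dA (x - y) /\ A (x - y) = A x - A y.
Proof.
move=> dx dy; have [dy' Ay'] := linear_onZ (-1) dy.
by have := linear_onD dx dy'; rewrite Ay' !scaleN1r.
Qed.

Lemma orbit_sum (h : R) (n : nat) x : 0 <= h ->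
  S (n%:R * h) x - x = \sum_(k < n) S (k%:R * h) (S h x - x).
Proof.
move=> h0; elim: n => [|n IH]; first by rewrite mul0r S0 subrr big_ord0.
rewrite big_ord_recr/= -IH (linear_sub _ _ (linS _)) ?mulr_ge0//.
by rewrite -SD ?mulr_ge0// -natr1 mulrDl mul1r addrC subrKA.
Qed.

(** The derivative at 0 is known only pointwise: the interval [0, h] is cut into
    pieces so small that the first-order expansion holds on each of them, and
    the semigroup property transports it along the orbit. *)
Lemma orbit_lipschitz (h : R) x : 0 <= h -> dA x -> nrm (S h x - x) <= h * B * nrm (A x).
Proof.
move=> h0 dx; have [->|hn0] := eqVneq h 0; first by rewrite S0 subrr nrm0 !mul0r.
have hp : 0 < h by rewrite lt0r hn0.
apply: le_of_eps => e e0.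
have hB : 0 < h * (B + 1) by rewrite mulr_gt0// ltr_wpDl.
have [d d0 dP] := gen dx (divr_gt0 e0 hB).
have [N NP] := small_invn (divr_gt0 d0 hp).
have N1 := NP N (leqnn _); pose n := N.+1; pose s : R := h / n%:R.
have s0 : 0 < s by rewrite divr_gt0// ltr0n.
have sd : s < d by rewrite /s mulrC -ltr_pdivlMr.
have ns : n%:R * s = h by rewrite /s mulrC divfK// pnatr_eq0.
have := orbit_sum n x (ltW s0); rewrite ns => ->.
have := dP s s0 sd; set eps := e / _ => hd.
have Ssx : nrm (S s x - x) <= eps * s + s * nrm (A x).
  have := nrmD (S s x - x - s%:C *: A x) (s%:C *: A x); rewrite subrK.
  by rewrite nrmZp ?(ltW s0)// => /le_trans; apply; rewrite lerD2r.
apply: (le_trans (nrm_sum _ _ _)).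
apply: (@le_trans _ _ (\sum_(k < n) B * (eps * s + s * nrm (A x)))).
  apply: ler_sum => k _; apply: (le_trans (SB _ _)); first by rewrite mulr_ge0// ltW.
  by rewrite ler_wpM2l.
rewrite sumr_const card_ord -[leLHS]mulr_natl.
set a := nrm (A x).
have -> : n%:R * (B * (eps * s + s * a)) = B * (eps * (n%:R * s) + (n%:R * s) * a) by ring.
rewrite ns.
have eps0 : 0 < eps by rewrite divr_gt0.
have : eps * (h * (B + 1)) = e by rewrite /eps divfK// gt_eqF.
have : 0 <= a by exact: nrm_ge0. nra.
Qed.

(** The same subdivision, with the increments of S(t) A x along the orbit
    controlled by the Lipschitz estimate. *)
Lemma orbit_second (h : R) x : 0 <= h -> dA x -> dA (A x) ->
  nrm (S h x - x - h%:C *: A x) <= h ^+ 2 * B * nrm (A (A x)).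
Proof.
move=> h0 dx dAx; have [->|hn0] := eqVneq h 0.
  by rewrite S0 subrr scale0r subr0 nrm0 expr0n/= !mul0r.
have hp : 0 < h by rewrite lt0r hn0.
apply: le_of_eps => e e0.
have hB : 0 < h * (B + 1) by rewrite mulr_gt0// ltr_wpDl.
have [d d0 dP] := gen dx (divr_gt0 e0 hB).
have [N NP] := small_invn (divr_gt0 d0 hp).
have N1 := NP N (leqnn _); pose n := N.+1; pose s : R := h / n%:R.
have s0 : 0 < s by rewrite divr_gt0// ltr0n.
have sd : s < d by rewrite /s mulrC -ltr_pdivlMr.
have ns : n%:R * s = h by rewrite /s mulrC divfK// pnatr_eq0.
have := orbit_sum n x (ltW s0); rewrite ns => ->.
have := dP s s0 sd; set eps := e / _ => hd.
have -> : h%:C *: A x = \sum_(k < n) s%:C *: A x.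
  by rewrite sumr_const card_ord scalerMnl -{1}ns rmorphM/= rmorph_nat mulr_natl.
rewrite -sumrB; apply: (le_trans (nrm_sum _ _ _)).
apply: (@le_trans _ _ (\sum_(k < n) (B * (eps * s) + s * (h * B * nrm (A (A x)))))).
  apply: ler_sum => k _.
  have ks0 : 0 <= k%:R * s by rewrite mulr_ge0// ltW.
  have ksh : k%:R * s <= h by rewrite -ns ler_pM2r// ler_nat ltnW.
  have -> : S (k%:R * s) (S s x - x) - s%:C *: A x =
     S (k%:R * s) (S s x - x - s%:C *: A x) + s%:C *: (S (k%:R * s) (A x) - A x).
    rewrite [S _ (_ - s%:C *: _)](linear_sub _ _ (linS ks0)).
    by rewrite (linear_scale _ _ (linS ks0)) scalerBr addrA subrK.
  apply: (le_trans (nrmD _ _)); apply: lerD.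
    by apply: (le_trans (SB _ ks0)); rewrite ler_wpM2l.
  rewrite nrmZp ?(ltW s0)// ler_pM2l//; apply: (le_trans (orbit_lipschitz ks0 dAx)).
  by rewrite ler_wpM2r ?nrm_ge0// ler_wpM2r.
rewrite sumr_const card_ord -[leLHS]mulr_natl.
set a := nrm (A (A x)).
have -> : n%:R * (B * (eps * s) + s * (h * B * a)) =
  B * (eps * (n%:R * s)) + (n%:R * s) * (h * B * a) by ring.
rewrite ns.
have eps0 : 0 < eps by rewrite divr_gt0.
have : eps * (h * (B + 1)) = e by rewrite /eps divfK// gt_eqF.
have : 0 <= a by exact: nrm_ge0. rewrite expr2; nra.
Qed.

(** [r] is the bounded operator (1 - h A)^-1. *)
Definition euler_step (h : R) (r : X -> X) : Prop :=
  (forall x, dA (r x) /\ r x - h%:C *: A (r x) = x) /\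
  (forall u, dA u -> r (u - h%:C *: A u) = u).

Lemma euler_step_exists h : 0 < h -> exists r, euler_step h r.
Proof.
move=> h0; have hz : 0 < complex.Re (h^-1)%:C by rewrite /= invr_gt0.
have hC : h%:C * (h^-1)%:C = 1 :> R[i] by rewrite -rmorphM/= mulfV// gt_eqF.
have [Rl [[R1 R2] _]] := res hz; exists (fun x => Rl ((h^-1)%:C *: x)); split.
  move=> x; have [d e] := R1 ((h^-1)%:C *: x); split=> //.
  set u := Rl _ in e *.
  rewrite -[RHS]scale1r -hC -scalerA -e scalerBr scalerA hC scale1r //.
by move=> u du; rewrite scalerBr scalerA mulrC hC scale1r R2.
Qed.

Definition ritt_const : R :=
  6 * expR 1 * ((1 + (M + 2)) * (1 + B) * ((M + 2) * (1 + B)) ^+ 2).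

Lemma ritt_const_ge0 : 0 <= ritt_const.
Proof.
have M2 : 0 <= M + 2 by rewrite addr_ge0.
by rewrite /ritt_const !mulr_ge0 ?sqr_ge0 ?expR_ge0 ?addr_ge0.
Qed.

Section EulerStep.
Variables (h : R) (r : X -> X).
Hypothesis h0 : 0 < h.
Hypothesis er : euler_step h r.

Lemma euler_linear : linear r.
Proof.
move=> k x y; have [d1 e1] := er.1 x; have [d2 e2] := er.1 y.
have [dk ek] := linear_onZ k d1; have [dd ed] := linear_onD dk d2.
rewrite -[RHS](er.2 _ dd); congr r.
rewrite ed ek scalerDr opprD addrACA -{1}e1 -{1}e2 scalerBr; congr (_ - _ + _).
by rewrite !scalerA mulrC.
Qed.

Lemma euler_dom x : dA x -> r x = x + h%:C *: r (A x).
Proof.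
move=> dx; have := er.2 _ dx; rewrite (linear_sub _ _ euler_linear).
by rewrite (linear_scale _ _ euler_linear) => /eqP; rewrite subr_eq => /eqP.
Qed.

(** The implicit Euler step does not increase the norm sup_t |S t x|, which is
    equivalent to the given norm; hence its powers are bounded uniformly in h and
    n.  For y = r x and small s, the identity y - h A y = x together with
    s A y = S s y - y + o(s) gives (s + h) y = s x + h S s y + o(s).  Writing Q
    for the supremum at y, this yields (s + h) Q <= s L + h Q + o(s), hence
    Q <= L. *)
Lemma euler_orbit x L : (forall t : R, 0 <= t -> nrm (S t x) <= L) ->
  forall t : R, 0 <= t -> nrm (S t (r x)) <= L.
Proof.
move=> xL; set y := r x; have [dy xE] := er.1 x; rewrite -/y in dy xE.
pose E := [set nrm (S t y) | t in [set t | 0 <= t]].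
have supE : has_sup E.
  split; first by exists (nrm (S 0 y)); exists 0 => //=.
  by exists (B * nrm y) => _ [t /= t0 <-]; exact: SB.
pose Q := sup E.
have QP (t : R) : 0 <= t -> nrm (S t y) <= Q by move=> t0; apply: sup_upper_bound => //; exists t.
suff QL : Q <= L by move=> t t0; exact: le_trans (QP _ t0) QL.
apply: le_of_eps => e e0.
have hB : 0 < h * B + 1 by rewrite ltr_wpDl// mulr_ge0// ltW.
have [d d0 dP] := gen dy (divr_gt0 e0 hB); set eps := e / _ in dP.
pose s := d / 2.
have s0 : 0 < s by rewrite divr_gt0.
have sd : s < d by rewrite /s; lra.
have hd := dP s s0 sd.
have eps0 : 0 < eps by rewrite divr_gt0.
have main (t : R) : 0 <= t -> (s + h) * nrm (S t y) <= s * L + h * Q + h * B * (eps * s).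
  move=> t0.
  have E1 : (s + h)%:C *: y = s%:C *: x + h%:C *: S s y
      - h%:C *: (S s y - y - s%:C *: A y).
    rewrite -xE !scalerBr !scalerA [h%:C * _]mulrC rmorphD/= scalerDl.
    set p := _ *: y; set q := _ *: y; set u := _ *: S s y; set v := _ *: A y.
    by rewrite !opprB addrACA subrK [u + _]addrC subrK.
  rewrite -nrmZp ?addr_ge0 ?(ltW s0) ?(ltW h0)//.
  rewrite -(linear_scale _ _ (linS t0)) E1.
  rewrite (linear_sub _ _ (linS t0)) (linear_add _ _ (linS t0)).
  rewrite !(linear_scale _ _ (linS t0)) -SD ?(ltW s0)//.
  apply: (le_trans (nrmB _ _)); apply: lerD.
    apply: (le_trans (nrmD _ _)); apply: lerD.
      by rewrite nrmZp ?(ltW s0)// ler_pM2l// xL.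
    by rewrite nrmZp ?(ltW h0)// ler_pM2l// QP// addr_ge0// ltW.
  rewrite nrmZp ?(ltW h0)// -mulrA ler_pM2l//.
  by apply: (le_trans (SB _ t0)); rewrite ler_wpM2l.
have sh : 0 < s + h by rewrite addr_gt0.
have QB : Q <= (s * L + h * Q + h * B * (eps * s)) / (s + h).
  apply: ge_sup; first exact: supE.1.
  by move=> _ [t /= t0 <-]; rewrite ler_pdivlMr// mulrC main.
move: QB; rewrite ler_pdivlMr// => QB.
have : eps * (h * B + 1) = e by rewrite /eps divfK// gt_eqF.
have hB0 : 0 <= h * B by rewrite mulr_ge0// ltW.
move: QB hB0; set a := h * B => QB a0 ae.
have : s * Q <= s * (L + a * eps) by lra.
rewrite ler_pM2l// => H; move: ae; lra.
Qed.

Lemma euler_pow n x : nrm (iter n r x) <= B * nrm x.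
Proof.
suff H (t : R) : 0 <= t -> nrm (S t (iter n r x)) <= B * nrm x.
  by have := H 0 (lexx 0); rewrite S0.
by elim: n t => [|n IH] t t0 /=; [exact: SB|exact: euler_orbit].
Qed.

(** With v = r y and w = y - z r y, one has (1 - z) v - h A v = w, so v is the
    value of the resolvent of A at (1 - z) / h, a point of the right half-plane
    for |z| < 1; the resolvent estimate becomes |1 - z| |v| <= M |w|. *)
Lemma euler_ritt (z : R[i]) y : cabs z < 1 ->
  cabs (1 - z) * nrm y <= (M + 2) * nrm (y - z *: r y).
Proof.
move=> z1; set w := y - z *: r y; have [dv yE] := er.1 y; set v := r y in dv yE w *.
have hC : (h^-1)%:C * h%:C = 1 :> R[i] by rewrite -rmorphM/= mulVf// gt_eqF.
pose zt := (h^-1)%:C * (1 - z).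
have ReIm : complex.Re z < 1.
  rewrite -ltcR; apply: le_lt_trans (_ : `|z| < 1); last by rewrite cabsE ltcR.
  by apply: le_trans (normc_ge_Re z); rewrite lecR ler_norm.
have zt0 : 0 < complex.Re zt.
  rewrite /zt; case: (z) ReIm => a b /= ab.
  by rewrite mul0r subr0 mulr_gt0 ?invr_gt0// subr_gt0.
have [Rl [[_ R2] RM]] := res zt0.
have vE : v = Rl ((h^-1)%:C *: w).
  rewrite -[LHS](R2 _ dv); congr Rl; rewrite /w -{1}yE scalerBr scalerBr.
  rewrite [(h^-1)%:C *: (h%:C *: _)]scalerA hC scale1r.
  by rewrite /zt -scalerA scalerBl scale1r scalerBr addrAC.
have z1' : 0 < cabs (1 - z).
  rewrite cabs_gt0 subr_eq0 eq_sym; apply/eqP => zz; move: ReIm.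
  by rewrite zz /= ltxx.
have vM : cabs (1 - z) * nrm v <= M * nrm w.
  have := RM ((h^-1)%:C *: w); rewrite -vE nrmZp ?invr_ge0 ?(ltW h0)//.
  rewrite /zt cabsM cabs_pos ?invr_ge0 ?(ltW h0)//.
  have -> : M / (h^-1 * cabs (1 - z)) * (h^-1 * nrm w) = M * nrm w / cabs (1 - z).
    by move: (cabs (1 - z)) z1' => q q0; field; rewrite ?gt_eqF.
  by rewrite ler_pdivlMr// mulrC.
have yw : nrm y <= nrm w + cabs z * nrm v.
  have -> : y = w + z *: v by rewrite /w subrK.
  by rewrite (le_trans (nrmD _ _))// nrmZ.
have c2 : cabs (1 - z) <= 2.
  apply: (le_trans (cabsD _ _)); rewrite cabs1 cabsN; move: z1; lra.
have w0 := nrm_ge0 w; have v0 := nrm_ge0 v; have zc := cabs_ge0 z.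
apply: (@le_trans _ _ (cabs (1 - z) * (nrm w + cabs z * nrm v))).
  by rewrite ler_wpM2l// ltW.
rewrite mulrDr mulrCA mulrDl addrC lerD//; last by rewrite ler_wpM2r.
by rewrite -[leRHS]mul1r ler_pM// ?mulr_ge0 ?cabs_ge0// ltW.
Qed.

Lemma euler_consistent x : dA x -> dA (A x) ->
  nrm (r x - S h x) <= 2 * B * h ^+ 2 * nrm (A (A x)).
Proof.
move=> dx dAx; have H1 := orbit_second (ltW h0) dx dAx.
have E : r x - x - h%:C *: A x = (h ^+ 2)%:C *: r (A (A x)).
  rewrite (euler_dom dx) [x + _]addrC addrK -scalerBr (euler_dom dAx) [A x + _]addrC addrK.
  by rewrite scalerA -rmorphM/= -expr2.
have := nrmB (r x - x - h%:C *: A x) (S h x - x - h%:C *: A x).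
have -> : r x - x - h%:C *: A x - (S h x - x - h%:C *: A x) = r x - S h x.
  by rewrite -[r x - x - _]addrA -[S h x - x - _]addrA opprD addrACA subrr addr0.
move=> /le_trans; apply.
rewrite E nrmZp ?sqr_ge0//.
have := euler_pow 1 (A (A x)) => /= H2.
have : h ^+ 2 * nrm (r (A (A x))) <= h ^+ 2 * (B * nrm (A (A x))) by rewrite ler_wpM2l// sqr_ge0.
move: H1; lra.
Qed.

Lemma orbit_dom2 (t : R) x : 0 <= t -> dA x -> dA (A x) ->
  [/\ dA (S t x), dA (A (S t x)) & A (A (S t x)) = S t (A (A x))].
Proof.
move=> t0 dx dAx; have [d1 e1] := inv t0 dx; have [d2 e2] := inv t0 dAx.
by split=> //; rewrite e1.
Qed.

(** Stability and consistency.  The induction bounds the error after any further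
    number j of Euler steps, so that the bound for powers of r is applied once to
    every local error instead of being compounded. *)
Lemma euler_converges n x : dA x -> dA (A x) ->
  nrm (iter n r x - S (n%:R * h) x) <= n%:R * (2 * B ^+ 3 * h ^+ 2 * nrm (A (A x))).
Proof.
move=> dx dAx; set D := 2 * B ^+ 2 * h ^+ 2 * nrm (A (A x)).
have D0 : 0 <= D by rewrite /D !mulr_ge0 ?nrm_ge0 ?(ltW h0).
have loc k : nrm (r (S (k%:R * h) x) - S h (S (k%:R * h) x)) <= D.
  have kh0 : 0 <= k%:R * h by rewrite mulr_ge0// ltW.
  have [d1 d2 e2] := orbit_dom2 kh0 dx dAx.
  apply: (le_trans (euler_consistent d1 d2)); rewrite e2.
  have -> : D = 2 * B * h ^+ 2 * (B * nrm (A (A x))) by rewrite /D; ring.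
  by rewrite ler_wpM2l ?SB// !mulr_ge0 ?(ltW h0).
suff H j : nrm (iter j r (iter n r x - S (n%:R * h) x)) <= n%:R * (B * D).
  have := H 0%N; rewrite /=; have -> // : n%:R * (B * D) = n%:R * (2 * B ^+ 3 * h ^+ 2 * nrm (A (A x))).
  by rewrite /D; ring.
elim: n j => [|n IH] j.
  by rewrite mul0r S0 subrr (linear_zero (iter_linear euler_linear j)) nrm0 mul0r.
have -> : iter n.+1 r x - S (n.+1%:R * h) x = r (iter n r x - S (n%:R * h) x)
    + (r (S (n%:R * h) x) - S h (S (n%:R * h) x)).
  rewrite (linear_sub _ _ euler_linear) addrA subrK /=.
  by rewrite -SD ?(ltW h0) ?mulr_ge0 ?(ltW h0)// -natr1 mulrDl mul1r [h + _]addrC.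
rewrite (linear_add _ _ (iter_linear euler_linear j)) -iterSr.
apply: (le_trans (nrmD _ _)); rewrite -natr1 mulrDl mul1r lerD//.
by apply: (le_trans (euler_pow _ _)); rewrite ler_wpM2l.
Qed.

Lemma euler_increment n m x :
  nrm (iter (n.+1 + m) r x - iter n.+1 r x) <= ritt_const * (m%:R / n.+1%:R) * nrm x.
Proof.
have M2 : 0 <= M + 2 by rewrite addr_ge0.
elim: m => [|m IH]; first by rewrite addn0 subrr nrm0 mul0r mulr0 mul0r.
have := ritt_power_diff euler_linear B0 M2 euler_pow euler_ritt (n.+1 + m) x.
rewrite -/ritt_const => H; rewrite addnS.
apply: (le_trans (nrmBD _ (iter (n.+1 + m) r x) _)).
rewrite -natr1 [(_ + 1) / _]mulrDl mulrDr mulrDl addrC lerD//.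
rewrite nrmC (le_trans H)//; rewrite ler_wpM2r ?nrm_ge0// ler_wpM2l ?ritt_const_ge0//.
by rewrite mul1r lef_pV2 ?posrE// ler_nat; lia.
Qed.

End EulerStep.

(** The increments of the powers of the implicit Euler step are O(m / n) by
    Ritt's theorem; this passes to the limit along the steps h = t / (n + 1),
    with m the integer part of u / h. *)
Lemma analytic_dom2 (t u : R) x : 0 < t -> 0 <= u -> dA x -> dA (A x) ->
  nrm (S (t + u) x - S t x) <= ritt_const * (u / t) * nrm x.
Proof.
move=> t0 u0 dx dAx; set a1 := nrm (A x); set a2 := nrm (A (A x)).
have a10 : 0 <= a1 by exact: nrm_ge0. have a20 : 0 <= a2 by exact: nrm_ge0.
apply: (@le_of_invn _ _ _ (t * (B * B * a1 + (t + u + t) * (2 * B ^+ 3 * a2)))) => n.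
set iN : R := n.+1%:R^-1; have iN0 : 0 < iN by rewrite invr_gt0.
pose h := t * iN; have h0 : 0 < h by rewrite mulr_gt0.
have [r er] := euler_step_exists h0.
pose m := Num.truncn (u / h).
have uh0 : 0 <= u / h by rewrite divr_ge0// ltW.
have /andP[mu um] := truncn_itv uh0; rewrite -/m in mu um.
have {}mu : m%:R * h <= u by rewrite -ler_pdivlMr.
have {}um : u - m%:R * h <= h.
  by move: um; rewrite ltr_pdivrMr// -natr1 mulrDl mul1r; lra.
have nh : n.+1%:R * h = t by rewrite /h /iN mulrCA divff ?mulr1// pnatr_eq0.
have nm : (n.+1 + m)%:R * h = t + m%:R * h by rewrite natrD mulrDl nh.
have nm0 : 0 <= (n.+1 + m)%:R * h by rewrite mulr_ge0// ltW.
have E1 : nrm (S (t + u) x - S ((n.+1 + m)%:R * h) x) <= B * B * a1 * h.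
  have d0 : 0 <= u - m%:R * h by rewrite subr_ge0.
  have -> : t + u = (n.+1 + m)%:R * h + (u - m%:R * h) by rewrite nm; ring.
  rewrite SD// -(linear_sub _ _ (linS nm0)); apply: (le_trans (SB _ nm0)).
  rewrite -!mulrA ler_wpM2l//; apply: (le_trans (orbit_lipschitz d0 dx)).
  rewrite -/a1 (_ : _ * B * a1 = B * (a1 * (u - m%:R * h))); last by ring.
  by rewrite ler_wpM2l// ler_wpM2l.
have E2 := euler_converges h0 er (n.+1 + m) dx dAx.
have E3 := euler_converges h0 er n.+1 dx dAx.
rewrite -/a2 in E2 E3; rewrite nh in E3.
have E4 := euler_increment h0 er n m x.
have {}E4 : nrm (iter (n.+1 + m) r x - iter n.+1 r x) <= ritt_const * (u / t) * nrm x.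
  apply: (le_trans E4); rewrite ler_wpM2r ?nrm_ge0// ler_wpM2l ?ritt_const_ge0//.
  rewrite ler_pdivlMr// (_ : _ / _ * t = m%:R * h)//.
  by rewrite /h /iN; ring.
have c0 : 0 <= 2 * B ^+ 3 * h * a2.
  by rewrite mulr_ge0// mulr_ge0 ?(ltW h0)// mulr_ge0// exprn_ge0.
have {}E2 : nrm (iter (n.+1 + m) r x - S ((n.+1 + m)%:R * h) x) <= (t + u) * (2 * B ^+ 3 * h * a2).
  apply: (le_trans E2).
  have -> : (n.+1 + m)%:R * (2 * B ^+ 3 * h ^+ 2 * a2) = ((n.+1 + m)%:R * h) * (2 * B ^+ 3 * h * a2) by ring.
  by rewrite ler_wpM2r// nm lerD2l.
have {}E3 : nrm (iter n.+1 r x - S t x) <= t * (2 * B ^+ 3 * h * a2).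
  apply: (le_trans E3); rewrite le_eqVlt; apply/orP; left; apply/eqP.
  by rewrite -[in RHS]nh; ring.
have T1 := nrmBD (S (t + u) x) (S ((n.+1 + m)%:R * h) x) (S t x).
have T2 := nrmBD (S ((n.+1 + m)%:R * h) x) (iter (n.+1 + m) r x) (S t x).
have T3 := nrmBD (iter (n.+1 + m) r x) (iter n.+1 r x) (S t x).
rewrite (nrmC (S ((n.+1 + m)%:R * h) x) (iter (n.+1 + m) r x)) in T2.
have -> : t * (B * B * a1 + (t + u + t) * (2 * B ^+ 3 * a2)) * iN =
  B * B * a1 * h + (t + u) * (2 * B ^+ 3 * h * a2) + t * (2 * B ^+ 3 * h * a2).
  by rewrite /h; ring.
move: T1 T2 T3 E1 E2 E3 E4; lra.
Qed.

(** Implicit Euler steps map the domain into the domain of the square, and tend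
    to the identity. *)
Lemma dense_dom2 x (e : R) : 0 < e ->
  exists y, [/\ dA y, dA (A y) & nrm (x - y) < e].
Proof.
move=> e0; have e2 : 0 < e / 2 by rewrite divr_gt0.
have [y [dy xy]] : exists y, dA y /\ nrm (x - y) < e / 2.
  have : closure dA x by rewrite dense.
  move=> /(_ [set y | nrm (x - y) < e / 2]) [|y [dy xy]]; last by exists y.
  by have /cvg_nrmP := @cvg_id _ (nbhs x); apply.
have ay0 : 0 < B * nrm (A y) + 1 by rewrite ltr_wpDl// mulr_ge0// nrm_ge0.
pose h := e / 2 / (B * nrm (A y) + 1).
have h0 : 0 < h by rewrite divr_gt0.
have [r er] := euler_step_exists h0.
have [dr rE] := er.1 y.
exists (r y); split=> //.
  have -> : A (r y) = (h^-1)%:C *: (r y - y).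
    rewrite -[in X in _ *: (_ - X)]rE opprB addrC subrK scalerA -rmorphM/=.
    by rewrite mulVf ?gt_eqF// scale1r.
  have [d1 _] := linear_onB dr dy; exact: (linear_onZ _ d1).1.
have ry : nrm (y - r y) <= e / 2.
  rewrite (euler_dom er dy) opprD addrA subrr sub0r nrmN nrmZp ?(ltW h0)//.
  apply: (@le_trans _ _ (h * (B * nrm (A y)))).
    by rewrite ler_pM2l//; have := euler_pow h0 er 1 (A y).
  rewrite /h mulrAC ler_pdivrMr// ler_pM2l//; lra.
have := nrmBD x y (r y); move: xy ry; lra.
Qed.

(** This is the only trace of analyticity that the error analysis needs; it
    replaces the bound |t A S(t)| <= C, of which it is the integrated form, and
    makes sense without knowing that S(t) maps into the domain of A. *)
Theorem analytic_bound (t u : R) x : 0 < t -> 0 <= u ->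
  nrm (S (t + u) x - S t x) <= ritt_const * (u / t) * nrm x.
Proof.
move=> t0 u0; set c := ritt_const * (u / t).
have c0 : 0 <= c by rewrite mulr_ge0 ?ritt_const_ge0// divr_ge0// ltW.
apply: le_of_eps => e e0.
have cB : 0 < c + 2 * B + 1 by rewrite ltr_wpDl// addr_ge0// mulr_ge0.
have [y [dy dAy xy]] := dense_dom2 x (divr_gt0 e0 cB).
have := analytic_dom2 t0 u0 dy dAy; rewrite -/c => H.
have tu0 : 0 <= t + u by rewrite addr_ge0// ltW.
have H1 := SB (x - y) tu0; have H2 := SB (x - y) (ltW t0).
rewrite (linear_sub _ _ (linS tu0)) in H1; rewrite (linear_sub _ _ (linS (ltW t0))) in H2.
have T1 := nrmBD (S (t + u) x) (S (t + u) y) (S t x).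
have T2 := nrmBD (S (t + u) y) (S t y) (S t x).
rewrite (nrmC (S t y) (S t x)) in T2.
have yx : nrm y <= nrm x + nrm (x - y).
  by rewrite addrC nrmC; have := nrmD (y - x) x; rewrite subrK.
set d := nrm (x - y) in xy H1 H2 yx.
have d0 : 0 <= d by exact: nrm_ge0.
have de : d * (c + 2 * B + 1) <= e by rewrite -ler_pdivlMr// ltW.
have cy : c * nrm y <= c * nrm x + c * d by rewrite -mulrDr ler_wpM2l.
move: T1 T2 H H1 H2 de cy; lra.
Qed.

End BoundedSemigroup.

(** * Semigroups of sectorial operators *)
Lemma zmod_regroup (V : zmodType) (p e k l x m : V) :
  p - x - (l - m) = p - e - k - (l - k) + (e - x + m).
Proof.
have -> : p - e - k - (l - k) = p - e - l by rewrite opprB addrA subrK.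
rewrite [p - e - l]addrAC -[e - x + m]addrA [RHS]addrA subrK [RHS]addrA.
by rewrite opprB addrA [p - l - x]addrAC [RHS]addrAC.
Qed.

Section SectorialSemigroup.
Variables (R : realType) (X : completeNormedModType R[i]).

Lemma near_right0 (P : R -> Prop) : (\forall t \near (0 : R)^'+, P t) ->
  exists2 d : R, 0 < d & forall h : R, 0 < h -> h < d -> P h.
Proof.
move=> /nbhs_ballP[d /= d0 dP]; exists d => // h h0 hd; apply: dP => //.
by rewrite -ball_normE/= sub0r normrN gtr0_norm.
Qed.

(** Sectors are given in polar coordinates; the right half-plane lies in every
    sector of half-angle larger than pi / 2. *)
Lemma polar_form (z : R[i]) : 0 < complex.Re z ->
  exists w : R, `|w| <= pi / 2 /\ z = (cabs z)%:C * (cos w +i* sin w).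
Proof.
case: z => x y /= x0; set z := x +i* y; set r := cabs z.
have r2 : r ^+ 2 = x ^+ 2 + y ^+ 2 by rewrite /r cabs_sqr.
have r0 : 0 < r.
  by rewrite /r cabs_gt0 eq_complex/= negb_and gt_eqF.
have yr : -1 <= y / r <= 1.
  have y2 : y ^+ 2 <= r ^+ 2 by rewrite r2 lerDr sqr_ge0.
  have : `|y| <= r by rewrite -(ger0_norm (ltW r0)) -ler_sqr ?nnegrE// !real_normK ?num_real.
  by rewrite ler_norml ler_pdivlMr// ler_pdivrMr// mulN1r mul1r.
exists (asin (y / r)); split.
  have := asin_geNpi2 yr; have := asin_lepi2 yr.
  by rewrite ler_norml => -> ->.
rewrite asinK ?in_itv//= cos_asin//.
have -> : Num.sqrt (1 - (y / r) ^+ 2) = x / r.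
  have -> : 1 - (y / r) ^+ 2 = (x / r) ^+ 2.
    have -> : (x / r) ^+ 2 = x ^+ 2 / r ^+ 2 by rewrite expr_div_n.
    have -> : x ^+ 2 = r ^+ 2 - y ^+ 2 by rewrite r2 addrK.
    by field; rewrite gt_eqF.
  by rewrite sqrtr_sqr ger0_norm// divr_ge0// ltW.
have rx u : r * (u / r) = u by rewrite mulrCA divff ?mulr1// gt_eqF.
by apply/eqP; rewrite eq_complex/= !mul0r subr0 addr0 !rx !eqxx.
Qed.

Lemma expRN_bounds (s : R) : 0 <= s ->
  0 <= 1 - expR (- s) /\ 1 - expR (- s) <= s /\ `|expR (- s) - 1 + s| <= s ^+ 2.
Proof.
move=> s0; have h1 : 1 - s <= expR (- s) by have := expR_ge1Dx (- s).
have h2 : expR (- s) <= (1 + s)^-1.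
  rewrite expRN lef_pV2 ?posrE ?expR_gt0 ?ltr_pwDl//; exact: expR_ge1Dx.
have s1 : 0 < 1 + s by rewrite ltr_pwDl.
have h3 : (1 + s)^-1 <= 1 - s + s ^+ 2.
  rewrite -div1r ler_pdivrMr//.
  have : 0 <= s ^+ 3 by rewrite exprn_ge0.
  rewrite !exprS expr0; nra.
have h4 : expR (- s) <= 1.
  by rewrite (le_trans h2)// invf_le1// lerDl.
by split; [|split]; rewrite ?ler_norml; lra.
Qed.

Variables (dA : set X) (A : X -> X) (S : R -> X -> X).
Hypothesis lA : linear_on dA A.
Hypothesis hA : sectorial dA A.
Hypothesis hS : is_semigroup_of dA A S.

Lemma semigroup_bounded_linear (t : R) : 0 <= t -> exists K, bounded_linear (S t) K.
Proof.
move=> t0; have [H _ _ _ _] := hS; have [[_ lS] [K KP]] := H t t0.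
by exists K; split=> // k x y; have [] := lS k x y.
Qed.

Lemma semigroup_linear (t : R) : 0 <= t -> linear (S t).
Proof. by move=> /semigroup_bounded_linear[K []]. Qed.

Lemma semigroup0 x : S 0 x = x. Proof. by have [] := hS. Qed.

Lemma semigroupD (t u : R) x : 0 <= t -> 0 <= u -> S (t + u) x = S t (S u x).
Proof. by have [_ _ H _ _] := hS; exact: H. Qed.

Lemma semigroup_right_cont x (e : R) : 0 < e ->
  exists2 d : R, 0 < d & forall h : R, 0 <= h -> h < d -> nrm (S h x - x) < e.
Proof.
move=> e0; have [_ _ _ H _] := hS.
have [d d0 dP] := near_right0 ((cvg_nrmP _ _).1 (H x) e e0).
exists d => // h; rewrite le_eqVlt => /orP[/eqP <-|h0] hd.
  by rewrite semigroup0 subrr nrm0.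
by rewrite nrmC dP.
Qed.

Lemma semigroup_gen x : dA x -> forall e : R, 0 < e -> exists2 d : R, 0 < d &
  forall h : R, 0 < h -> h < d -> nrm (S h x - x - h%:C *: A x) <= e * h.
Proof.
move=> dx e e0; have [_ _ _ _ G] := hS.
have [d d0 dP] := near_right0 ((cvg_nrmP _ _).1 ((G x (A x)).1 (conj dx erefl)) e e0).
exists d => // h h0 hd.
have -> : S h x - x - h%:C *: A x = - (h%:C *: (A x - (h^-1)%:C *: (S h x - x))).
  by rewrite scalerBr scalerA -rmorphM/= divff ?gt_eqF// scale1r opprB.
by rewrite nrmN nrmZp ?(ltW h0)// mulrC ler_pM2r// ltW// dP.
Qed.

Lemma semigroup_inv (t : R) x : 0 <= t -> dA x -> dA (S t x) /\ A (S t x) = S t (A x).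
Proof.
move=> t0 dx; have [_ _ _ _ G] := hS; apply/G.
have [K [lS KP]] := semigroup_bounded_linear t0.
have K1 : 0 < `|K| + 1 by rewrite ltr_wpDl.
apply/cvg_nrmP => e e0.
have H : \forall h \near (0 : R)^'+,
    nrm (A x - (h^-1)%:C *: (S h x - x)) < e / (`|K| + 1).
  exact: (cvg_nrmP _ _).1 ((G x (A x)).1 (conj dx erefl)) _ (divr_gt0 e0 K1).
near=> h.
have h0 : 0 < h by near: h; exact: nbhs_right_gt.
rewrite -semigroupD ?(ltW h0)// [h + t]addrC semigroupD ?(ltW h0)//.
rewrite -(linear_sub _ _ lS) -(linear_scale _ _ lS) -(linear_sub _ _ lS).
apply: (le_lt_trans (KP _)); apply: (@le_lt_trans _ _ ((`|K| + 1) * nrm (A x - (h^-1)%:C *: (S h x - x)))).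
  by rewrite ler_wpM2r ?nrm_ge0// (le_trans (ler_norm K))// lerDl.
by rewrite mulrC -ltr_pdivlMr//; near: h.
Unshelve. all: by end_near. Qed.

(** Otherwise there are times tending to 0 at which the operator norms are
    unbounded, although every orbit converges there: this contradicts the
    uniform boundedness principle. *)
Lemma semigroup_locally_bounded : exists (d K : R), [/\ 0 < d, 1 <= K &
  forall (t : R) x, 0 <= t -> t <= d -> nrm (S t x) <= K * nrm x].
Proof.
apply: contrapT => nb.
have bad (n : nat) : exists p : R * X, [/\ 0 <= p.1, p.1 <= n.+1%:R^-1 &
    n.+1%:R * nrm p.2 < nrm (S p.1 p.2)].
  apply: contrapT => nbad; apply: nb; exists n.+1%:R^-1, n.+1%:R; split.
  - by rewrite invr_gt0.
  - by rewrite ler1n.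
  move=> t x t0 tn; rewrite leNgt; apply/negP => lt; apply: nbad.
  by exists (t, x).
have [p pP] := choice bad.
have bl n : exists K, bounded_linear (S (p n).1) K.
  by apply: semigroup_bounded_linear; have [] := pP n.
have pb x : exists M, forall n, nrm (S (p n).1 x) <= M.
  have [d d0 dP] := semigroup_right_cont x (@ltr01 R).
  have [N NP] := small_invn d0.
  exists (\sum_(k < N) nrm (S (p k).1 x) + (nrm x + 1)) => n.
  have x0 := nrm_ge0 x.
  case: (ltnP n N) => nN.
    rewrite (bigD1 (Ordinal nN))//= -addrA lerDl addr_ge0 ?addr_ge0//.
    by apply: sumr_ge0 => i _; exact: nrm_ge0.
  have [t0 tn _] := pP n.
  have := dP _ t0 (le_lt_trans tn (NP _ nN)).
  have := nrmD (S (p n).1 x - x) x; rewrite subrK.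
  have : 0 <= \sum_(k < N) nrm (S (p k).1 x) by apply: sumr_ge0 => i _; exact: nrm_ge0.
  lra.
have [K K0 KP] := banach_steinhaus bl pb.
have := truncnS_gt K; set n := Num.truncn K => nK.
have [_ _] := pP n; have := KP n (p n).2.
have := nrm_ge0 (p n).2; move: nK; set q := n.+1%:R => nK a b c.
have : K * nrm (p n).2 <= q * nrm (p n).2 by rewrite ler_wpM2r// ltW.
move: b c; lra.
Qed.

(** A time t is k steps of length d and a shorter one, where k <= t / d, and
    K^k <= exp (K k). *)
Lemma semigroup_exp_bound : exists (K w : R), [/\ 0 <= K, 0 <= w &
  forall (t : R) x, 0 <= t -> nrm (S t x) <= K * expR (w * t) * nrm x].
Proof.
have [d [K [d0 K1 KP]]] := semigroup_locally_bounded.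
have K0 : 0 <= K by rewrite (le_trans _ K1).
exists K, (K / d); split => //; first by rewrite divr_ge0// ltW.
have pw (k : nat) (s : R) x : 0 <= s -> s <= d -> nrm (S (k%:R * d + s) x) <= K ^+ k.+1 * nrm x.
  move=> s0 sd; elim: k => [|k IH]; first by rewrite mul0r add0r expr1 KP.
  have -> : k.+1%:R * d + s = d + (k%:R * d + s) by rewrite -natr1; ring.
  rewrite semigroupD ?(ltW d0)//; last by rewrite addr_ge0// mulr_ge0// ltW.
  apply: (le_trans (KP _ _ (ltW d0) (lexx _))).
  by rewrite exprS -mulrA ler_wpM2l.
move=> t x t0; pose k := Num.truncn (t / d).
have td0 : 0 <= t / d by rewrite divr_ge0// ltW.
have /andP[kt tk] := truncn_itv td0; rewrite -/k in kt tk.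
have {}kt' : k%:R * d <= t by rewrite -ler_pdivlMr.
have tk' : t - k%:R * d <= d by move: tk; rewrite ltr_pdivrMr// -natr1 mulrDl mul1r; lra.
have := pw k (t - k%:R * d) x; rewrite subr_ge0 [_ * d + _]addrC subrK => /(_ kt' tk') => H.
apply: (le_trans H); rewrite ler_wpM2r ?nrm_ge0// exprS ler_wpM2l//.
apply: (@le_trans _ _ (expR K ^+ k)).
  rewrite lerXn2r ?nnegrE ?expR_ge0//; apply: le_trans (expR_ge1Dx K).
  by rewrite lerDr.
rewrite -expRM_natl ler_expR mulrC -[leRHS]mulrA ler_wpM2l//.
by rewrite mulrC.
Qed.

(** Rescaling: for w larger than the growth bound and than the vertex of the
    sector, exp (- w t) S(t) is bounded and is generated by A - w, whose
    resolvent is bounded by M / |z| in the right half-plane.  On [0, T] the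
    factor exp (w t) is bounded and varies by O(u) <= O(u / t). *)
Theorem sectorial_semigroup_estimates (T : R) : 0 < T ->
  exists K L : R, [/\ 0 <= K, 0 <= L,
    forall (t : R) x, 0 <= t -> t <= T -> nrm (S t x) <= K * nrm x &
    forall (t u : R) x, 0 < t -> 0 <= u -> t + u <= T ->
      nrm (S (t + u) x - S t x) <= L * (u / t) * nrm x].
Proof.
move=> T0; have [B [w0 [B0 w00 SB0]]] := semigroup_exp_bound.
have [hd _ [M [a [theta [M1 th _ res]]]]] := hA.
pose w := w0 + `|a|.
have ww0 : w0 <= w by rewrite /w lerDl.
have aw : a <= w by rewrite /w (le_trans (ler_norm a))// lerDr.
have w_ge0 : 0 <= w by rewrite (le_trans w00).
clearbody w.
pose S1 t x := (expR (- (w * t)))%:C *: S t x.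
pose A1 x := A x - w%:C *: x.
have M0 : 0 <= M by rewrite (le_trans _ M1).
have lA1 : linear_on dA A1.
  split; first exact: lA.1.
  move=> k u v du dv; have [d1 e1] := lA.2 k u v du dv; split=> //.
  by rewrite /A1 e1 !scalerDr scalerN !scalerA opprD addrACA [k * _]mulrC.
have linS1 (t : R) : 0 <= t -> linear (S1 t).
  by move=> t0 k u v; rewrite /S1 (semigroup_linear t0) scalerDr !scalerA [k * _]mulrC.
have S10 x : S1 0 x = x by rewrite /S1 mulr0 oppr0 expR0 scale1r semigroup0.
have S1D (t u : R) x : 0 <= t -> 0 <= u -> S1 (t + u) x = S1 t (S1 u x).
  move=> t0 u0; rewrite /S1 semigroupD// (linear_scale _ _ (semigroup_linear t0)) scalerA.
  by rewrite -rmorphM/= -expRD; congr ((expR _)%:C *: _); ring.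
have S1B (t : R) x : 0 <= t -> nrm (S1 t x) <= B * nrm x.
  move=> t0; rewrite /S1 nrmZp ?expR_ge0//.
  apply: (@le_trans _ _ (expR (- (w * t)) * (B * expR (w0 * t) * nrm x))).
    by rewrite ler_wpM2l ?expR_ge0// SB0.
  have -> : expR (- (w * t)) * (B * expR (w0 * t) * nrm x) = (expR (- (w * t)) * expR (w0 * t)) * (B * nrm x) by ring.
  rewrite -expRD -[leRHS]mul1r ler_wpM2r ?mulr_ge0 ?nrm_ge0// -expR0 ler_expR addrC subr_le0.
  by rewrite ler_wpM2r.
have gen1 x : dA x -> forall e : R, 0 < e -> exists2 d : R, 0 < d &
    forall h : R, 0 < h -> h < d -> nrm (S1 h x - x - h%:C *: A1 x) <= e * h.
  move=> dx e e0; have e2 : 0 < e / 2 by rewrite divr_gt0.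
  have [d d0 dP] := semigroup_gen dx e2.
  pose c := w * nrm (A x) + w ^+ 2 * nrm x.
  have c0 : 0 <= c by rewrite /c addr_ge0// mulr_ge0 ?nrm_ge0// exprn_ge0.
  have c1 : 0 < c + 1 by rewrite ltr_wpDl.
  exists (Num.min d (e / 2 / (c + 1))); first by rewrite lt_min d0 divr_gt0.
  move=> h h0; rewrite lt_min => /andP[hd' hc].
  have wh0 : 0 <= w * h by rewrite mulr_ge0// ltW.
  have [b1 [b2 b3]] := expRN_bounds wh0; set E := expR _ in b1 b2 b3.
  have E0 : 0 <= E by exact: expR_ge0.
  have -> : S1 h x - x - h%:C *: A1 x = E%:C *: (S h x - x - h%:C *: A x)
      - ((1 - E) * h)%:C *: A x + (E - 1 + w * h)%:C *: x.
    rewrite /S1 /A1 -/E; move: (S h x) (A x) => p q.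
    rewrite !scalerBr !scalerA -!rmorphM/= mulrBl mul1r rmorphB/= scalerBl.
    rewrite [(E - 1 + _)%:C]rmorphD/= rmorphB/= rmorph1 scalerDl scalerBl scale1r [w * h]mulrC.
    set P := _ *: p; set l := h%:C *: q; set m := (h * w)%:C *: x.
    set k := (E * h)%:C *: q; set e' := E%:C *: x.
    exact: zmod_regroup.
  have := dP _ h0 hd'; set a0 := nrm (_ - _) => a0P.
  have n2 : nrm (E%:C *: (S h x - x - h%:C *: A x)) <= e / 2 * h.
    rewrite nrmZp//; apply: le_trans a0P; rewrite -[leRHS]mul1r ler_wpM2r ?nrm_ge0//; lra.
  have n3 : nrm (((1 - E) * h)%:C *: A x) <= w * h * h * nrm (A x).
    rewrite nrmZp; last by rewrite mulr_ge0// ltW.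
    by rewrite ler_wpM2r ?nrm_ge0// ler_wpM2r// ltW.
  have n4 : nrm ((E - 1 + w * h)%:C *: x) <= (w * h) ^+ 2 * nrm x.
    by rewrite nrmZr ler_wpM2r ?nrm_ge0.
  apply: (le_trans (nrmD _ _)).
  have T1 := nrmB (E%:C *: (S h x - x - h%:C *: A x)) (((1 - E) * h)%:C *: A x).
  have : h * (c + 1) <= e / 2 by rewrite -ler_pdivlMr// ltW.
  move=> hc1; have {}hc1 : h * (c * h) <= e / 2 * h.
    rewrite [leRHS]mulrC ler_pM2l//; apply: le_trans hc1; nra.
  have E3 : h * (c * h) = w * h * h * nrm (A x) + (w * h) ^+ 2 * nrm x by rewrite /c; ring.
  move: T1 n2 n3 n4; rewrite E3 in hc1; lra.
have inv1 (t : R) x : 0 <= t -> dA x -> dA (S1 t x) /\ A1 (S1 t x) = S1 t (A1 x).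
  move=> t0 dx; have [d1 e1] := semigroup_inv t0 dx.
  have [d2 e2] := linear_onZ lA (expR (- (w * t)))%:C d1.
  split=> //; rewrite /A1 /S1 e2 e1 (linear_sub _ _ (semigroup_linear t0)).
  by rewrite (linear_scale _ _ (semigroup_linear t0)) scalerBr !scalerA [w%:C * _]mulrC.
have res1 (z : R[i]) : 0 < complex.Re z ->
    exists Rl, is_resolvent dA A1 z Rl /\ forall x, nrm (Rl x) <= M / cabs z * nrm x.
  move=> z0; pose eta := z + (w - a)%:C.
  have eta0 : 0 < complex.Re eta.
    by move: z0; rewrite /eta; case: (z) => p q /= p0; rewrite ltr_pwDl// subr_ge0.
  have zeta : cabs z <= cabs eta.
    rewrite -ler_sqr ?nnegrE ?cabs_ge0// !cabs_sqr /eta.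
    move: z0; case: (z) => p q /= p0; rewrite addr0 lerD2r ler_sqr ?nnegrE ?(ltW p0)//.
      by rewrite lerDl subr_ge0.
    by rewrite addr_ge0 ?subr_ge0// ltW.
  have cz0 : 0 < cabs z by rewrite cabs_gt0; apply/eqP => zz; move: z0; rewrite zz ltxx.
  have ceta0 := lt_le_trans cz0 zeta.
  have [phi [phi2 etaE]] := polar_form eta0.
  have [Rl [[R1 R2] RM]] := res (cabs eta) phi ceta0 (le_trans phi2 (ltW th)).
  have lamE u : (a%:C + (cabs eta)%:C * (cos phi +i* sin phi)) *: u - A u = z *: u - A1 u.
    have -> : a%:C + (cabs eta)%:C * (cos phi +i* sin phi) = z + w%:C.
      by rewrite -etaE /eta rmorphB/= addrCA [a%:C + _]addrC subrK.
    by rewrite /A1 scalerDl opprB addrA.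
  exists Rl; split.
    by split=> [x|u du]; [have [d e] := R1 x; rewrite -lamE|rewrite -lamE R2].
  move=> x; apply: (le_trans (RM x)); rewrite ler_wpM2r ?nrm_ge0// ler_wpM2l//.
  by rewrite lef_pV2 ?posrE.
have key := analytic_bound lA1 B0 M0 linS1 S10 S1D S1B gen1 inv1 hd res1.
set Rc := ritt_const B M in key.
have Rc0 : 0 <= Rc by exact: ritt_const_ge0.
have SE (t : R) x : S t x = (expR (w * t))%:C *: S1 t x.
  by rewrite /S1 scalerA -rmorphM/= -expRD subrr expR0 scale1r.
exists (B * expR (w * T)), (expR (w * T) * (Rc + w * T * B)); split.
- by rewrite mulr_ge0// expR_ge0.
- by rewrite mulr_ge0 ?expR_ge0// addr_ge0// !mulr_ge0// ltW.
- move=> t x t0 tT; rewrite SE nrmZp ?expR_ge0// mulrAC mulrC.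
  rewrite ler_pM ?nrm_ge0 ?expR_ge0// ?S1B// ler_expR ler_wpM2l//.
move=> t u x t0 u0 tuT.
have -> : S (t + u) x - S t x = (expR (w * (t + u)))%:C *: (S1 (t + u) x - S1 t x)
    + (expR (w * (t + u)) * (1 - expR (- (w * u))))%:C *: S1 t x.
  rewrite mulrBr mulr1 -expRD (_ : w * (t + u) - w * u = w * t); last by ring.
  by rewrite scalerBr rmorphB/= scalerBl -!SE addrA subrK.
have ET : expR (w * (t + u)) <= expR (w * T) by rewrite ler_expR ler_wpM2l.
have wu0 : 0 <= w * u by rewrite mulr_ge0.
have [b1 [b2 _]] := expRN_bounds wu0; have eg := expR_ge0 (w * (t + u)).
have x0 := nrm_ge0 x.
have ut : u <= T * (u / t).
  rewrite mulrA ler_pdivlMr// mulrC ler_wpM2r//.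
  by rewrite (le_trans _ tuT)// lerDl.
have := key t u x t0 u0; set d := nrm (_ - _) => dP.
have d0 : 0 <= d by exact: nrm_ge0.
have h1 : expR (w * (t + u)) * d <= expR (w * T) * (Rc * (u / t) * nrm x) by rewrite ler_pM.
have h2 : expR (w * (t + u)) * (1 - expR (- (w * u))) * nrm (S1 t x) <=
    expR (w * T) * (w * (T * (u / t))) * (B * nrm x).
  rewrite ler_pM ?nrm_ge0 ?mulr_ge0//; last by rewrite S1B// ltW.
  by rewrite ler_pM// (le_trans b2)// ler_wpM2l.
have -> : expR (w * T) * (Rc + w * T * B) * (u / t) * nrm x =
  expR (w * T) * (Rc * (u / t) * nrm x) + expR (w * T) * (w * (T * (u / t))) * (B * nrm x) by ring.
apply: (le_trans (nrmD _ _)); apply: lerD; first by rewrite nrmZp.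
by rewrite nrmZp ?mulr_ge0.
Qed.

End SectorialSemigroup.

(** * Operator phi-functions *)
Section Monomials.
Variables (R : realType) (X : completeNormedModType R[i]).
Implicit Types (s t a b : R) (l : nat).

Definition mono l t : R := t ^+ l / l`!%:R.

Lemma mono_ge0 l t : 0 <= t -> 0 <= mono l t.
Proof. by move=> t0; rewrite divr_ge0 ?exprn_ge0. Qed.

Lemma fact_ge1 l : 1 <= l`!%:R :> R.
Proof. by rewrite ler1n fact_gt0. Qed.

Lemma mono_le l t b : 0 <= t -> t <= b -> mono l t <= b ^+ l.
Proof.
move=> t0 tb; rewrite ler_pdivrMr ?ltr0n ?fact_gt0//.
rewrite -[leLHS]mulr1 ler_pM ?exprn_ge0 ?fact_ge1//.
by rewrite lerXn2r ?nnegrE// (le_trans t0).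
Qed.

Lemma mono_lip l b : 0 <= b -> exists2 C : R, 0 <= C & forall s t,
  0 <= s <= b -> 0 <= t <= b -> `|mono l s - mono l t| <= C * `|s - t|.
Proof.
move=> b0; suff [C C0 CP] : exists2 C : R, 0 <= C & forall s t,
    0 <= s <= b -> 0 <= t <= b -> `|s ^+ l - t ^+ l| <= C * `|s - t|.
  exists C => // s t sb tb; rewrite /mono -mulrBl normrM -[leRHS]mulr1.
  by rewrite ler_pM// ?CP// ger0_norm ?invr_ge0// invf_le1 ?fact_ge1 ?ltr0n ?fact_gt0.
elim: l => [|l [C C0 CP]].
  by exists 0 => // s t _ _; rewrite !expr0 subrr normr0 mul0r.
exists (b * C + b ^+ l); first by rewrite addr_ge0 ?mulr_ge0 ?exprn_ge0.
move=> s t sb tb; have -> : s ^+ l.+1 - t ^+ l.+1 = s * (s ^+ l - t ^+ l) + (s - t) * t ^+ l.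
  by rewrite !exprS; ring.
have /andP[s0 sb'] := sb; have /andP[t0 tb'] := tb.
rewrite (le_trans (ler_normD _ _))// [leRHS]mulrDl lerD// normrM.
  by rewrite -mulrA ler_pM ?CP// ger0_norm.
by rewrite mulrC ler_wpM2r// ger0_norm ?exprn_ge0// lerXn2r ?nnegrE.
Qed.

(** The remainder of the expansion of order one of a power is nonnegative and
    quadratic; the sign lets the induction on the exponent go through without
    absolute values. *)
Lemma mono_quad l b : 0 <= b -> exists2 C : R, 0 <= C & forall s t,
  0 <= s -> s <= t -> t <= b ->
  `|mono l.+1 t - mono l.+1 s - (t - s) * mono l s| <= C * (t - s) ^+ 2.
Proof.
move=> b0; suff [C C0 CP] : exists2 C : R, 0 <= C & forall s t,
    0 <= s -> s <= t -> t <= b ->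
    0 <= t ^+ l.+1 - s ^+ l.+1 - l.+1%:R * (t - s) * s ^+ l <= C * (t - s) ^+ 2.
  exists C => // s t s0 st tb; have /andP[h1 h2] := CP s t s0 st tb.
  have -> : mono l.+1 t - mono l.+1 s - (t - s) * mono l s =
      (t ^+ l.+1 - s ^+ l.+1 - l.+1%:R * (t - s) * s ^+ l) / l.+1`!%:R.
    rewrite /mono factS natrM; field.
    by rewrite nat1r !pnatr_eq0 -lt0n fact_gt0.
  rewrite ger0_norm ?divr_ge0// ler_pdivrMr ?ltr0n ?fact_gt0//.
  apply: (le_trans h2); rewrite -[leLHS]mulr1 ler_wpM2l ?fact_ge1//.
  by rewrite mulr_ge0// sqr_ge0.
elim: l => [|l [C C0 CP]].
  exists 0 => // s t s0 st tb; rewrite !expr1 expr0 mul0r mulr1 mul1r subrr lexx//.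
exists (b * C + l.+1%:R * b ^+ l); first by rewrite addr_ge0 ?mulr_ge0 ?exprn_ge0.
move=> s t s0 st tb; have t0 := le_trans s0 st.
have /andP[h1 h2] := CP s t s0 st tb.
have -> : t ^+ l.+2 - s ^+ l.+2 - l.+2%:R * (t - s) * s ^+ l.+1 =
    t * (t ^+ l.+1 - s ^+ l.+1 - l.+1%:R * (t - s) * s ^+ l)
    + l.+1%:R * s ^+ l * (t - s) ^+ 2.
  by rewrite -(natr1 l.+1) !exprS; ring.
have q0 : 0 <= (t - s) ^+ 2 by rewrite sqr_ge0.
set Z := _ - _ - _ in h1 h2 *.
have A1 : 0 <= t * Z by rewrite mulr_ge0.
have A2 : 0 <= l.+1%:R * s ^+ l by rewrite mulr_ge0 ?exprn_ge0.
apply/andP; split; first by rewrite addr_ge0// mulr_ge0.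
rewrite [leRHS]mulrDl lerD//.
  by rewrite -mulrA ler_pM.
rewrite ler_wpM2r// ler_wpM2l// lerXn2r ?nnegrE//.
exact: le_trans st tb.
Qed.

Lemma unif_cont_mono l a b (G : R -> X) (C : R) : a <= b -> 0 <= C ->
  (forall t, a <= t <= b -> nrm (G t) <= C) ->
  unif_cont a b G -> unif_cont a b (fun t => (mono l (t - a))%:C *: G t).
Proof.
move=> ab C0 GC ucG e e0; have ba0 : 0 <= b - a by rewrite subr_ge0.
have [L L0 LP] := mono_lip l ba0.
pose P := (b - a) ^+ l; have P0 : 0 <= P by rewrite exprn_ge0.
have e2 : 0 < e / 2 by rewrite divr_gt0.
have P1 : 0 < P + 1 by rewrite ltr_wpDl.
have LC : 0 < L * C + 1 by rewrite ltr_wpDl// mulr_ge0.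
have [d d0 dP] := ucG _ (divr_gt0 e2 P1).
exists (Num.min d (e / 2 / (L * C + 1))); first by rewrite lt_min d0 divr_gt0.
move=> s t sab tab; rewrite lt_min => /andP[st1 st2].
have -> : (mono l (s - a))%:C *: G s - (mono l (t - a))%:C *: G t =
  (mono l (s - a))%:C *: (G s - G t) + (mono l (s - a) - mono l (t - a))%:C *: G t.
  by rewrite scalerBr rmorphB/= scalerBl addrA subrK.
apply: (le_lt_trans (nrmD _ _)); rewrite !nrmZr.
have /andP[s1 s2] := sab; have /andP[t1 t2] := tab.
have sa : 0 <= s - a <= b - a by rewrite subr_ge0 s1 lerD2r.
have ta : 0 <= t - a <= b - a by rewrite subr_ge0 t1 lerD2r.
have h1 : `|mono l (s - a)| * nrm (G s - G t) <= P * (e / 2 / (P + 1)).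
  have /andP[sa0 sab'] := sa.
  rewrite ler_pM ?nrm_ge0//; last by rewrite ltW// dP.
  by rewrite ger0_norm ?mono_ge0// mono_le.
have h1' : P * (e / 2 / (P + 1)) < e / 2.
  rewrite mulrA ltr_pdivrMr// mulrC ltr_pM2l// ltrDl//.
have h2 : `|mono l (s - a) - mono l (t - a)| * nrm (G t) <= L * `|s - t| * C.
  rewrite ler_pM ?nrm_ge0 ?GC//.
  by have := LP _ _ sa ta; have -> : s - a - (t - a) = s - t by ring.
have h2' : L * `|s - t| * C <= e / 2.
  rewrite mulrAC; apply: (@le_trans _ _ ((L * C + 1) * `|s - t|)).
    by rewrite ler_wpM2r// lerDl.
  by rewrite mulrC -ler_pdivlMr// ltW.
move: h1 h1' h2 h2'; lra.
Qed.

Lemma unif_cont_cst a b (x : X) : unif_cont a b (fun=> x).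
Proof. by move=> e e0; exists 1 => // s t _ _ _; rewrite subrr nrm0. Qed.

Lemma lint_mono l a b (x : X) : a <= b ->
  lint a b (fun t => (mono l (t - a))%:C *: x) ((mono l.+1 (b - a))%:C *: x).
Proof.
move=> ab; have ba0 : 0 <= b - a by rewrite subr_ge0.
have uc : unif_cont a b (fun t => (mono l (t - a))%:C *: x).
  by apply: (@unif_cont_mono l a b (fun=> x) _ ab (nrm_ge0 x)) => //; exact: unif_cont_cst.
have -> : (mono l.+1 (b - a))%:C *: x =
  (mono l.+1 (b - a))%:C *: x - (mono l.+1 (a - a))%:C *: x.
  by rewrite subrr /mono expr0n/= mul0r scale0r subr0.
apply: (lint_ftc (G := fun t => (mono l.+1 (t - a))%:C *: x) ab uc) => e e0.
have [C C0 CP] := mono_quad l ba0.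
have Cx : 0 < C * nrm x + 1 by rewrite ltr_wpDl// mulr_ge0// nrm_ge0.
exists (e / (C * nrm x + 1)); first by rewrite divr_gt0.
move=> s t as_ st tb std.
rewrite scalerA -rmorphM/= -!scalerBl -!rmorphB/= nrmZr.
have := CP (s - a) (t - a); rewrite subr_ge0 lerD2r => /(_ as_ st).
rewrite lerD2r => /(_ tb); have -> : t - a - (s - a) = t - s by ring.
move=> H; apply: (@le_trans _ _ (C * (t - s) ^+ 2 * nrm x)).
  by rewrite ler_wpM2r// nrm_ge0.
have ts0 : 0 <= t - s by rewrite subr_ge0.
have -> : C * (t - s) ^+ 2 * nrm x = ((t - s) * (C * nrm x)) * (t - s) by ring.
rewrite ler_wpM2r//; move: std; rewrite ltr_pdivlMr// => std; apply: le_trans (ltW std).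
by rewrite ler_wpM2l// lerDl.
Qed.

End Monomials.

Section PhiOperators.
Variables (R : realType) (X : completeNormedModType R[i]).
Variables (S : R -> X -> X) (T K L : R).
Hypothesis K0 : 0 <= K.
Hypothesis L0 : 0 <= L.
Hypothesis linS : forall t : R, 0 <= t -> linear (S t).
Hypothesis SD : forall (t u : R) x, 0 <= t -> 0 <= u -> S (t + u) x = S t (S u x).
Hypothesis contS : forall x (e : R), 0 < e ->
  exists2 d : R, 0 < d & forall h : R, 0 <= h -> h < d -> nrm (S h x - x) < e.
Hypothesis SK : forall (t : R) x, 0 <= t -> t <= T -> nrm (S t x) <= K * nrm x.
Hypothesis SL : forall (t u : R) x, 0 < t -> 0 <= u -> t + u <= T ->
  nrm (S (t + u) x - S t x) <= L * (u / t) * nrm x.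

Lemma bounded_linear_upto (t : R) : 0 <= t -> t <= T -> bounded_linear (S t) K.
Proof. by move=> t0 tT; split; [exact: linS|move=> x; exact: SK]. Qed.

Lemma unif_cont_orbit (a b : R) x : 0 <= b - a -> b - a <= T ->
  unif_cont a b (fun t => S (b - t) x).
Proof.
move=> ba0 baT e e0; have K1 : 0 < K + 1 by rewrite ltr_wpDl.
have [d d0 dP] := contS x (divr_gt0 e0 K1); exists d => // s t.
wlog st : s t / s <= t.
  move=> W sab tab std; case/orP: (le_total s t) => st; first exact: W.
  by rewrite nrmC; apply: W => //; rewrite distrC.
move=> /andP[s1 s2] /andP[t1 t2]; rewrite ler0_norm ?subr_le0// opprB => std.
have bt0 : 0 <= b - t by rewrite subr_ge0.
have btT : b - t <= T by rewrite (le_trans _ baT)// lerD2l lerN2.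
have ts0 : 0 <= t - s by rewrite subr_ge0.
have -> : b - s = (b - t) + (t - s) by ring.
rewrite SD// -(linear_sub _ _ (linS bt0)).
apply: (le_lt_trans (SK _ bt0 btT)).
apply: (@le_lt_trans _ _ ((K + 1) * nrm (S (t - s) x - x))).
  by rewrite ler_wpM2r ?nrm_ge0// lerDl.
by rewrite mulrC -ltr_pdivlMr// dP.
Qed.

Lemma unif_cont_phi l (a b : R) x : 0 <= b - a -> b - a <= T ->
  unif_cont a b (fun t => (mono l (t - a))%:C *: S (b - t) x).
Proof.
move=> ba0 baT; have ab : a <= b by rewrite -subr_ge0.
have Kx : 0 <= K * nrm x by rewrite mulr_ge0 ?nrm_ge0.
apply: (@unif_cont_mono _ _ l a b (fun t => S (b - t) x) _ ab Kx); last exact: unif_cont_orbit.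
move=> t /andP[at_ tb]; apply: SK; first by rewrite subr_ge0.
by rewrite (le_trans _ baT)// lerD2l lerN2.
Qed.

Lemma phi_opE l (tau : R) x : phi_op S l.+1 tau x =
  (tau ^- l.+1)%:C *: bochner 0 tau (fun t => (mono l (t - 0))%:C *: S (tau - t) x).
Proof.
by rewrite /=; congr (_ *: bochner _ _ _); apply/funext => t; rewrite subr0.
Qed.

(** The integral of t^l / l! S(b - t) x over an arbitrary interval, whereas the
    operators are defined by integrals over [0, tau]: this is what the local
    error over a grid interval needs. *)
Lemma phi_int l (a b : R) x : 0 < b - a -> b - a <= T ->
  lint a b (fun t => (mono l (t - a))%:C *: S (b - t) x)
    (((b - a) ^+ l.+1)%:C *: phi_op S l.+1 (b - a) x).
Proof.
move=> ba0 baT; have ab : a <= b by rewrite -subr_ge0 ltW.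
have uc := unif_cont_phi l x (ltW ba0) baT.
have [v vP] := unif_cont_lint ab uc.
have sh := lint_shift ab uc vP.
have uc0 : unif_cont 0 (b - a) (fun t => (mono l (t - 0))%:C *: S (b - a - t) x).
  by apply: unif_cont_phi; rewrite subr0// ltW.
have := bochner_lint (ltW ba0) uc0.
set F := (fun t => _ *: S (b - a - t) x) => bF.
have vE : v = bochner 0 (b - a) F.
  apply: (lint_unique (ltW ba0)) _ bF; apply: lint_eq sh => t _.
  by rewrite /F subr0 [a + t]addrC addrK opprD addrA addrAC.
rewrite phi_opE -/F -vE scalerA -rmorphM/= mulfV ?scale1r//.
by rewrite gt_eqF// exprn_gt0.
Qed.

Lemma phi_unique l (tau : R) x v : 0 < tau -> tau <= T ->
  lint 0 tau (fun t => (mono l t)%:C *: S (tau - t) x) v ->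
  v = (tau ^+ l.+1)%:C *: phi_op S l.+1 tau x.
Proof.
move=> t0 tT vP; have := @phi_int l 0 tau x; rewrite subr0 => /(_ t0 tT) H.
apply: (lint_unique (ltW t0)) vP _; apply: lint_eq H => t _.
by rewrite subr0.
Qed.

Lemma phi_int0 l (tau : R) x : 0 < tau -> tau <= T ->
  lint 0 tau (fun t => (mono l t)%:C *: S (tau - t) x)
    ((tau ^+ l.+1)%:C *: phi_op S l.+1 tau x).
Proof.
move=> t0 tT; have := @phi_int l 0 tau x; rewrite subr0 => /(_ t0 tT).
by apply: lint_eq => t _; rewrite subr0.
Qed.

Lemma phi_linear l (tau : R) : 0 < tau -> tau <= T -> linear (phi_op S l.+1 tau).
Proof.
move=> t0 tT k x y.
have H := lint_lincomb k (phi_int0 l x t0 tT) (phi_int0 l y t0 tT).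
have tn0 : (tau ^+ l.+1)%:C != 0 :> R[i].
  by rewrite -cabs_gt0 cabs_pos ?exprn_gt0// exprn_ge0// ltW.
apply: (scalerI tn0).
transitivity (k *: ((tau ^+ l.+1)%:C *: phi_op S l.+1 tau x)
    + (tau ^+ l.+1)%:C *: phi_op S l.+1 tau y).
  apply/esym; apply: (phi_unique t0 tT); apply: lint_eq H => t /andP[t1 t2].
  have tt : 0 <= tau - t by rewrite subr_ge0.
  by rewrite (linS tt) scalerDr !scalerA mulrC.
move: (phi_op S l.+1 tau x) (phi_op S l.+1 tau y) => p q.
by rewrite scalerDr !scalerA mulrC.
Qed.

Lemma phi_bound l (tau : R) x : 0 < tau -> tau <= T ->
  nrm (phi_op S l.+1 tau x) <= K * nrm x.
Proof.
move=> t0 tT.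
have tn0 : 0 < tau ^+ l.+1 by rewrite exprn_gt0.
rewrite -(ler_pM2l tn0) -[leLHS]nrmZp ?(ltW tn0)//.
have c0 : 0 <= tau ^+ l * (K * nrm x) by rewrite mulr_ge0 ?mulr_ge0 ?nrm_ge0// exprn_ge0// ltW.
have -> : tau ^+ l.+1 * (K * nrm x) = tau ^+ l * (K * nrm x) * (tau - 0).
  by rewrite subr0 exprS; ring.
apply: (lint_nrm_cst (ltW t0) c0 (phi_int0 l x t0 tT)) => t /andP[t1 t2].
rewrite nrmZp ?mono_ge0// ler_pM ?mono_ge0 ?nrm_ge0 ?mono_le//.
by apply: SK; rewrite ?subr_ge0// (le_trans _ tT)// gerBl.
Qed.

(** Parabolic smoothing: 1 / (l + 1)! is the value at 0 of the function
    phi_(l+1), and the difference is the integral of S(tau - t) x - x over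
    [0, tau] with weight t^l / (l! tau^(l+1)).  After applying S t, the increments of the orbit are
    measured at times at least t. *)
Lemma phi_smooth l (tau t : R) x : 0 < tau -> 0 < t -> t + tau <= T ->
  nrm (S t (phi_op S l.+1 tau x - (l.+1`!%:R^-1)%:C *: x)) <= L * (tau / t) * nrm x.
Proof.
move=> tau0 t0 tT.
have tauT : tau <= T by rewrite (le_trans _ tT)// lerDr ltW.
have tT' : t <= T by rewrite (le_trans _ tT)// lerDl ltW.
have tn0 : 0 < tau ^+ l.+1 by rewrite exprn_gt0.
have I1 := phi_int0 l x tau0 tauT.
have I2 := lint_mono l x (ltW tau0).
have I3 := lint_map K0 (bounded_linear_upto (ltW t0) tT') (lintB I1 I2).
set v := S t _ in I3.
have vE : v = (tau ^+ l.+1)%:C *: S t (phi_op S l.+1 tau x - (l.+1`!%:R^-1)%:C *: x).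
  rewrite -(linear_scale _ _ (linS (ltW t0))) /v; congr S.
  move: (phi_op S l.+1 tau x) => p.
  by rewrite scalerBr scalerA -rmorphM/= /mono subr0.
rewrite -(ler_pM2l tn0) -[leLHS]nrmZp ?(ltW tn0)// -vE.
have c0 : 0 <= tau ^+ l * (L * (tau / t) * nrm x).
  by rewrite mulr_ge0 ?exprn_ge0 ?(ltW tau0)// mulr_ge0 ?nrm_ge0// mulr_ge0// divr_ge0// ltW.
have -> : tau ^+ l.+1 * (L * (tau / t) * nrm x) = tau ^+ l * (L * (tau / t) * nrm x) * (tau - 0).
  by rewrite subr0 exprS; ring.
apply: (lint_nrm_cst (ltW tau0) c0 I3) => u /andP[u1 u2].
rewrite subr0 -scalerBr (linear_scale _ _ (linS (ltW t0))) nrmZp ?mono_ge0//.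
have tu0 : 0 <= tau - u by rewrite subr_ge0.
rewrite ler_pM ?mono_ge0 ?nrm_ge0 ?mono_le//.
rewrite (linear_sub _ _ (linS (ltW t0))) -SD ?(ltW t0)//.
apply: (le_trans (SL _ t0 tu0 _)).
  by rewrite (le_trans _ tT)// lerD2l gerBl.
rewrite ler_wpM2r ?nrm_ge0// ler_wpM2l// ler_pM2r ?invr_gt0//.
by rewrite gerBl.
Qed.

End PhiOperators.

(** * Linear independence of the scalar phi-functions *)
Section PhiFunctions.
Variable R : realType.
Implicit Types (z : R[i]).

Definition exp_poly (l : nat) : {poly R[i]} := \poly_(m < l) (m`!%:R)^-1.

Lemma exp_polyE l z : (exp_poly l).[z] = \sum_(m < l) (m`!%:R)^-1 * z ^+ m.
Proof. by rewrite horner_poly. Qed.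

Lemma phi0 l : phi l (0 : R[i]) = (l`!%:R)^-1.
Proof. by case: l => [|l] /=; rewrite eqxx. Qed.

Lemma phi_expand l z : z != 0 -> z ^+ l * phi l z = cexp z - (exp_poly l).[z].
Proof.
move=> z0; elim: l => [|l IH].
  by rewrite exp_polyE big_ord0 subr0 expr0 mul1r /= (negbTE z0).
rewrite exp_polyE big_ord_recr/= -exp_polyE (negbTE z0) exprSr.
rewrite -mulrA [z * _]mulrC divfK// mulrBr IH opprD addrA.
by rewrite [_ ^+ l * _ in LHS]mulrC.
Qed.

Lemma poly_infinite_roots (p : {poly R[i]}) (f : nat -> R[i]) :
  injective f -> (forall n, p.[f n] = 0) -> p = 0.
Proof.
move=> fi fr; apply/eqP; apply: contraT => p0.
have := @max_poly_roots _ p (map f (iota 0 (size p))) p0.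
rewrite size_map size_iota ltnn; apply.
  by apply/allP => _ /mapP[n _ ->]; rewrite rootE fr.
by rewrite map_inj_uniq// iota_uniq.
Qed.

Lemma cos_sin_period (n : nat) (x : R) :
  cos (x + n%:R * (pi * 2)) = cos x /\ sin (x + n%:R * (pi * 2)) = sin x.
Proof.
elim: n => [|n [c s]]; first by rewrite mul0r addr0.
have -> : x + n.+1%:R * (pi * 2) = x + n%:R * (pi * 2) + pi + pi.
  by rewrite -natr1; ring.
by rewrite !cosDpi !sinDpi !opprK.
Qed.

Lemma cexp_period (n : nat) (x : R) :
  cexp (0 +i* (x + n%:R * (pi * 2))) = cos x +i* sin x :> R[i].
Proof.
have [c s] := cos_sin_period n x.
by rewrite /cexp /= expR0 c s rmorph1 mul1r.
Qed.

Lemma imag_inj (x : R) : injective (fun n : nat => 0 +i* (x + n.+1%:R * (pi * 2)) : R[i]).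
Proof.
move=> n m /= [] /addrI /mulIf; rewrite mulf_eq0 gt_eqF ?pi_gt0//=.
rewrite pnatr_eq0/= => /(_ isT) /eqP.
by rewrite eqr_nat eqSS => /eqP.
Qed.

(** The exponential function is not rational: on the infinitely many points
    2 pi i k the identity reads P = Q, on the points pi i + 2 pi i k it reads
    - P = Q. *)
Lemma exp_transcendental (P Q : {poly R[i]}) :
  (forall z, z != 0 -> cexp z * P.[z] = Q.[z]) -> P = 0.
Proof.
move=> PQ.
have z0 (x : R) n : 0 <= x -> (0 +i* (x + n.+1%:R * (pi * 2)) : R[i]) != 0.
  move=> x0; rewrite eq_complex/= negb_and; apply/orP; right.
  by rewrite gt_eqF// ltr_wpDl// !mulr_gt0// pi_gt0.
have H1 : P - Q = 0.
  apply: (@poly_infinite_roots (P - Q) _ (@imag_inj 0)) => n.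
  have := PQ _ (z0 0 n (lexx _)); rewrite cexp_period cos0 sin0.
  by rewrite (_ : 1 +i* 0 = 1)// mul1r hornerD hornerN => ->; rewrite subrr.
have H2 : P + Q = 0.
  apply: (@poly_infinite_roots (P + Q) _ (@imag_inj pi)) => n.
  have := PQ _ (z0 pi n (pi_ge0 _)); rewrite cexp_period cospi sinpi.
  rewrite (_ : -1 +i* 0 = -1); last by apply/eqP; rewrite eq_complex/= oppr0 !eqxx.
  by rewrite mulN1r hornerD => <-; rewrite subrr.
have : P + P = 0.
  by rewrite -[RHS](addr0 0) -{1}H1 -H2 addrA [P - Q + P]addrAC addrNK.
move/eqP; rewrite -mulr2n -mulr_natl mulf_eq0 => /orP[|/eqP //].
by rewrite -polyC_natr polyC_eq0 pnatr_eq0.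
Qed.

(** Multiplied by z^s, a vanishing combination of phi_1, ..., phi_s becomes a
    relation exp (z) P(z) = Q(z) in which the coefficients of P are those of the
    combination. *)
Lemma phi_free s (ga : 'I_s -> R[i]) :
  (forall z, \sum_(l < s) ga l * phi l.+1 z = 0) -> forall l, ga l = 0.
Proof.
move=> H.
pose P : {poly R[i]} := \sum_(l < s) ga l *: 'X^(s - l.+1).
pose Q : {poly R[i]} := \sum_(l < s) ga l *: ('X^(s - l.+1) * exp_poly l.+1).
have P0 : P = 0.
  apply: (@exp_transcendental P Q) => z z0.
  rewrite /P /Q !horner_sum mulr_sumr; apply/eqP; rewrite -subr_eq0 -sumrB; apply/eqP.
  transitivity (z ^+ s * \sum_(l < s) ga l * phi l.+1 z); last by rewrite H mulr0.
  rewrite mulr_sumr; apply: eq_bigr => l _.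
  rewrite !hornerZ hornerM !hornerXn.
  have -> : z ^+ s = z ^+ (s - l.+1) * z ^+ l.+1 by rewrite -exprD subnK.
  have := phi_expand l.+1 z0; move: (phi _ _) (exp_poly _).[z] => p q E.
  have -> : z ^+ (s - l.+1) * z ^+ l.+1 * (ga l * p) = z ^+ (s - l.+1) * ga l * (z ^+ l.+1 * p) by ring.
  by rewrite E; ring.
move=> l; have := congr1 (fun p : {poly R[i]} => p`_(s - l.+1)) P0.
rewrite /P coef0 coef_sum (bigD1 l)//= coefZ coefXn eqxx mulr1 big1 ?addr0// => k kl.
rewrite coefZ coefXn; case: eqP => [E|_]; last by rewrite mulr0.
case/eqP: kl; apply/val_inj => /=.
by have := ltn_ord k; have := ltn_ord l; lia.
Qed.

(** The order conditions are identities between combinations of linearly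
    independent functions, so they hold coefficientwise. *)
Lemma order_conditions_coef s (c : 'I_s -> R) (beta : 'M[R[i]]_s) :
  order_conditions c beta -> forall j l : 'I_s,
  (j`!%:R)^-1 * \sum_(i < s) beta i l * (c i)%:C ^+ j = (j == l)%:R.
Proof.
move=> H j l.
pose ga l' := (j`!%:R)^-1 * (\sum_(i < s) beta i l' * (c i)%:C ^+ j) - (j == l')%:R.
suff : ga l = 0 by move/eqP; rewrite subr_eq0 => /eqP.
apply: phi_free => z.
have := H j.+1 z (ltn_ord j); rewrite /= -/(phi j.+1 z) => Hz.
have -> : \sum_(l' < s) ga l' * phi l'.+1 z =
  (j`!%:R)^-1 * (\sum_(l' < s) (\sum_(i < s) beta i l' * (c i)%:C ^+ j) * phi l'.+1 z)
  - phi j.+1 z.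
  rewrite /ga (eq_bigr _ (fun l' _ => mulrBl _ _ _)) sumrB; congr (_ - _).
    by rewrite mulr_sumr; apply: eq_bigr => l' _; rewrite mulrA.
  rewrite (bigD1 j)//= eqxx mul1r big1 ?addr0// => l' l'j.
  by rewrite eq_sym (negbTE l'j) mul0r.
apply/eqP; rewrite subr_eq0; apply/eqP; rewrite -[RHS]Hz; congr (_ * _).
rewrite /weight; under [RHS]eq_bigr do rewrite mulr_suml.
rewrite exchange_big/=; apply: eq_bigr => l' _.
by rewrite mulr_suml; apply: eq_bigr => i _; rewrite mulrAC.
Qed.

Lemma quadrature_order_coef s (c : 'I_s -> R) (beta : 'M[R[i]]_s) :
  quadrature_order c beta s.+1 ->
  \sum_(l < s) (s`!%:R)^-1 * (\sum_(i < s) beta i l * (c i)%:C ^+ s) * (l.+1`!%:R)^-1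
    = (s.+1`!%:R)^-1.
Proof.
move=> /(_ s.+1); rewrite leqnn => /(_ isT) H.
have -> : (s.+1`!%:R)^-1 = (s`!%:R)^-1 * s.+1%:R^-1 :> R[i].
  by rewrite factS natrM invfM mulrC.
rewrite -H mulr_sumr.
under [RHS]eq_bigr do rewrite /weight mulr_suml mulr_sumr.
rewrite exchange_big/=; apply: eq_bigr => l _.
rewrite -mulrA mulr_suml mulr_sumr; apply: eq_bigr => i _.
by rewrite -/(phi l.+1 0) phi0 [beta i l * _ * _]mulrAC.
Qed.

End PhiFunctions.

(** * The local error *)
Section Taylor.
Variables (R : realType) (X : completeNormedModType R[i]).

Lemma mono0 (t : R) : mono 0 t = 1.
Proof. by rewrite /mono expr0 fact0 divr1. Qed.

(** Integrating p times the variation of the highest derivative.  The sharp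
    remainder would be divided by p!; only the power of b - a matters. *)
Lemma taylor_bound p (G : nat -> R -> X) (a b H : R) : a <= b -> 0 <= H ->
  (forall j t, (j < p)%N -> a <= t <= b -> lint a t (G j.+1) (G j t - G j a)) ->
  (forall t, a <= t <= b -> nrm (G p t - G p a) <= H) ->
  forall t, a <= t <= b ->
    nrm (G 0%N t - \sum_(l < p.+1) (mono l (t - a))%:C *: G l a) <= (b - a) ^+ p * H.
Proof.
move=> ab H0; elim: p G => [|p IH] G Gint GH t tab.
  by rewrite big_ord_recl big_ord0 addr0 mono0 scale1r expr0 mul1r GH.
have {}IH := IH (fun j => G j.+1) (fun j t jp => Gint j.+1 t jp) GH.
have /andP[at_ tb] := tab; have ta0 : 0 <= t - a by rewrite subr_ge0.
have I1 := Gint 0%N t (ltn0Sn _) tab.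
have I2 := lint_sum at_ (fun l : 'I_p.+1 => lint_mono l (G l.+1 a) at_).
have c0 : 0 <= (b - a) ^+ p * H by rewrite mulr_ge0// exprn_ge0// subr_ge0.
rewrite big_ord_recl mono0 scale1r opprD addrA.
apply: (@le_trans _ _ ((b - a) ^+ p * H * (t - a))).
  apply: (lint_nrm_cst at_ c0 (lintB I1 I2)) => u /andP[u1 u2].
  by apply: IH; rewrite u1 (le_trans u2).
have -> : (b - a) ^+ p.+1 * H = (b - a) ^+ p * H * (b - a) by rewrite exprS; ring.
by rewrite ler_wpM2l// lerD2r.
Qed.

End Taylor.

Lemma zmod_split_error (V : zmodType) (w v A q r : V) :
  w - (v + (A + r)) = q - r + (w - (A + q) - v).
Proof.
have -> : w - (A + q) - v = w - A - v - q by rewrite opprD [w + _]addrA [LHS]addrAC.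
rewrite [RHS]addrC [RHS]addrA subrK.
by rewrite !opprD !addrA [w - v - A]addrAC.
Qed.

Local Arguments phi_op : simpl never.

Section LocalError.
Variables (R : realType) (X : completeNormedModType R[i]).
Variables (S : R -> X -> X) (T K L : R).
Hypothesis K0 : 0 <= K.
Hypothesis L0 : 0 <= L.
Hypothesis linS : forall t : R, 0 <= t -> linear (S t).
Hypothesis SD : forall (t u : R) x, 0 <= t -> 0 <= u -> S (t + u) x = S t (S u x).
Hypothesis contS : forall x (e : R), 0 < e ->
  exists2 d : R, 0 < d & forall h : R, 0 <= h -> h < d -> nrm (S h x - x) < e.
Hypothesis SK : forall (t : R) x, 0 <= t -> t <= T -> nrm (S t x) <= K * nrm x.
Hypothesis SL : forall (t u : R) x, 0 < t -> 0 <= u -> t + u <= T ->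
  nrm (S (t + u) x - S t x) <= L * (u / t) * nrm x.
Variables (s : nat) (c : 'I_s -> R) (beta : 'M[R[i]]_s).
Hypothesis c01 : forall i, 0 <= c i <= 1.

(** The coefficient of phi_(l+1) in the quadrature of the function t^j / j!. *)
Definition moment (j : nat) (l : 'I_s) : R[i] :=
  (j`!%:R)^-1 * \sum_(i < s) beta i l * (c i)%:C ^+ j.

Hypothesis moment_lt : forall j l : 'I_s, moment j l = (j == l)%:R.
Hypothesis moment_s : \sum_(l < s) moment s l * (l.+1`!%:R)^-1 = (s.+1`!%:R)^-1.

Definition moment_bound : R := 1 + \sum_(l < s) cabs (moment s l).
Definition weight_bound : R := 1 + \sum_(i < s) \sum_(l < s) cabs (beta i l).

(** The error of the quadrature rule on the first power that it need not
    integrate exactly, t^s / s!, scaled to a unit step: a combination psi(tau A)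
    of the operators phi_l(tau A). *)
Definition defect (tau : R) (x : X) : X :=
  phi_op S s.+1 tau x - \sum_(l < s) moment s l *: phi_op S l.+1 tau x.

Let phiB l (tau : R) x : 0 < tau -> tau <= T ->
  nrm (phi_op S l.+1 tau x) <= K * nrm x.
Proof. exact: phi_bound. Qed.

Lemma defect_bound (tau : R) x : 0 < tau -> tau <= T ->
  nrm (defect tau x) <= K * moment_bound * nrm x.
Proof.
move=> t0 tT; rewrite /defect (le_trans (nrmB _ _))//.
rewrite /moment_bound mulrDr mulr1 mulrDl lerD ?phiB//.
rewrite (le_trans (nrm_sum _ _ _))// mulr_sumr mulr_suml ler_sum// => l _.
by rewrite nrmZ mulrAC [leRHS]mulrC ler_wpM2l ?cabs_ge0// phiB.
Qed.

Lemma fact_realC (n : nat) : (n`!%:R^-1 : R)%:C = (n`!%:R)^-1 :> R[i].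
Proof. by rewrite fmorphV rmorph_nat. Qed.

(** The classical order s + 1 says that the function psi vanishes at 0.
    Subtracting from each phi_l its value at 0 does not change psi, and every
    term then gains the factor tau / t. *)
Lemma defect_smooth (tau t : R) x : 0 < tau -> 0 < t -> t + tau <= T ->
  nrm (S t (defect tau x)) <= L * moment_bound * (tau / t) * nrm x.
Proof.
move=> tau0 t0 tT.
have tT' : t <= T by rewrite (le_trans _ tT)// lerDl ltW.
have bl := bounded_linear_upto linS SK (ltW t0) tT'.
pose y l := phi_op S l.+1 tau x - (l.+1`!%:R^-1)%:C *: x.
have -> : defect tau x = y s - \sum_(l < s) moment s l *: y l.
  have aux (q : nat -> X) : q s - \sum_(l < s) moment s l *: q l =
      q s - (s.+1`!%:R^-1)%:C *: x
      - \sum_(l < s) moment s l *: (q l - (l.+1`!%:R^-1)%:C *: x).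
    under [in RHS]eq_bigr do rewrite scalerBr scalerA fact_realC.
    by rewrite sumrB -scaler_suml moment_s fact_realC opprB addrA subrK.
  exact: (aux (fun l => phi_op S l.+1 tau x)).
rewrite (linear_sub _ _ bl.1) (bounded_linear_sum _ _ bl).
apply: (le_trans (nrmB _ _)); rewrite /moment_bound mulrDr mulr1 !mulrDl lerD//.
  exact: (phi_smooth K0 L0 linS SD contS SK SL).
rewrite (le_trans (nrm_sum _ _ _))// mulr_sumr !mulr_suml ler_sum// => l _.
have -> : L * cabs (moment s l) * (tau / t) * nrm x = cabs (moment s l) * (L * (tau / t) * nrm x) by ring.
by rewrite nrmZ ler_wpM2l ?cabs_ge0//; exact: (phi_smooth K0 L0 linS SD contS SK SL).
Qed.

Lemma weight_op_bound i (tau : R) x : 0 < tau -> tau <= T ->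
  nrm (weight_op S beta i tau x) <= (\sum_(l < s) cabs (beta i l)) * (K * nrm x).
Proof.
move=> t0 tT; rewrite /weight_op (le_trans (nrm_sum _ _ _))// mulr_suml ler_sum// => l _.
by rewrite nrmZ ler_wpM2l ?cabs_ge0// phiB.
Qed.

Lemma weight_op_linear i (tau : R) : 0 < tau -> tau <= T -> linear (weight_op S beta i tau).
Proof.
move=> t0 tT k x y; rewrite /weight_op scaler_sumr -big_split/=; apply: eq_bigr => l _.
by rewrite (phi_linear K0 linS SD contS SK l t0 tT) scalerDr !scalerA [beta i l * k]mulrC.
Qed.

(** The powers below s are integrated exactly against the semigroup; the power s
    contributes the moments that appear in the defect. *)
Lemma quadrature_exact (tau : R) (p : nat -> X) : 0 < tau -> tau <= T ->
  tau%:C *: \sum_(i < s) weight_op S beta i tau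
     (\sum_(l < s.+1) (mono l (c i * tau))%:C *: p l) =
  \sum_(l < s) (tau ^+ l.+1)%:C *: phi_op S l.+1 tau (p l)
  + (tau ^+ s.+1)%:C *: \sum_(l < s) moment s l *: phi_op S l.+1 tau (p s).
Proof.
move=> t0 tT.
have wl i := weight_op_linear i t0 tT.
transitivity (\sum_(j < s.+1) (tau ^+ j.+1)%:C *:
    \sum_(l < s) moment j l *: phi_op S l.+1 tau (p j)).
  under eq_bigr do rewrite (linear_bigsum _ (wl _)).
  rewrite scaler_sumr; under eq_bigr do rewrite scaler_sumr.
  rewrite exchange_big/=; apply: eq_bigr => j _.
  under eq_bigr do rewrite (linear_scale _ _ (wl _)) /weight_op !scaler_sumr.
  rewrite exchange_big/= scaler_sumr; apply: eq_bigr => l _.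
  move: (phi_op S l.+1 tau (p j)) => q.
  under eq_bigr do rewrite !scalerA.
  rewrite -scaler_suml scalerA; congr (_ *: _).
  rewrite /moment !mulr_sumr; apply: eq_bigr => i _.
  rewrite /mono exprMn exprSr !rmorphM/= fact_realC !rmorphXn/=; ring.
rewrite big_ord_recr/=; congr (_ + _); apply: eq_bigr => j _; congr (_ *: _).
rewrite (bigD1 j)//= moment_lt eqxx scale1r big1 ?addr0// => l lj.
by rewrite moment_lt eq_sym (negbTE lj) scale0r.
Qed.

(** Expanding the inhomogeneity at [a] up to degree s, the exact integral and
    the quadrature differ on the polynomial part by the defect applied to the
    coefficient [p s], and on the remainder, which is at most (b - a)^s H, by a
    bounded multiple of its size times the length b - a. *)
Theorem local_error (a b H : R) (p : nat -> X) (f : R -> X) (wa wb : X) :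
  0 <= a -> a < b -> b <= T -> 0 <= H ->
  lint a b (fun t => S (b - t) (f t)) (wb - S (b - a) wa) ->
  (forall t, a <= t <= b ->
     nrm (f t - \sum_(l < s.+1) (mono l (t - a))%:C *: p l) <= (b - a) ^+ s * H) ->
  exists2 r : X, nrm r <= K * weight_bound * ((b - a) ^+ s.+1 * H) &
    wb - S (b - a) wa - (b - a)%:C *: \sum_(i < s) weight_op S beta i (b - a) (f (a + c i * (b - a)))
    = ((b - a) ^+ s.+1)%:C *: defect (b - a) (p s) + r.
Proof.
move=> a0 ab bT H0 I1 fp; set tau := b - a in I1 fp *.
have t0 : 0 < tau by rewrite subr_gt0.
have tT : tau <= T by rewrite (le_trans _ bT)// gerBl.
have ab' := ltW ab.
pose P t := \sum_(l < s.+1) (mono l (t - a))%:C *: p l.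
have h0 : 0 <= tau ^+ s * H by rewrite mulr_ge0// exprn_ge0// ltW.
have I2 : lint a b (fun t => S (b - t) (P t))
    (\sum_(l < s.+1) (tau ^+ l.+1)%:C *: phi_op S l.+1 tau (p l)).
  have := lint_sum ab' (fun l : 'I_s.+1 => phi_int K0 linS SD contS SK l (p l) t0 tT).
  apply: lint_eq => t /andP[t1 t2].
  have bt0 : 0 <= b - t by rewrite subr_ge0.
  rewrite /P (linear_bigsum _ (linS bt0)); apply: eq_bigr => l _.
  by rewrite (linear_scale _ _ (linS bt0)).
have I3 := lintB I1 I2.
set v1 := _ - _ in I3.
have v1P : nrm v1 <= K * (tau ^+ s * H) * (b - a).
  have K1 : 0 <= K * (tau ^+ s * H) by rewrite mulr_ge0.
  apply: (lint_nrm_cst ab' K1 I3) => t /[dup] tab /andP[t1 t2].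
  have bt0 : 0 <= b - t by rewrite subr_ge0.
  have btT : b - t <= T by rewrite (le_trans _ bT)// gerBl (le_trans a0).
  rewrite -(linear_sub _ _ (linS bt0)) (le_trans (SK _ bt0 btT))//.
  by rewrite ler_wpM2l// fp.
pose v2 := tau%:C *: \sum_(i < s) weight_op S beta i tau (f (a + c i * tau) - P (a + c i * tau)).
have v2P : nrm v2 <= tau * ((\sum_(i < s) \sum_(l < s) cabs (beta i l)) * (K * (tau ^+ s * H))).
  rewrite /v2 nrmZp ?(ltW t0)// ler_wpM2l ?(ltW t0)//.
  rewrite (le_trans (nrm_sum _ _ _))// mulr_suml ler_sum// => i _.
  rewrite (le_trans (weight_op_bound _ _ t0 tT))// ler_wpM2l//.
    by rewrite sumr_ge0// => l _; exact: cabs_ge0.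
  rewrite ler_wpM2l// fp//; have /andP[c0 c1] := c01 i.
  rewrite lerDl mulr_ge0 ?(ltW t0)//= -lerBrDl -/tau.
  by rewrite -[leRHS]mul1r ler_wpM2r// ltW.
exists (v1 - v2).
  rewrite (le_trans (nrmB _ _))// /weight_bound.
  apply: (le_trans (lerD v1P v2P)); rewrite -/tau le_eqVlt; apply/orP; left; apply/eqP.
  by rewrite exprS; ring.
have E2 : tau%:C *: \sum_(i < s) weight_op S beta i tau (f (a + c i * tau)) =
    v2 + (\sum_(l < s) (tau ^+ l.+1)%:C *: phi_op S l.+1 tau (p l)
  + (tau ^+ s.+1)%:C *: \sum_(l < s) moment s l *: phi_op S l.+1 tau (p s)).
  rewrite -quadrature_exact// /v2 -scalerDr -big_split/=; congr (_ *: _).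
  apply: eq_bigr => i _; rewrite (linear_sub _ _ (weight_op_linear i t0 tT)).
  have -> : P (a + c i * tau) = \sum_(l < s.+1) (mono l (c i * tau))%:C *: p l.
    by apply: eq_bigr => l _; rewrite addrAC subrr add0r.
  by rewrite subrK.
rewrite E2 /v1 big_ord_recr/= /defect scalerBr.
set w := wb - _; set A := \sum_(i < s) _; set q := _ *: phi_op S s.+1 tau (p s).
set r := _ *: \sum_(l < s) _.
exact: zmod_split_error.
Qed.

End LocalError.

(** * Grids and step size ratios *)
Section Grid.
Variables (R : realType) (tau : nat -> R) (N : nat).
Hypothesis tau0 : forall n, (n < N)%N -> 0 < tau n.

Lemma grid0 : grid tau 0 = 0.
Proof. by rewrite /grid big_ord0. Qed.

Lemma gridS n : grid tau n.+1 = grid tau n + tau n.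
Proof. by rewrite /grid big_ord_recr. Qed.

Lemma grid_le n m : (n <= m)%N -> (m <= N)%N -> grid tau n <= grid tau m.
Proof.
move=> nm; rewrite -(subnKC nm); elim: (m - n)%N => [|k IH]; first by rewrite addn0.
rewrite addnS => kN; rewrite gridS (le_trans (IH (ltnW kN)))// lerDl ltW// tau0//.
Qed.

Lemma grid_ge0 n : (n <= N)%N -> 0 <= grid tau n.
Proof. by move=> nN; rewrite -grid0 grid_le. Qed.

(** When the steps at least double, the sum is dominated by a geometric one. *)
Lemma sum_powers_le p m : (forall j, (j < m)%N -> 2 * tau j <= tau j.+1) ->
  (m < N)%N -> \sum_(j < m) tau j ^+ p.+1 <= tau m ^+ p.+1.
Proof.
elim: m => [|m IH] dbl mN; first by rewrite big_ord0 exprn_ge0// ltW// tau0.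
have m0 := tau0 (ltnW mN).
rewrite big_ord_recr/=.
have h1 := IH (fun j jm => dbl j (ltnW jm)) (ltnW mN).
have h2 : (2 * tau m) ^+ p.+1 <= tau m.+1 ^+ p.+1.
  by rewrite lerXn2r ?nnegrE ?mulr_ge0 ?(ltW m0)// ?dbl// ltW// tau0.
apply: le_trans h2; rewrite exprMn.
have : 2 <= 2 ^+ p.+1 :> R by rewrite -natrX ler_nat -{1}(expn1 2) leq_exp2l.
have : 0 <= tau m ^+ p.+1 by rewrite exprn_ge0// ltW.
move: h1; set q := tau m ^+ _; set w := 2 ^+ _; nra.
Qed.

(** This produces the factor kappa in front of the last sum of the error bound.
    For kappa >= 1/2 it is trivial.  Otherwise the steps at least double, all the
    ratios tau j / (t_(m+1) - t_(j+1)) are at most 1 and the sum is absorbed by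
    the last step. *)
Lemma step_ratio_sum (kappa : R) (p m : nat) : 0 < kappa ->
  (forall j, (j.+1 < N)%N -> tau j <= kappa * tau j.+1) -> (m < N)%N ->
  \sum_(j < m) tau j ^+ p.+1 * ((grid tau m.+1 - grid tau j.+1)^-1 * tau j) <=
  2 * kappa * (\sum_(j < m) tau j ^+ p.+1 * ((grid tau m.+1 - grid tau j.+1)^-1 * tau j))
  + tau m ^+ p.+1.
Proof.
move=> k0 stp mN; set Q := \sum_(j < m) _.
have tm0 : 0 <= tau m ^+ p.+1 by rewrite exprn_ge0// ltW// tau0.
have jN (j : 'I_m) : (j.+1 < N)%N by rewrite (leq_ltn_trans _ mN).
have gj (j : 'I_m) : tau j.+1 <= grid tau m.+1 - grid tau j.+1.
  have : grid tau j.+2 <= grid tau m.+1 by apply: grid_le; rewrite // ltnS.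
  by rewrite gridS lerBrDl.
have gj0 (j : 'I_m) : 0 < grid tau m.+1 - grid tau j.+1.
  by apply: lt_le_trans (gj j); rewrite tau0.
have Q0 : 0 <= Q.
  apply: sumr_ge0 => j _; have j0 := ltW (tau0 (ltnW (jN j))).
  by rewrite mulr_ge0 ?exprn_ge0// mulr_ge0// invr_ge0 ltW.
have [k2|k2] := leP (1 / 2) kappa; first by nra.
have dbl j : (j < m)%N -> 2 * tau j <= tau j.+1.
  move=> jm; have := stp j (leq_ltn_trans jm mN).
  have : 0 < tau j.+1 by rewrite tau0// (leq_ltn_trans jm).
  by move: k2; rewrite ltr_pdivlMr//; nra.
have : Q <= tau m ^+ p.+1.
  apply: le_trans (sum_powers_le p dbl mN); apply: ler_sum => j _.
  have j0 := tau0 (ltnW (jN j)).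
  rewrite -[leRHS]mulr1 ler_wpM2l ?exprn_ge0 ?(ltW j0)//.
  rewrite mulrC ler_pdivrMr// mul1r; apply: le_trans (gj j).
  by apply: le_trans (dbl j (ltn_ord j)); move: j0; lra.
nra.
Qed.

End Grid.

(** * The global error *)
Lemma zmod_step_error (V : zmodType) (p q u x : V) :
  p + q - u = p - x - (u - x - q).
Proof. by rewrite !opprB [q + _]addrCA [RHS]addrA subrK addrA. Qed.

Lemma step_constant (R : realFieldType) (a b l A Q q Sg kappa : R) :
  0 <= a -> 0 <= b -> 0 <= l -> 0 <= A -> 0 <= Q -> 0 <= q -> 0 <= Sg -> 0 < kappa ->
  Q <= 2 * kappa * Q + q ->
  a * A + (l * Sg * Q + q * (b * Sg)) <=
  (a + b + 2 * l) * A + (a + b + 2 * l) * q * Sg + (a + b + 2 * l) * kappa * (Q * Sg).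
Proof.
move=> a0 b0 l0 A0 Q0 q0 S0 k0 QP.
have h1 : 0 <= (b + 2 * l) * A by rewrite mulr_ge0// addr_ge0// mulr_ge0.
have h2 : 0 <= (a + l) * (q * Sg) by rewrite !mulr_ge0// addr_ge0.
have h3 : 0 <= (a + b) * (kappa * (Q * Sg)).
  by rewrite mulr_ge0 ?addr_ge0// mulr_ge0 ?(ltW k0)// mulr_ge0.
have h4 : 0 <= l * Sg * (2 * kappa * Q + q - Q) by rewrite mulr_ge0 ?subr_ge0// mulr_ge0.
lra.
Qed.

Section ErrorRecursion.
Variables (R : realType) (X : completeNormedModType R[i]).
Variables (S : R -> X -> X) (tau : nat -> R) (N : nat).
Hypothesis tau0 : forall n, (n < N)%N -> 0 < tau n.
Hypothesis linS : forall t : R, 0 <= t -> linear (S t).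
Hypothesis S0 : forall x, S 0 x = x.
Hypothesis SD : forall (t u : R) x, 0 <= t -> 0 <= u -> S (t + u) x = S t (S u x).

(** The local errors are transported by the semigroup itself, so only the norms
    of S(t_n - t_(j+1)) applied to local errors are needed and no powers of a
    stability constant accumulate. *)
Lemma error_recursion (e d : nat -> X) : e 0%N = 0 ->
  (forall n, (n < N)%N -> e n.+1 = S (tau n) (e n) - d n) ->
  forall n, (n <= N)%N ->
    e n = - \sum_(j < n) S (grid tau n - grid tau j.+1) (d j).
Proof.
move=> e0 eS; elim=> [|n IH] nN; first by rewrite e0 big_ord0 oppr0.
have t0 := ltW (tau0 nN).
have E : S (tau n) (\sum_(j < n) S (grid tau n - grid tau j.+1) (d j)) =
    \sum_(j < n) S (grid tau n.+1 - grid tau j.+1) (d j).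
  rewrite (linear_bigsum _ (linS t0)); apply: eq_bigr => j _.
  have g0 : 0 <= grid tau n - grid tau j.+1.
    by rewrite subr_ge0; apply: (grid_le tau0); [exact: ltn_ord|exact: ltnW].
  by rewrite -(SD _ t0 g0) [grid tau n.+1]gridS addrCA addrA.
have S0n : S (tau n) 0 = 0 := linear_zero (linS t0).
have g0 : grid tau n.+1 - grid tau n.+1 = 0 by exact: subrr.
rewrite big_ord_recr [in RHS]/= g0 S0 opprD (eS n nN) (IH (ltnW nN)).
by rewrite -[X in S _ X]sub0r (linear_sub _ _ (linS t0)) S0n E sub0r.
Qed.

End ErrorRecursion.

Section SobolevFacts.
Variables (R : realType) (X : completeNormedModType R[i]).

Lemma sobolev_lint (T : R) (g h : R -> X) : sobolev_deriv T g h ->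
  forall a b, 0 <= a -> a <= b -> b <= T -> lint a b h (g b - g a).
Proof.
move=> gh a b a0 ab bT.
have b0 := le_trans a0 ab; have aT := le_trans ab bT.
have Ib := lint_of_bochner (gh b ltac:(by rewrite in_itv/= b0)).
have Ia := lint_of_bochner (gh a ltac:(by rewrite in_itv/= a0)).
have := lint_sub a0 ab Ib Ia; congr (lint _ _ _ _).
by rewrite opprB addrA subrK.
Qed.

(** The supremum is a true bound because an absolutely continuous function is
    bounded. *)
Lemma supnorm_ge (T : R) (g h : R -> X) (t : R) : 0 <= t -> t <= T ->
  sobolev_deriv T g h -> bochner_integrable 0 T h ->
  nrm (g t) <= supnorm T g.
Proof.
move=> t0 tT gh hT; have T0 := le_trans t0 tT.
have dh := bochner_dominated_nrm (lexx 0) T0 (lexx T) hT.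
set H := Rintegral _ _ _ in dh.
apply: sup_upper_bound; last by exists t => //=; rewrite in_itv/= t0.
split; first by exists (nrm (g t)); exists t => //=; rewrite in_itv/= t0.
exists (nrm (g 0) + H) => _ [u /= uT <-].
move: uT; rewrite in_itv/= => /andP[u0 uT].
have := lint_nrm_le (sobolev_lint gh (lexx 0) u0 uT) (dominated_sub (lexx 0) uT dh).
have := nrmD (g u - g 0) (g 0); rewrite subrK; lra.
Qed.

Lemma mild_step (S : R -> X -> X) (T K : R) (f w : R -> X) (w0 : X) :
  0 <= K -> (forall t : R, 0 <= t -> linear (S t)) ->
  (forall (t u : R) x, 0 <= t -> 0 <= u -> S (t + u) x = S t (S u x)) ->
  (forall (t : R) x, 0 <= t -> t <= T -> nrm (S t x) <= K * nrm x) ->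
  mild_solution S T f w0 w ->
  forall a b, 0 <= a -> a <= b -> b <= T ->
    lint a b (fun t => S (b - t) (f t)) (w b - S (b - a) (w a)).
Proof.
move=> K0 linS SD SK mw a b a0 ab bT.
have b0 := le_trans a0 ab; have aT := le_trans ab bT.
have Ib := lint_of_bochner (mw b ltac:(by rewrite in_itv/= b0)).
have Ia := lint_of_bochner (mw a ltac:(by rewrite in_itv/= a0)).
have ba0 : 0 <= b - a by rewrite subr_ge0.
have baT : b - a <= T by rewrite (le_trans _ bT)// gerBl.
have I2 : lint 0 a (fun t => S (b - t) (f t)) (S (b - a) (w a - S a w0)).
  have := lint_map K0 (bounded_linear_upto linS SK ba0 baT) Ia.
  apply: lint_eq => t /andP[t0 ta].
  by rewrite -SD ?subr_ge0// addrA subrK.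
have := lint_sub a0 ab Ib I2; congr (lint _ _ _ _).
by rewrite (linear_sub _ _ (linS _ ba0)) -SD// subrK opprB addrA subrK.
Qed.

End SobolevFacts.

Section GlobalError.
Variables (R : realType) (X : completeNormedModType R[i]) (S : R -> X -> X).
Variables (T K L : R).
Hypotheses (hT : 0 < T) (K1 : 1 <= K) (L0 : 0 <= L).
Hypothesis linS : forall t : R, 0 <= t -> linear (S t).
Hypothesis S0 : forall x, S 0 x = x.
Hypothesis SD : forall (t u : R) x, 0 <= t -> 0 <= u -> S (t + u) x = S t (S u x).
Hypothesis contS : forall (x : X) (e : R), 0 < e ->
  exists2 d : R, 0 < d & forall h : R, 0 <= h -> h < d -> nrm (S h x - x) < e.
Hypothesis SK : forall (t : R) x, 0 <= t -> t <= T -> nrm (S t x) <= K * nrm x.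
Hypothesis SL : forall (t u : R) x, 0 < t -> 0 <= u -> t + u <= T ->
  nrm (S (t + u) x - S t x) <= L * (u / t) * nrm x.

Variables (s : nat) (c : 'I_s -> R) (beta : 'M[R[i]]_s).
Hypothesis hc01 : forall i, 0 <= c i <= 1.
Hypothesis moment_lt : forall j l : 'I_s, moment c beta j l = (j == l)%:R.
Hypothesis moment_s : \sum_(l < s) moment c beta s l * (l.+1`!%:R)^-1 = (s.+1`!%:R)^-1.

(** The three parts bound the contributions of the Taylor remainders, of the
    last defect, and of the smoothed defects of the earlier steps; the latter is
    doubled to match the factor 2 kappa in [step_ratio_sum]. *)
Definition error_constant : R :=
  K * K * weight_bound beta + K * moment_bound c beta + 2 * (L * moment_bound c beta).

(** The estimate for homogeneous boundary conditions, for any semigroup that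
    satisfies the two estimates on [0, T]. *)
Theorem exponential_quadrature_error (f : R -> X) (g : nat -> R -> X)
  (w : R -> X) (N : nat) (tau : nat -> R) (kappa : R) (v : nat -> X) :
  mild_solution S T f (w 0) w ->
  (forall t : R, t \in `[0, T] -> g 0%N t = f t) ->
  (forall j, (j <= s)%N -> sobolev_deriv T (g j) (g j.+1)) ->
  bochner_integrable 0 T (g s.+1) ->
  (forall n, (n < N)%N -> 0 < tau n) -> grid tau N = T ->
  0 < kappa -> (forall j, (j.+1 < N)%N -> tau j <= kappa * tau j.+1) ->
  v 0%N = w 0 ->
  (forall n, (n < N)%N -> v n.+1 = S (tau n) (v n) + (tau n)%:C *:
     \sum_(i < s) weight_op S beta i (tau n) (f (grid tau n + c i * tau n))) ->
  forall n, (1 <= n <= N)%N ->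
    nrm (v n - w (grid tau n)) <=
      error_constant * (\sum_(j < n) tau j ^+ s.+1 *
             Rintegral lebesgue_measure `[grid tau j, grid tau j.+1]
               (fun xi => nrm (g s.+1 xi)))
      + error_constant * tau n.-1 ^+ s.+1 * supnorm T (g s)
      + error_constant * kappa * \sum_(j < n.-1)
          tau j ^+ s.+1 * ((grid tau n - grid tau j.+1)^-1 * tau j)
            * supnorm T (g s).
Proof.
move=> mw hg0 hg hgs1 htau hgrid hkappa hstep v0 vS n /andP[n1 nN].
have K0 : 0 <= K by rewrite (le_trans _ K1).
pose Mb := moment_bound c beta.
pose Wb := weight_bound beta.
have Mb0 : 0 <= Mb by rewrite addr_ge0// sumr_ge0// => l _; exact: cabs_ge0.
have Wb0 : 0 <= Wb.
  by rewrite addr_ge0// sumr_ge0// => i _; rewrite sumr_ge0// => l _; exact: cabs_ge0.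
rewrite /error_constant -/Mb -/Wb.
case: n n1 nN => // m _ mN.
pose t := grid tau.
pose d j := w (t j.+1) - S (tau j) (w (t j))
  - (tau j)%:C *: \sum_(i < s) weight_op S beta i (tau j) (f (t j + c i * tau j)).
pose H j := Rintegral lebesgue_measure `[t j, t j.+1] (fun xi => nrm (g s.+1 xi)).
pose Sg := supnorm T (g s).
have tT j : (j <= N)%N -> t j <= T by move=> jN; rewrite -hgrid; apply: (grid_le htau).
have tg0 j : (j <= N)%N -> 0 <= t j by exact: (grid_ge0 htau).
have tS j : t j.+1 = t j + tau j by exact: gridS.
have tE j : tau j = t j.+1 - t j by rewrite tS addrAC subrr add0r.
have tm j : (j < N)%N -> t j < t j.+1 by move=> jN; rewrite tS ltrDl htau.
have H0 j : 0 <= H j.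
  by rewrite /H /Rintegral fine_ge0// integral_ge0// => xi _; rewrite lee_fin nrm_ge0.
have gS x : 0 <= x -> x <= T -> nrm (g s x) <= Sg.
  by move=> x0 xT; apply: (supnorm_ge x0 xT (hg s (leqnn _)) hgs1).
have Sg0 : 0 <= Sg by apply: le_trans (gS 0 (lexx _) (ltW hT)); exact: nrm_ge0.
have in0T x : 0 <= x -> x <= T -> x \in `[0, T] by move=> x0 xT; rewrite in_itv/= x0.
have loc j : (j < N)%N -> exists2 r : X, nrm r <= K * Wb * (tau j ^+ s.+1 * H j) &
    d j = (tau j ^+ s.+1)%:C *: defect S c beta (tau j) (g s (t j)) + r.
  move=> jN; have jT := tT _ jN; have j0 := tg0 _ (ltnW jN); have jm := tm _ jN.
  rewrite /d !tE.
  apply: (local_error K0 linS SD contS SK hc01 moment_lt (p := fun l => g l (t j)) (f := f)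
    j0 jm jT (H0 j)).
    exact: (mild_step K0 linS SD SK mw j0 (ltW jm) jT).
  have dH := bochner_dominated_nrm j0 (ltW jm) jT hgs1.
  move=> y yab; have /andP[y1 y2] := yab; rewrite -hg0 ?in0T ?(le_trans j0)// ?(le_trans y2)//.
  move: y yab {y1 y2}.
  apply: (taylor_bound (ltW jm) (H0 j)) => [i x si /andP[x1 x2]|x /andP[x1 x2]].
    by apply: (sobolev_lint (hg i (ltnW si)) j0 x1); rewrite (le_trans x2).
  have xT := le_trans x2 jT.
  exact: (lint_nrm_le (sobolev_lint (hg s (leqnn _)) j0 x1 xT) (dominated_sub (lexx _) x2 dH)).
pose e j := v j - w (t j).
have e0 : e 0%N = 0 by rewrite /e v0 /t grid0 subrr.
have eS j : (j < N)%N -> e j.+1 = S (tau j) (e j) - d j.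
  move=> jN; rewrite /e (vS _ jN) (linear_sub _ _ (linS (ltW (htau _ jN)))).
  exact: zmod_step_error.
have eE := error_recursion htau linS S0 SD e0 eS mN.
have -> : nrm (v m.+1 - w (t m.+1)) = nrm (\sum_(j < m.+1) S (t m.+1 - t j.+1) (d j)).
  by rewrite -[LHS]/(nrm (e m.+1)) eE nrmN.
apply: (le_trans (nrm_sum _ _ _)).
pose q j := tau j ^+ s.+1.
pose Q := \sum_(j < m) q j * ((t m.+1 - t j.+1)^-1 * tau j).
pose A := \sum_(j < m.+1) q j * H j.
have q0 j : (j < N)%N -> 0 <= q j by move=> jN; rewrite exprn_ge0// ltW// htau.
have mT := tT _ mN.
have tj j : (j < m.+1)%N -> 0 <= t m.+1 - t j.+1 <= T.
  move=> jm; rewrite subr_ge0 (grid_le htau)//= (le_trans _ mT)// gerBl tg0//.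
  exact: leq_trans jm mN.
have rem j (r : X) : (j < m.+1)%N -> nrm r <= K * Wb * (q j * H j) ->
    nrm (S (t m.+1 - t j.+1) r) <= K * K * Wb * (q j * H j).
  move=> jm rP; have /andP[x0 xT] := tj j jm.
  apply: (le_trans (SK r x0 xT)).
  by rewrite -[K * K * Wb]mulrA -[leRHS]mulrA ler_wpM2l.
have taujT j : (j < N)%N -> tau j <= T.
  by move=> jN; apply: (le_trans _ (tT _ jN)); rewrite tS lerDr tg0// ltnW.
(* The remainder of the local error is only transported, the defect is kept
   apart because it is smoothed by the semigroup. *)
have split_term j : (j < m.+1)%N ->
    nrm (S (t m.+1 - t j.+1) (d j)) <= K * K * Wb * (q j * H j)
      + q j * nrm (S (t m.+1 - t j.+1) (defect S c beta (tau j) (g s (t j)))).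
  move=> jm; have jN := leq_trans jm mN; have /andP[x0 xT] := tj j jm.
  have [r rP ->] := loc j jN.
  rewrite (linear_add _ _ (linS x0)) (linear_scale _ _ (linS x0)).
  by rewrite addrC (le_trans (nrmD _ _))// lerD ?rem// nrmZp ?q0.
(* No time is left for smoothing after the last step. *)
have last_term : nrm (S (t m.+1 - t m.+1) (defect S c beta (tau m) (g s (t m)))) <= K * Mb * Sg.
  have -> : t m.+1 - t m.+1 = 0 by exact: subrr.
  rewrite S0 (le_trans (defect_bound K0 linS SD contS SK c beta _ (htau _ mN) (taujT _ mN)))//.
  by rewrite ler_wpM2l ?mulr_ge0// gS// ?tg0 ?tT// ltnW.
have early_term j : (j < m)%N ->
    nrm (S (t m.+1 - t j.+1) (defect S c beta (tau j) (g s (t j)))) <=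
      L * Mb * ((t m.+1 - t j.+1)^-1 * tau j) * Sg.
  move=> jm; have jN : (j.+1 < N)%N by exact: leq_ltn_trans jm mN.
  have x0 : 0 < t m.+1 - t j.+1.
    by rewrite subr_gt0 (lt_le_trans (tm _ jN))// (grid_le htau).
  have xT : t m.+1 - t j.+1 + tau j <= T.
    rewrite [t j.+1]tS opprD addrA subrK (le_trans _ mT)// gerBl tg0// ltnW//.
    exact: ltnW.
  have y0 := htau _ (ltnW jN).
  rewrite [_^-1 * _]mulrC (le_trans (defect_smooth K0 L0 linS SD contS SK SL moment_s _ y0 x0 xT))//.
  rewrite ler_wpM2l//.
    exact: (mulr_ge0 (mulr_ge0 L0 Mb0) (divr_ge0 (ltW y0) (ltW x0))).
  have jN' := ltnW (ltnW jN).
  exact: gS (tg0 _ jN') (tT _ jN').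
have sum_bound : \sum_(j < m.+1) nrm (S (t m.+1 - t j.+1) (d j)) <=
    K * K * Wb * A + (L * Mb * Sg * Q + q m * (K * Mb * Sg)).
  apply: (@le_trans _ _ (\sum_(j < m.+1) (K * K * Wb * (q j * H j)
    + q j * nrm (S (t m.+1 - t j.+1) (defect S c beta (tau j) (g s (t j))))))).
    by apply: ler_sum => j _; exact: split_term (ltn_ord j).
  rewrite big_split /= -mulr_sumr lerD2l big_ord_recr /=.
  apply: lerD; last by rewrite ler_wpM2l ?q0.
  rewrite /Q mulr_sumr; apply: ler_sum => j _.
  have jN : (j < N)%N by exact: ltn_trans (ltn_ord j) mN.
  apply: (le_trans (ler_wpM2l (q0 _ jN) (early_term _ (ltn_ord j)))).
  by rewrite le_eqVlt; apply/orP; left; apply/eqP; ring.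
apply: (le_trans sum_bound).
(* The defects of the earlier steps carry no factor kappa yet. *)
have QP : Q <= 2 * kappa * Q + q m by exact: (step_ratio_sum htau s hkappa hstep mN).
rewrite -mulr_suml -/Sg -/t.
rewrite -[\sum_(j < m.+1) _]/A -[\sum_(j < m) _]/Q -[tau m ^+ _]/(q m).
have A0 : 0 <= A by apply: sumr_ge0 => j _; rewrite mulr_ge0 ?q0// (leq_trans (ltn_ord j)).
have Q0 : 0 <= Q.
  apply: sumr_ge0 => j _; have jN : (j < N)%N by exact: ltn_trans (ltn_ord j) mN.
  have /andP[x0 _] := tj j (ltnW (ltn_ord j)).
  by rewrite mulr_ge0 ?q0// mulr_ge0 ?invr_ge0// ltW// htau.
have qm0 := q0 _ mN.
have C1 : 0 <= K * K * Wb by rewrite !mulr_ge0.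
have C2 : 0 <= K * Mb by rewrite mulr_ge0.
have C3 : 0 <= L * Mb by rewrite mulr_ge0.
exact: step_constant.
Qed.

End GlobalError.

Theorem theorem2 (R : realType)
  (d : nat) (hd : (0 < d)%N) (Omega : set 'rV[R]_d) (hOmega : is_domain Omega)
  (X : completeNormedModType R[i]) (rep : X -> 'rV[R]_d -> R[i])
  (hX : function_space Omega rep)
  (m : nat) (a : multi_index d m -> 'rV[R]_d -> R[i])
  (ha : smooth_coefficients Omega a) (hell : strongly_elliptic Omega a)
  (domD : set X) (D : X -> X) (hD : is_diff_op Omega rep a domD D)
  (Y : lmodType R[i]) (B : X -> Y) (hB : is_boundary_op Omega rep domD B)
  (domA : set X) (hdomA : domA = [set u | domD u /\ B u = 0])
  (hA : sectorial domA D)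
  (S : R -> X -> X) (hS : is_semigroup_of domA D S)
  (s : nat) (hs : (0 < s)%N)
  (c : 'I_s -> R) (hc : injective c) (hc01 : forall i, 0 <= c i <= 1)
  (beta : 'M[R[i]]_s) (hbeta : order_conditions c beta)
  (hord : quadrature_order c beta s.+1)
  (T : R) (hT : 0 < T) :
  exists C : R,
  forall (f : R -> X) (b : R -> Y) (u0 : X) (u z dz k : R -> X)
    (hzsmooth : smooth_curve T z)
    (hzspace : forall t, t \in `[0, T] ->
       exists2 v, smooth_on Omega v & ae_eq_on Omega (rep (z t)) v)
    (hzdom : forall t, t \in `[0, T] -> domD (z t))
    (hzB : forall t, t \in `[0, T] -> B (z t) = b t)
    (hdz : forall t, t \in `[0, T] -> curve_deriv T z t (dz t))
    (hk : forall t, t \in `[0, T] -> k t = D (z t) - dz t)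
    (hu0 : u 0 = u0)
    (hu : mild_solution S T (fun t => f t + k t) (u0 - z 0) (fun t => u t - z t))
    (g : nat -> R -> X)
    (hg0 : forall t, t \in `[0, T] -> g 0%N t = f t + k t)
    (hg : forall j, (j <= s)%N -> sobolev_deriv T (g j) (g j.+1))
    (hgs : bochner_integrable 0 T (g s))
    (hgs1 : bochner_integrable 0 T (g s.+1))
    (N : nat) (tau : nat -> R)
    (htau : forall n, (n < N)%N -> 0 < tau n)
    (hgrid : grid tau N = T)
    (kappa : R) (hkappa : 0 < kappa)
    (hstep : forall j, (j.+1 < N)%N -> tau j <= kappa * tau j.+1)
    (un : nat -> X) (hun0 : un 0%N = u0)
    (hun : forall n, (n < N)%N ->
       un n.+1 = S (tau n) (un n - z (grid tau n)) + z (grid tau n.+1)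
         + (tau n)%:C *: \sum_(i < s)
             weight_op S beta i (tau n)
               (f (grid tau n + c i * tau n) + k (grid tau n + c i * tau n))),
  forall n, (1 <= n <= N)%N ->
    nrm (un n - u (grid tau n)) <=
      C * (\sum_(j < n) tau j ^+ s.+1 *
             Rintegral lebesgue_measure `[grid tau j, grid tau j.+1]
               (fun xi => nrm (g s.+1 xi)))
      + C * tau n.-1 ^+ s.+1 * supnorm T (g s)
      + C * kappa * \sum_(j < n.-1)
          tau j ^+ s.+1 * ((grid tau n - grid tau j.+1)^-1 * tau j)
            * supnorm T (g s).
Proof.
have hAB : linear_on domA D.
  rewrite hdomA; have [[dD0 lD] _] := hD; have [[_ lB] _] := hB.
  have B0 : B 0 = 0.
    have [_] := lB 1 0 0 dD0 dD0; rewrite !scale1r addr0 => E.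
    by apply: (@addrI _ (B 0)); rewrite addr0 -E.
  split; first by split.
  move=> a0 u v [du Bu] [dv Bv]; have [d1 e1] := lD a0 u v du dv.
  have [_ e2] := lB a0 u v du dv.
  by split=> //; split=> //; rewrite e2 Bu Bv scaler0 addr0.
have [K' [L [K'0 L0 SK' SL]]] := sectorial_semigroup_estimates hAB hA hS hT.
pose K := K' + 1.
have K1 : 1 <= K by rewrite lerDr.
have K0 : 0 <= K by rewrite (le_trans _ K1).
have SK (t : R) x : 0 <= t -> t <= T -> nrm (S t x) <= K * nrm x.
  move=> t0 tT; apply: (le_trans (SK' t x t0 tT)).
  by rewrite ler_wpM2r ?nrm_ge0// lerDl.
have linS := semigroup_linear hS.
have S0 := semigroup0 hS.
have SD := semigroupD hS.
have contS := semigroup_right_cont hS.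
have moment_lt := order_conditions_coef hbeta.
have moment_s := quadrature_order_coef hord.
exists (error_constant K L c beta).
move=> f b u0 u z dz k _ _ _ _ _ _ hu0 hu g hg0 hg hgs hgs1 N tau htau hgrid kappa hkappa
  hstep un hun0 hun n nN.
have w0 : u0 - z 0 = u 0 - z 0 by rewrite hu0.
rewrite w0 in hu.
(* The correction z cancels: u_n - z(t_n) is the numerical approximation of
   (u - z)(t_n). *)
have -> : un n - u (grid tau n) =
    (un n - z (grid tau n)) - (u (grid tau n) - z (grid tau n)).
  by rewrite opprB addrA subrK.
apply: (exponential_quadrature_error hT K1 L0 linS S0 SD contS SK SL hc01 moment_lt moment_s
  hu hg0 hg hgs1 htau hgrid hkappa hstep (v := fun n => un n - z (grid tau n))) nN.
- by rewrite hun0 grid0 hu0.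
- by move=> j jN; rewrite hun// [_ + z _ + _]addrAC addrK.
Qed.
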